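(* Let $p\ge 1$, let $f:\mathbb{R}^p\to\mathbb{R}$ be three times differentiable, let $\pi$ be the probability measure on $\mathbb{R}^p$ with density proportional to $e^{-f}$, and let $m,M,M_1,M_3>0$ and $\delta>0$ be fixed. Choose $$a>\frac{2}{3m},\qquad k_0\ge\max\left\{1,\frac{a(m+M)}{2}\right\},$$ and set, for $k\ge0$, $$h_k:=\frac{a}{k+k_0},\qquad c_k^2:=\left(\frac{9m\delta^2h_k}{2M_3^2p^3}\right)^{1/3},\quad c_k>0.$$ Let $(X_k)_{k\ge0}$ be the noisy LMC-SPSA chain with stepsizes $h_k$ and perturbation magnitudes $c_k$, and let $\nu_k$ be the law of $X_k$. Assume: (A1) $f(x)-f(y)-\nabla f(y)^\top(x-y)\ge \frac m2\|x-y\|_2^2$ for all $x,y\in\mathbb{R}^p$; (A2) $\|\nabla f(x)-\nabla f(y)\|_2\le M\|x-y\|_2$ for all $x,y\in\mathbb{R}^p$; (A3) $\max_{i,j,l}\left|\frac{\partial^3 f(x)}{\partial x_i\partial x_j\partial x_l}\right|\le M_3$ for all $x\in\mathbb{R}^p$; (A4) $\sup_{k\ge0}\mathbb{E}\big[\|\nabla f(X_k)\|_2\big]\le M_1$; (A5) for every $k$, $\mathbb{E}[\varepsilon_k^{(+)}-\varepsilon_k^{(-)}\mid\mathcal F_k,\Delta_k]=0$ and $\mathbb{E}[(\varepsilon_k^{(+)}-\varepsilon_k^{(-)})^2\mid\mathcal F_k,\Delta_k]\le 2\delta^2$, and $\varepsilon_k^{(+)}-\varepsilon_k^{(-)}$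 is conditionally independent of $\xi_k$ given $(\mathcal F_k,\Delta_k)$. Then there exists a finite constant $D>0$, independent of $k$, such that for every $k\ge0$, $$W_2^2(\nu_k,\pi)\le\frac{D}{(k+k_0)^{2/3}},\qquad W_2(\nu_k,\pi)\le\frac{\sqrt D}{(k+k_0)^{1/3}}=\mathcal O(k^{-1/3}).$$ Up to problem-dependent constants, the leading noise-dependent contribution to this bound scales as $\mathcal O(\delta^{2/3}p\,k^{-1/3})$.
   Context: $W_2(\mu,\nu)=\inf_{U\sim\mu,V\sim\nu}(\mathbb{E}\|U-V\|_2^2)^{1/2}$ (infimum over all couplings) is the quadratic Wasserstein distance on $\mathbb{R}^p$; $W_2(\nu_0,\pi)$ is taken to be finite. The constant $M_1$ may depend on the dimension $p$, but is assumed to grow at most linearly, $M_1=O(p)$. Noisy LMC-SPSA. Given an initial state $X_0\sim\nu_0$, stepsizes $h_k>0$ and perturbation magnitudes $c_k>0$, at each iteration $k\ge0$: draw $\Delta_k\in\{\pm1\}^p$ with i.i.d. Rademacher coordinates, independent of the past; obtain the two noisy values $\widetilde f(X_k\pm c_k\Delta_k)=f(X_k\pm c_k\Delta_k)+\varepsilon_k^{(\pm)}$, where $\varepsilon_k^{(\pm)}$ are random measurement noises; form $$\widetilde G_k=\frac{\widetilde f(X_k+c_k\Delta_k)-\widetilde f(X_k-c_k\Delta_k)}{2c_k}\,\Delta_k^{-1},$$ where $\Delta_k^{-1}$ is the entrywise inverse (equal to $\Delta_k$ here); and set $X_{k+1}=X_k-h_k\widetilde G_k+\sqrt{2h_k}\,\xi_k$,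 where $\xi_k\sim\mathcal N(0,I_p)$ is a fresh Gaussian vector independent of the past and of $\Delta_k$. $\mathcal F_k$ denotes the history before the two oracle evaluations at iteration $k$ (so $X_k$ is $\mathcal F_k$-measurable and $\Delta_k$ is independent of $\mathcal F_k$). *)

(* Defs.v *)
From HB Require Import structures.
From mathcomp Require Import all_boot all_order all_algebra.
From mathcomp Require Import all_classical all_reals all_analysis.

Set Implicit Arguments.
Unset Strict Implicit.
Unset Printing Implicit Defensive.

Import Order.TTheory GRing.Theory Num.Theory.
Import numFieldNormedType.Exports.

Local Open Scope classical_set_scope.
Local Open Scope ring_scope.

(* The topology that the library puts on ['rV[R]_n] is that of the sup norm;
   its Borel sigma-algebra is the one generated by the coordinates, as for
   [n.-tuple R]. *)
Definition rV_display : measure_display -> measure_display.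
Proof. exact. Qed.

Section measurable_rV.
Context {R : realType} (n : nat).

Let coord (i : 'I_n) (v : 'rV[R]_n) : R := v 0 i.

Let rV_set0 : g_sigma_preimage coord set0.
Proof. exact: sigma_algebra0. Qed.

Let rV_setC A : g_sigma_preimage coord A -> g_sigma_preimage coord (~` A).
Proof. exact: sigma_algebraC. Qed.

Let rV_bigcup (F : _^nat) : (forall i, g_sigma_preimage coord (F i)) ->
  g_sigma_preimage coord (\bigcup_i (F i)).
Proof. exact: sigma_algebra_bigcup. Qed.

HB.instance Definition _ :=
  @isMeasurable.Build (rV_display default_measure_display)
    'rV[R]_n (g_sigma_preimage coord) rV_set0 rV_setC rV_bigcup.

Lemma measurable_rV_coord (i : 'I_n) :
  measurable_fun setT (fun v : 'rV[R]_n => v 0 i).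
Proof.
move=> _ Y mY; rewrite setTI; apply: sub_sigma_algebra => /=.
rewrite -bigcup_seq/=; exists i => /=; first by rewrite mem_index_enum.
by exists Y => //; rewrite setTI.
Qed.

Lemma measurable_fun_rV d (T : measurableType d) (f : T -> 'rV[R]_n) :
  (forall i, measurable_fun setT (fun t => f t 0 i)) -> measurable_fun setT f.
Proof.
move=> mf _ B; rewrite setTI.
move: B; apply: smallest_sub.
  split => [|A mA|F mF].
  - by rewrite preimage_set0.
  - by rewrite setTD preimage_setC; apply: measurableC.
  - by rewrite preimage_bigcup; apply: bigcupT_measurable.
rewrite -bigcup_seq => A [i _ [B mB <-]]; rewrite setTI.
by have := mf i measurableT B mB; rewrite setTI.
Qed.

End measurable_rV.

Section rV_cons.
Context {R : realType} (n : nat).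

Definition rV_cons (z : R * 'rV[R]_n) : 'rV[R]_n.+1 :=
  \row_i (if unlift ord0 i is Some j then z.2 0 j else z.1).

Definition rV_uncons (v : 'rV[R]_n.+1) : R * 'rV[R]_n :=
  (v 0 ord0, \row_j v 0 (lift ord0 j)).

Lemma rV_consK : cancel rV_cons rV_uncons.
Proof.
move=> [x v]; rewrite /rV_uncons /rV_cons; congr pair.
  by rewrite mxE unlift_none.
by apply/rowP => j; rewrite !mxE liftK.
Qed.

Lemma measurable_rV_cons : measurable_fun setT rV_cons.
Proof.
apply: measurable_fun_rV => i; under eq_fun do rewrite mxE.
case: unliftP => [j _|_]; last exact: measurable_fst.
exact: (measurableT_comp (measurable_rV_coord j) measurable_snd).
Qed.

Lemma measurable_rV_uncons : measurable_fun setT rV_uncons.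
Proof.
apply/measurable_fun_pairP; split; first exact: measurable_rV_coord.
apply: measurable_fun_rV => j.
under eq_fun do rewrite mxE.
exact: measurable_rV_coord.
Qed.

End rV_cons.

Section lebesgue_cons.
Local Open Scope ereal_scope.
Context {R : realType} (n : nat).
Variable mu : {sigma_finite_measure set 'rV[R]_n -> \bar R}.

Definition lebesgue_cons (A : set 'rV[R]_n.+1) : \bar R :=
  (lebesgue_measure \x mu) (@rV_cons R n @^-1` A).

Let mpre (A : set 'rV[R]_n.+1) : measurable A ->
  measurable (@rV_cons R n @^-1` A).
Proof.
by move=> mA; rewrite -[X in measurable X]setTI; exact: measurable_rV_cons.
Qed.

Let lebesgue_cons0 : lebesgue_cons set0 = 0.
Proof. by rewrite /lebesgue_cons preimage_set0 measure0. Qed.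

Let lebesgue_cons_ge0 A : 0 <= lebesgue_cons A.
Proof. exact: measure_ge0. Qed.

Let lebesgue_cons_sigma_additive : semi_sigma_additive lebesgue_cons.
Proof.
move=> F mF tF mUF; rewrite /lebesgue_cons preimage_bigcup.
apply: measure_semi_sigma_additive.
- by move=> k; exact: mpre.
- apply/trivIsetP => /= i j _ _ ij; rewrite -preimage_setI.
  by move/trivIsetP : tF => /(_ _ _ _ _ ij) ->//; rewrite preimage_set0.
- by rewrite -preimage_bigcup; exact: mpre.
Qed.

HB.instance Definition _ := isMeasure.Build _ _ _ lebesgue_cons
  lebesgue_cons0 lebesgue_cons_ge0 lebesgue_cons_sigma_additive.

Let lebesgue_cons_sigma_finite : sigma_finite setT lebesgue_cons.
Proof.
have /sigma_finiteP[F [TF ndF Foo]] := sigma_finiteT (@lebesgue_measure R).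
have /sigma_finiteP[G [TG ndG Goo]] := sigma_finiteT mu.
exists (fun k => @rV_uncons R n @^-1` (F k `*` G k)).
  rewrite -preimage_bigcup (_ : \bigcup_k (F k `*` G k) = setT) ?preimage_setT//.
  rewrite -setXTT TF TG predeqE => -[x y]; split.
    by move=> [k _ []/= ? ?]; split; exists k.
  move=> [/= [k _ Fkx] [l _ Gly]]; exists (maxn k l) => //; split.
  - by move: x Fkx; exact/subsetPset/ndF/leq_maxl.
  - by move: y Gly; exact/subsetPset/ndG/leq_maxr.
move=> k; have [mF Fk] := Foo k; have [mG Gk] := Goo k; split.
  rewrite -[X in measurable X]setTI; apply: measurable_rV_uncons => //.
  exact: measurableX.
rewrite /lebesgue_cons -comp_preimage (_ : _ \o _ = id); last first.
  by apply/funext => z; exact: rV_consK.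
rewrite preimage_id product_measure1E// lte_mul_pinfty// ge0_fin_numE//.
Qed.

HB.instance Definition _ := Measure_isSigmaFinite.Build _ _ _ lebesgue_cons
  lebesgue_cons_sigma_finite.

End lebesgue_cons.

Fixpoint lebesgue_rV {R : realType} (n : nat) :
    {sigma_finite_measure set 'rV[R]_n -> \bar R} :=
  match n with
  | 0 => \d_(0 : 'rV[R]_0)
  | n'.+1 => lebesgue_cons (lebesgue_rV n')
  end.

Definition dotV {R : realType} {p : nat} (u v : 'rV[R]_p) : R :=
  \sum_(i < p) u 0 i * v 0 i.

(* Euclidean norm; the library's [`|x|] on row vectors is the sup norm. *)
Definition norm2 {R : realType} {p : nat} (x : 'rV[R]_p) : R :=
  Num.sqrt (\sum_(i < p) x 0 i ^+ 2).

Definition partial {R : realType} {p : nat} (i : 'I_p) (f : 'rV[R]_p -> R)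
    (x : 'rV[R]_p) : R :=
  'D_(delta_mx 0 i) f x.

Definition grad {R : realType} {p : nat} (f : 'rV[R]_p -> R)
    (x : 'rV[R]_p) : 'rV[R]_p :=
  \row_i partial i f x.

(* [n] times Frechet differentiable on R^p: the k-th differential is
   differentiable iff all its coordinates, the k-th partial derivatives, are. *)
Fixpoint times_differentiable {R : realType} {p : nat} (n : nat)
    (f : 'rV[R]_p -> R) : Prop :=
  match n with
  | 0 => True
  | n'.+1 => (forall x, differentiable f x) /\
             (forall i, times_differentiable n' (partial i f))
  end.

(* [Z] is forced to be the integral of exp(-f), since [pi] has mass 1. *)
Definition gibbs_measure {R : realType} {p : nat} (f : 'rV[R]_p -> R)
    (pi : probability 'rV[R]_p R) : Prop :=
  exists2 Z : R, 0 < Z & forall A, measurable A ->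
    pi A = (\int[lebesgue_rV p]_(x in A) (Z^-1 * expR (- f x))%:E)%E.

Section wasserstein.
Local Open Scope ereal_scope.
Context {R : realType} {p : nat}.

Definition coupling (mu nu : probability 'rV[R]_p R) :
    set (probability ('rV[R]_p * 'rV[R]_p)%type R) :=
  [set gamma | forall A, measurable A ->
     gamma (A `*` setT) = mu A /\ gamma (setT `*` A) = nu A].

Definition wasserstein2 (mu nu : probability 'rV[R]_p R) : \bar R :=
  ereal_inf [set (\int[gamma]_z (norm2 (z.1 - z.2) ^+ 2)%:E) `^ 2^-1
            | gamma in coupling mu nu].

End wasserstein.

Section probability_notions.
Context {R : realType} {d : measure_display} {Omega : measurableType d}
  (P : probability Omega R).

Definition indep_sigma (G H : set (set Omega)) : Prop :=
  forall A B, G A -> H B -> P (A `&` B) = (P A * P B)%E.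

Definition is_cond_exp (G : set (set Omega)) (X Y : Omega -> R) : Prop :=
  [/\ P.-integrable setT (EFin \o X),
      P.-integrable setT (EFin \o Y),
      (forall B : set R, measurable B -> G (Y @^-1` B)) &
      forall A, G A ->
        (\int[P]_(w in A) (Y w)%:E = \int[P]_(w in A) (X w)%:E)%E].

Definition cond_indep d1 d2 (T1 : measurableType d1) (T2 : measurableType d2)
    (G : set (set Omega)) (Y : Omega -> T1) (Z : Omega -> T2) : Prop :=
  forall (A : set T1) (B : set T2), measurable A -> measurable B ->
    exists u v : Omega -> R,
      [/\ is_cond_exp G (\1_(Y @^-1` A)) u,
          is_cond_exp G (\1_(Z @^-1` B)) v &
          is_cond_exp G (\1_(Y @^-1` A `&` Z @^-1` B)) (u \* v)].

Definition iid_coordinates {p : nat} (mu : set R -> \bar R)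
    (X : Omega -> 'rV[R]_p) : Prop :=
  forall A : 'I_p -> set R, (forall i, measurable (A i)) ->
    P [set w | forall i, A i (X w 0 i)] = (\prod_(i < p) mu (A i))%E.

End probability_notions.

Definition rademacher {R : realType} (A : set R) : \bar R :=
  ((2^-1)%:E * (\d_(1%R : R) A + \d_((- 1)%R : R) A))%E.

Definition stepsize {R : realType} (a k0 : R) (k : nat) : R := a / (k%:R + k0).

Definition perturbation {R : realType} (m M3 delta : R) (p : nat)
    (h : nat -> R) (k : nat) : R :=
  Num.sqrt ((9 * m * delta ^+ 2 * h k / (2 * M3 ^+ 2 * p%:R ^+ 3)) `^ 3^-1).

Section noisy_lmc_spsa.
Context {R : realType} {d : measure_display} {Omega : measurableType d}
  (P : probability Omega R) {p : nat}.
Implicit Types (X Delta xi : nat -> {RV P >-> 'rV[R]_p})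
  (epsp epsm : nat -> {RV P >-> R}).

(* The natural filtration: no randomness is assumed beyond the initial state,
   the directions, the measurement noises and the Gaussian vectors. *)
Definition history X Delta xi epsp epsm (k : nat) : set (set Omega) :=
  <<s g_sigma_algebra_preimage (X 0) `|`
      \bigcup_(j in [set j | (j < k)%N])
        (g_sigma_algebra_preimage (Delta j) `|`
         g_sigma_algebra_preimage (xi j) `|`
         g_sigma_algebra_preimage (epsp j) `|`
         g_sigma_algebra_preimage (epsm j)) >>.

Definition history_dir X Delta xi epsp epsm (k : nat) : set (set Omega) :=
  <<s history X Delta xi epsp epsm k `|`
      g_sigma_algebra_preimage (Delta k) >>.

Definition spsa_gradient (f : 'rV[R]_p -> R) (c : R) (x D : 'rV[R]_p)
    (ep em : R) : 'rV[R]_p :=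
  (((f (x + c *: D) + ep) - (f (x - c *: D) + em)) / (2 * c))
    *: map_mx GRing.inv D.

Record noisy_lmc_spsa (f : 'rV[R]_p -> R) (h c : nat -> R)
    X Delta xi epsp epsm : Prop := {
  spsa_dir_sign : forall k w i, Delta k w 0 i = 1 \/ Delta k w 0 i = - 1;
  spsa_dir_rademacher : forall k, iid_coordinates P rademacher (Delta k);
  spsa_dir_indep : forall k,
    indep_sigma P (history X Delta xi epsp epsm k)
      (g_sigma_algebra_preimage (Delta k));
  spsa_gauss : forall k, iid_coordinates P (normal_prob 0 1) (xi k);
  spsa_gauss_indep : forall k,
    indep_sigma P (history_dir X Delta xi epsp epsm k)
      (g_sigma_algebra_preimage (xi k));
  spsa_step : forall k w,
    X k.+1 w = X k w
      - h k *: spsa_gradient f (c k) (X k w) (Delta k w) (epsp k w) (epsm k w)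
      + Num.sqrt (2 * h k) *: xi k w }.

End noisy_lmc_spsa.

Definition strong_convexity {R : realType} {p : nat} (f : 'rV[R]_p -> R)
    (m : R) : Prop :=
  forall x y, m / 2 * norm2 (x - y) ^+ 2 <= f x - f y - dotV (grad f y) (x - y).

Definition gradient_lipschitz {R : realType} {p : nat} (f : 'rV[R]_p -> R)
    (M : R) : Prop :=
  forall x y, norm2 (grad f x - grad f y) <= M * norm2 (x - y).

Definition third_derivative_bound {R : realType} {p : nat}
    (f : 'rV[R]_p -> R) (M3 : R) : Prop :=
  forall x i j l, `|partial i (partial j (partial l f)) x| <= M3.

Definition gradient_moment_bound {R : realType} {d : measure_display}
    {Omega : measurableType d} (P : probability Omega R) {p : nat}
    (f : 'rV[R]_p -> R) (X : nat -> {RV P >-> 'rV[R]_p}) (M1 : R) : Prop :=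
  (ereal_sup (range (fun k => 'E_P[fun w => norm2 (grad f (X k w))]))
     <= M1%:E)%E.

Record noise_assumption {R : realType} {d : measure_display}
    {Omega : measurableType d} (P : probability Omega R) {p : nat}
    (X Delta xi : nat -> {RV P >-> 'rV[R]_p})
    (epsp epsm : nat -> {RV P >-> R}) (delta : R) : Prop := {
  noise_centered : forall k,
    is_cond_exp P (history_dir X Delta xi epsp epsm k)
      (fun w => epsp k w - epsm k w) (cst 0);
  noise_variance : forall k, exists2 V : Omega -> R,
    is_cond_exp P (history_dir X Delta xi epsp epsm k)
      (fun w => (epsp k w - epsm k w) ^+ 2) V &
    {ae P, forall w, V w <= 2 * delta ^+ 2};
  noise_cond_indep : forall k,
    cond_indep P (history_dir X Delta xi epsp epsm k)
      (fun w => epsp k w - epsm k w) (xi k) }.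

(* Main.v *)
(* The chain is coupled with a stationary Metropolis-adjusted Langevin chain Y
   with the same step sizes and the same Gaussian vectors: its law is exactly pi
   at every time, and since a proposal is rejected with probability O(h_k) times
   moments, the adjustment costs only O(h_k^2) in mean square. The coupling is
   kept such that the conditional law of Y_k given the randomness of X depends on
   the history only; hence, given (X_k, Y_k), the direction and the Gaussian
   vector of step k keep their laws and the noise stays centered.

   The average of the SPSA gradient over the 2^p sign vectors differs from the
   gradient by O(p M3 c_k^2) per coordinate, and the noise contributes
   h_k^2 p delta^2 / (2 c_k^2). With n = k + k0 and the prescribed c_k both are
   at most of order delta^(4/3) p^2 n^(-2/3) / n, so that e_k = E |X_k - Y_k|^2
   satisfies
     e_(k+1) <= (1 - lam/n + K/n^2) e_k + b n^(-2/3)/n + K/n^2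
   with lam = 3 m a / 2 > 1 and b = B delta^(4/3) p^2, B free of delta and p.
   Therefore e_k <= 4 b n^(-2/3) + K' n^(-5/6). *)
From HB Require Import structures.
From mathcomp Require Import all_boot all_order all_algebra.
From mathcomp Require Import all_classical all_reals all_analysis measurable_realfun.
From mathcomp Require Import ring lra.
Require Import Defs.

Set Implicit Arguments.
Unset Strict Implicit.
Unset Printing Implicit Defensive.

Import Order.TTheory GRing.Theory Num.Theory.
Import numFieldNormedType.Exports.

Local Open Scope classical_set_scope.
Local Open Scope ring_scope.

(** * Densities and Gaussian vectors *)

(** Comparison with the Langevin diffusion would require stochastic calculus; a reversible discrete
    chain needs only detailed balance, and gradient moments are taken under the fixed law pi. The
    accept-reject draw is integrated out, so the pair lives on [Omega * 'rV[R]_p] and nothing is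
    added to [Omega].

    A rejection displaces the gap by O(sqrt h) with probability O(h): the square costs O(h^2), and
    so does the cross term once Young's inequality with weight eta h has split it, at the price of a
    factor 1 + eta h and of sixth moments. The gradient bias is split likewise. With eta = m/4 the
    two factors reduce the contraction 1 - 2 m h to 1 - (3/2) m h, whence lam and the condition on
    a.

    The obstacle is dependence: Y is built from past Gaussian vectors, while directions and noise
    are controlled only given the history. The induction therefore carries a property of the joint
    law: functions on [Omega] with equal integrals over the history are not told apart by events of
    Y.

    The prescribed c_k^2 gives the bias h c_k^4 and the noise delta^2 h^2 / c_k^2 the same order in
    n and delta. *)

Definition pushforward_measure d d' (T : measurableType d)
    (T' : measurableType d') (R : realType) (mu : {measure set T -> \bar R})
    (f : T -> T') (mf : measurable_fun setT f) : {measure set T' -> \bar R} :=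
  measure_function_pushforward__canonical__measure_function_Measure mu mf.

Definition mfun_of d d' (T : measurableType d) (T' : measurableType d')
    (f : T -> T') (mf : measurable_fun setT f) : {mfun T >-> T'} :=
  HB.pack f (isMeasurableFun.Build _ _ _ _ _ mf).

Section density.
Local Open Scope ereal_scope.
Context d (T : measurableType d) (R : realType).
Variables (mu nu : {measure set T -> \bar R}) (g : T -> R).
Hypothesis mg : measurable_fun setT g.
Hypothesis g0 : forall x, (0 <= g x)%R.
Hypothesis nuE : forall A, measurable A -> nu A = \int[mu]_(x in A) (g x)%:E.

Import HBNNSimple.

Lemma nnsfun_integral_density (s : {nnsfun T >-> R}) :
  \int[nu]_x (s x)%:E = \int[mu]_x ((s x)%:E * (g x)%:E).
Proof.
under eq_integral do rewrite fimfunE -fsumEFin//.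
rewrite ge0_integral_fsum//; last 2 first.
- by move=> r; exact/measurable_EFinP/measurable_funM.
- by move=> r x _; rewrite nnfun_muleindic_ge0.
under [RHS]eq_integral.
  move=> x _; rewrite fimfunE -fsumEFin// muleC ge0_mule_fsumr; last first.
    by move=> r; rewrite nnfun_muleindic_ge0.
  over.
rewrite [RHS]ge0_integral_fsum//; last 2 first.
- move=> r; apply: emeasurable_funM; first exact/measurable_EFinP.
  exact/measurable_EFinP/measurable_funM.
- by move=> r x _; apply: mule_ge0; [rewrite lee_fin|exact: nnfun_muleindic_ge0].
apply: eq_fsbigr => r _; rewrite integralZl_indic_nnsfun// integral_indic//=.
rewrite setIT nuE// integral_mkcond.
(* A nonnegative simple function never takes a negative value, so that level set is empty. For
   [r >= 0] the constant can be taken out of the integral. *)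
have [r0|r0] := ltP r 0%R.
  rewrite (preimage_nnfun0 _ r0)// -[X in _ * X]integral_mkcond.
  rewrite integral_set0 mule0.
  by under eq_integral do rewrite indic0 mulr0 mule0; rewrite integral0.
rewrite -ge0_integralZl_EFin//; last 2 first.
- by move=> x _; apply: erestrict_ge0 => y _; rewrite lee_fin.
- by apply/(measurable_restrictT _ _).1 => //; apply/measurable_EFinP; exact: measurable_funS mg.
apply: eq_integral => x _; rewrite patchE indicE.
by case: ifPn => _; rewrite ?mulr1 ?mulr0 ?mule0// muleC.
Qed.

(** Monotone convergence lifts the identity from simple functions. [nu] is any measure given by
    integrals of [g], so the statement serves both [measure_with_density] and the Gibbs measure, of
    which only such a formula is assumed. *)
Lemma ge0_integral_density (f : T -> \bar R) : measurable_fun setT f ->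
  (forall x, 0 <= f x) -> \int[nu]_x f x = \int[mu]_x (f x * (g x)%:E).
Proof.
move=> mf f0; pose f_ := nnsfun_approx measurableT mf.
transitivity (limn (fun n => \int[nu]_x (f_ n x)%:E)).
  rewrite -monotone_convergence//=.
  - by apply: eq_integral => x _; apply/esym/cvg_lim => //;
      exact: cvg_nnsfun_approx.
  - by move=> n; exact/measurable_EFinP.
  - by move=> n x _; rewrite lee_fin.
  - by move=> x _ a b ab; rewrite lee_fin//; exact/lefP/nd_nnsfun_approx.
rewrite [X in limn X](_ : _ = fun n => \int[mu]_x ((f_ n x)%:E * (g x)%:E)).
  rewrite -monotone_convergence//=.
  - apply: eq_integral => x _; apply/cvg_lim => //.
    under eq_fun do rewrite muleC. rewrite [f x * _]muleC.
    by apply: cvgeZl => //; exact: cvg_nnsfun_approx.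
  - by move=> n; apply: emeasurable_funM; exact/measurable_EFinP.
  - by move=> n x _; rewrite mule_ge0// lee_fin.
  - move=> x _ a b ab; rewrite lee_wpmul2r// lee_fin//.
    exact/lefP/nd_nnsfun_approx.
by apply/funext => n; exact: nnsfun_integral_density.
Qed.

End density.

Section density_measure.
Local Open Scope ereal_scope.
Context d (T : measurableType d) (R : realType).
Variables (mu : {measure set T -> \bar R}) (g : T -> R).
Hypothesis mg : measurable_fun setT g.
Hypothesis g0 : forall x, (0 <= g x)%R.

Definition density_measure (A : set T) : \bar R := \int[mu]_(x in A) (g x)%:E.

Let density0 : density_measure set0 = 0.
Proof. by rewrite /density_measure integral_set0. Qed.

Let density_ge0 A : 0 <= density_measure A.
Proof. by apply: integral_ge0 => x _; rewrite lee_fin. Qed.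

Let density_sigma_additive : semi_sigma_additive density_measure.
Proof.
move=> A mA tA mUA; rewrite /density_measure/= ge0_integral_bigcup//=.
- by apply: is_cvg_ereal_nneg_natsum_cond => n _ _; exact: density_ge0.
- by apply/measurable_EFinP; exact: measurable_funS mg.
- by move=> x _; rewrite lee_fin.
Qed.

Definition measure_with_density : {measure set T -> \bar R} :=
  HB.pack density_measure (isMeasure.Build _ _ _ density_measure
    density0 density_ge0 density_sigma_additive).

End density_measure.

Lemma normal_pdf_affine (R : realType) (m s x : R) : 0 < s ->
  s * normal_pdf m s (m + s * x) = normal_pdf 0 1 x.
Proof.
move=> s0; rewrite /normal_pdf gt_eqF// oner_eq0 /normal_peak /normal_fun.
rewrite mulrA; congr (_ * expR _).
  rewrite -[s ^+ 2 * pi *+ 2]mulrnAr sqrtrM ?sqr_ge0// sqrtr_sqr gtr0_norm//.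
  by rewrite expr1n mul1r invfM mulrA divff ?mul1r// gt_eqF.
rewrite subr0 addrC addKr exprMn !mulNr expr1n; congr (- _).
by field; rewrite gt_eqF.
Qed.

Section affine.
Local Open Scope ereal_scope.
Context (R : realType) (m s : R).
Hypothesis s0 : (0 < s)%R.
Local Notation mu := (@lebesgue_measure R).
Let F : measurableTypeR R -> measurableTypeR R := fun x => (m + s * x)%R.

Let mF : measurable_fun setT F.
Proof. by apply: measurable_funD => //; exact: measurable_funM. Qed.

(** Uniqueness of Lebesgue measure: [s] times the pushforward gives each interval ]a, b] its length,
    because the preimage has length (b - a) / s. *)
Lemma lebesgue_measure_affine (A : set R) : measurable A ->
  mu A = s%:E * pushforward mu F A.
Proof.
move=> mA; pose k := NngNum (ltW s0).
have /(_ (mscale k (pushforward_measure mu mF))) := @lebesgue_measure_unique R.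
rewrite -[RHS]/(mscale k (pushforward_measure mu mF) A); apply => //.
move=> _ [[a b]] _ <-; rewrite -[RHS]/(s%:E * mu (F @^-1` [set` `]a, b]%R])).
rewrite (_ : F @^-1` _ = [set` `]((a - m) / s)%R, ((b - m) / s)%R]%R]); last first.
  apply/seteqP; split => x /=; rewrite !in_itv/= /F.
    by move=> /andP[ax xb]; rewrite ltr_pdivrMr// ler_pdivlMr//; lra.
  by rewrite ltr_pdivrMr// ler_pdivlMr// => /andP[ax xb]; apply/andP; split; lra.
rewrite !lebesgue_measure_itv/= !lte_fin ltr_pM2r ?invr_gt0// ltrD2r.
case: ifPn => ab; last by rewrite mule0.
rewrite -EFinD -EFinM; congr EFin.
by rewrite -mulrBl mulrCA divff ?gt_eqF// mulr1; lra.
Qed.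

Lemma ge0_integral_affine (f : R -> \bar R) : measurable_fun setT f ->
  (forall x, 0 <= f x) ->
  \int[mu]_x f x = s%:E * \int[mu]_x f (m + s * x)%R.
Proof.
move=> mf f0; pose k := NngNum (ltW s0).
transitivity (\int[mscale k (pushforward_measure mu mF)]_x f x).
  apply: eq_measure_integral => //= A mA _.
  by rewrite lebesgue_measure_affine.
by rewrite ge0_integral_mscale// ge0_integral_pushforward.
Qed.

Lemma normal_prob_affine (A : set R) : measurable A ->
  normal_prob m s A = normal_prob 0 1 [set x | A (m + s * x)%R].
Proof.
move=> mA; have mB : measurable [set x | A (m + s * x)%R].
  by have := mF measurableT mA; rewrite setTI.
rewrite /normal_prob [LHS]integral_mkcond ge0_integral_affine//; last 2 first.
- apply/(measurable_restrictT _ _).1 => //.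
  apply/measurable_EFinP; apply: measurable_funS (measurable_normal_pdf m s) => //.
- by move=> x; apply: erestrict_ge0 => y _; rewrite lee_fin normal_pdf_ge0.
rewrite [RHS]integral_mkcond -ge0_integralZl_EFin//; last 3 first.
- move=> x _; apply: erestrict_ge0 => y _; rewrite lee_fin normal_pdf_ge0//.
- have : measurable_fun setT ((fun x => (normal_pdf m s x)%:E) \_ A).
    apply/(measurable_restrictT _ _).1 => //.
    by apply/measurable_EFinP; apply: measurable_funS (measurable_normal_pdf m s).
  by move=> h; exact: (measurableT_comp h).
- exact: ltW.
apply: eq_integral => x _; rewrite !patchE.
have -> : (m + s * x \in A)%R = (x \in [set x | A (m + s * x)%R]).
  by apply/idP/idP => /[!inE].
case: ifPn => _; last by rewrite mule0.
by rewrite -EFinM normal_pdf_affine.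
Qed.

End affine.

(** * Boxes, open sets and measurability on row vectors *)

Section rV_measure.
Context (R : realType) (p : nat).
Implicit Types (A : 'I_p -> set R).

Definition rV_box A : set 'rV[R]_p := [set v | forall i, A i (v 0 i)].

Lemma measurable_rV_box A : (forall i, measurable (A i)) ->
  measurable (rV_box A).
Proof.
move=> mA; rewrite (_ : rV_box A =
    \bigcap_(i in [set: 'I_p]) ((fun v : 'rV[R]_p => v 0 i) @^-1` A i)).
  apply: fin_bigcap_measurable => // i _.
  by rewrite -[X in measurable X]setTI; exact: measurable_rV_coord.
by apply/seteqP; split => v /= vA i *; exact: vA.
Qed.

Lemma measurable_rVE : @measurable _ 'rV[R]_p =
  <<s [set rV_box A | A in [set A | forall i, measurable (A i)]] >>.
Proof.
apply/seteqP; split => B; last first.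
  apply: smallest_sub; first exact: sigma_algebra_measurable.
  by move=> _ [A mA <-]; exact: measurable_rV_box.
apply: smallest_sub; first exact: smallest_sigma_algebra.
rewrite -bigcup_seq => C [i _ [D mD <-]]; rewrite setTI.
apply: sub_sigma_algebra.
exists (fun j => if j == i then D else setT).
  by move=> j; case: ifPn.
apply/seteqP; split => v /=; first by move/(_ i); rewrite eqxx.
by move=> Dv j; case: eqP => // ->.
Qed.

(** Boxes are stable under intersection and generate the sigma-algebra; this is how laws with
    independent coordinates are identified. *)
Lemma rV_measure_unique (mu nu : {measure set 'rV[R]_p -> \bar R}) :
  (mu setT < +oo)%E ->
  (forall A, (forall i, measurable (A i)) -> mu (rV_box A) = nu (rV_box A)) ->
  forall B, measurable B -> mu B = nu B.
Proof.
move=> muoo munu; apply: (measure_unique _ (fun=> setT) measurable_rVE).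
- move=> _ _ [A mA <-] [B mB <-]; exists (fun i => A i `&` B i).
    by move=> i; exact: measurableI.
  apply/seteqP; split => v /=; first by move=> AB; split => i; have [] := AB i.
  by move=> [vA vB] i; split.
- by move=> _; exists (fun=> setT) => //; apply/seteqP; split.
- by apply/seteqP; split => // v _; exists 0%N.
- by move=> _ [A mA <-]; exact: munu.
- by [].
Qed.

(** The topology comes from the sup norm and the sigma-algebra from the coordinates; they meet
    because an open set is the union of the countably many boxes with rational ends that it
    contains. *)
Lemma open_measurable_rV (U : set 'rV[R]_p) : open U -> measurable U.
Proof.
move=> oU.
pose box (qr : 'rV[rat]_p * 'rV[rat]_p) : set 'rV[R]_p :=
  rV_box (fun i => [set` `]ratr (qr.1 0 i) : R, ratr (qr.2 0 i)[%R]).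
(* The boxes are enumerated through [pickle]; numbers that code no box and boxes that leave [U]
   contribute the empty set. *)
pose F n : set 'rV[R]_p := if unpickle n is Some qr
  then (if `[< box qr `<=` U >] then box qr else set0) else set0.
rewrite (_ : U = \bigcup_n F n).
  apply: bigcupT_measurable => n; rewrite /F.
  case: unpickle => [qr|//]; case: asboolP => // _.
  by apply: measurable_rV_box.
apply/seteqP; split => [x Ux|x [n _]]; last first.
  by rewrite /F; case: unpickle => // qr; case: asboolP => // + xqr; apply.
have /nbhs_ballP[e /= e0 xeU] := open_nbhs_nbhs (conj oU Ux).
have /choice[q qP] (i : 'I_p) : exists q : rat, ratr q \in `]x 0 i - e, x 0 i[.
  by apply: rat_in_itvoo; rewrite ltrBlDr ltrDl.
have /choice[r rP] (i : 'I_p) : exists r : rat, ratr r \in `]x 0 i, x 0 i + e[.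
  by apply: rat_in_itvoo; rewrite ltrDl.
exists (pickle (\row_i q i, \row_i r i)) => //; rewrite /F pickleK.
rewrite asboolT; last first.
  move=> v vqr; apply: xeU; split => // i j; rewrite ord1.
  have := vqr j; rewrite /= in_itv/= !mxE => /andP[qv vr].
  have := qP j; rewrite in_itv/= => /andP[xq _].
  have := rP j; rewrite in_itv/= => /andP[_ xr].
  rewrite -ball_normE /ball_ /= ltr_norml; apply/andP; split; lra.
move=> i; rewrite /= in_itv/= !mxE.
have := qP i; rewrite in_itv/= => /andP[_ ->].
by have := rP i; rewrite in_itv/= => /andP[-> _].
Qed.

Lemma continuous_measurable_rV (f : 'rV[R]_p -> R) : continuous f ->
  measurable_fun setT f.
Proof.
move=> /continuousP cf; apply: (measurability _ (RGenOpens.measurableE R)) => //.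
move=> _ [_ [a [b ->]] <-]; rewrite setTI.
by apply: open_measurable_rV; apply: cf; exact: interval_open.
Qed.

End rV_measure.

Section lebesgue_rV_prod.
Local Open Scope ereal_scope.
Context (R : realType).

Lemma ge0_integral_lebesgue_cons n
    (mu : {sigma_finite_measure set 'rV[R]_n -> \bar R})
    (f : 'rV[R]_n.+1 -> \bar R) : measurable_fun setT f ->
  (forall v, 0 <= f v) ->
  \int[lebesgue_cons mu]_v f v =
  \int[lebesgue_measure]_x \int[mu]_v f (rV_cons (x, v)).
Proof.
move=> mf f0.
transitivity (\int[pushforward_measure (lebesgue_measure \x mu)%E
    (@measurable_rV_cons R n)]_v f v).
  by apply: eq_measure_integral.
rewrite ge0_integral_pushforward//=; last exact: measurable_rV_cons.
rewrite fubini_tonelli1//.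
exact: (measurableT_comp mf (@measurable_rV_cons R n)).
Qed.

(** Induction on the dimension: Tonelli's theorem splits off the first coordinate. *)
Lemma integral_lebesgue_rV_prod n (g : 'I_n -> R -> R) :
  (forall i, measurable_fun setT (g i)) -> (forall i x, (0 <= g i x)%R) ->
  \int[lebesgue_rV n]_v (\prod_(i < n) g i (v 0 i))%:E =
  \prod_(i < n) \int[lebesgue_measure]_x (g i x)%:E.
Proof.
elim: n g => [|n ih] g mg g0.
  rewrite big_ord0; under eq_integral do rewrite big_ord0.
  by rewrite integral_cst//= mul1e diracT.
have mp k (h : 'I_k -> R -> R) : (forall i, measurable_fun setT (h i)) ->
    measurable_fun setT (fun v : 'rV[R]_k => \prod_(i < k) h i (v 0 i))%R.
  move=> mh; apply: measurable_prod => i _.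
  exact: (measurableT_comp (mh i) (@measurable_rV_coord R k i)).
rewrite [lebesgue_rV _]/= ge0_integral_lebesgue_cons; last 2 first.
- by apply/measurable_EFinP; exact: mp.
- by move=> v; rewrite lee_fin prodr_ge0.
rewrite big_ord_recl.
transitivity (\int[lebesgue_measure]_x ((g ord0 x)%:E *
    \prod_(i < n) \int[lebesgue_measure]_x (g (lift ord0 i) x)%:E)).
  apply: eq_integral => x _; rewrite -ih// -ge0_integralZl_EFin//; last 2 first.
  - by move=> v _; rewrite lee_fin prodr_ge0.
  - by apply/measurable_EFinP; exact: (mp _ (fun i => g (lift ord0 i))).
  apply: eq_integral => v _; rewrite -EFinM big_ord_recl; congr (_ * _)%:E.
    by rewrite mxE unlift_none.
  by apply: eq_bigr => i _; rewrite mxE liftK.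
rewrite ge0_integralZr//.
- by apply/measurable_EFinP; exact: mg.
- by move=> x _; rewrite lee_fin.
- apply: prode_ge0 => i _; apply: integral_ge0 => x _; by rewrite lee_fin.
Qed.

End lebesgue_rV_prod.

(** * Gaussian vectors and Gaussian integrals *)

Section gaussian_vector.
Context (R : realType) (p : nat).

Definition gaussian_pdf (mu : 'rV[R]_p) (s : R) (y : 'rV[R]_p) : R :=
  \prod_(i < p) normal_pdf (mu 0 i) s (y 0 i).

Lemma measurable_gaussian_pdf mu s : measurable_fun setT (gaussian_pdf mu s).
Proof.
apply: measurable_prod => i _.
exact: (measurableT_comp (measurable_normal_pdf _ _) (measurable_rV_coord i)).
Qed.

Lemma gaussian_pdf_ge0 mu s y : 0 <= gaussian_pdf mu s y.
Proof. by apply: prodr_ge0 => i _; exact: normal_pdf_ge0. Qed.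

Lemma measurable_rV_affine (mu : 'rV[R]_p) (s : R) :
  measurable_fun setT (fun v : 'rV[R]_p => mu + s *: v).
Proof.
apply: measurable_fun_rV => i; under eq_fun do rewrite !mxE.
apply: measurable_funD => //; apply: measurable_funM => //.
exact: measurable_rV_coord.
Qed.

(** Both sides are measures that factorise over boxes, so the claim reduces to the scalar
    [normal_prob_affine] in each coordinate. Only the values of [g] on boxes are assumed, which is
    the form in which the law of each [xi k] is given. *)
Lemma gaussian_affine (g : {measure set 'rV[R]_p -> \bar R}) (mu : 'rV[R]_p)
    (s : R) (B : set 'rV[R]_p) :
  (forall A : 'I_p -> set R, (forall i, measurable (A i)) ->
    g (rV_box A) = \prod_(i < p) normal_prob 0 1 (A i))%E ->
  0 < s -> measurable B ->
  g [set v | B (mu + s *: v)] =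
  (\int[lebesgue_rV p]_(y in B) (gaussian_pdf mu s y)%:E)%E.
Proof.
move=> gE s0; pose nu1 := pushforward_measure g (measurable_rV_affine mu s).
pose nu2 := measure_with_density (lebesgue_rV p)
  (measurable_gaussian_pdf mu s) (gaussian_pdf_ge0 mu s).
suff : forall B, measurable B -> nu1 B = nu2 B by apply.
apply: rV_measure_unique => [|A mA].
  rewrite -[X in (X < _)%E]/(g setT).
  have -> : [set: 'rV[R]_p] = rV_box (fun=> setT) by apply/seteqP; split.
  rewrite gE//; under eq_bigr do rewrite probability_setT.
  by rewrite big1_eq ltry.
have -> : nu1 (rV_box A) = g (rV_box (fun i => [set x | A i (mu 0 i + s * x)])).
  by congr (g _); apply/seteqP; split => v /= vA i; have := vA i; rewrite !mxE.
have mA' i : measurable [set x | A i (mu 0 i + s * x)].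
  have mf : measurable_fun setT (fun x : R => mu 0 i + s * x).
    by apply: measurable_funD => //; exact: measurable_funM.
  by have := mf measurableT _ (mA i); rewrite setTI.
rewrite gE//.
have -> : nu2 (rV_box A) = (\int[lebesgue_rV p]_v
    (\prod_(i < p) (normal_pdf (mu 0 i) s (v 0 i) * \1_(A i) (v 0 i)))%:E)%E.
  rewrite -[LHS]/(\int[lebesgue_rV p]_(y in rV_box A) (gaussian_pdf mu s y)%:E)%E.
  rewrite integral_mkcond; apply: eq_integral => v _; rewrite patchE.
  case: ifPn => [/[!inE] vA|/negP].
    by congr EFin; apply: eq_bigr => i _; rewrite indicE mem_set ?mulr1//; exact: vA.
  move=> /[!inE] /existsNP[i vA]; rewrite (bigD1 i)//= indicE memNset//.
  by rewrite mulr0 mul0r.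
rewrite (@integral_lebesgue_rV_prod _ _ (fun i x => normal_pdf (mu 0 i) s x * \1_(A i) x)); last 2 first.
- move=> i; apply: measurable_funM; first exact: measurable_normal_pdf.
  exact: measurable_indic.
- by move=> i x; rewrite mulr_ge0// normal_pdf_ge0.
apply: eq_bigr => i _; rewrite -normal_prob_affine//.
rewrite /normal_prob integral_mkcond; apply: eq_integral => x _.
by rewrite patchE indicE; case: ifPn => _; rewrite ?mulr1 ?mulr0.
Qed.

Lemma integral_expR_sqr_lty (k : R) : 0 < k ->
  (\int[lebesgue_rV p]_v (expR (- (k * \sum_(i < p) v 0 i ^+ 2)))%:E < +oo)%E.
Proof.
move=> k0; under eq_integral do rewrite mulr_sumr -sumrN expR_sum.
rewrite (@integral_lebesgue_rV_prod _ _ (fun=> fun x => expR (- (k * x ^+ 2)))); last 2 first.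
- move=> i; apply: measurableT_comp => //; apply: measurableT_comp => //.
  by apply: measurable_funM => //; exact: measurable_funX.
- by move=> i x; exact: expR_ge0.
suff H : (\int[lebesgue_measure]_x (expR (- (k * x ^+ 2)))%:E)%E \is a fin_num.
  by rewrite -ge0_fin_numE ?prode_fin_num// prode_ge0// => i _;
    apply: integral_ge0 => x _; rewrite lee_fin expR_ge0.
(* With variance 1 / (2 k) the integrand is the normal density divided by its peak. *)
pose s := Num.sqrt ((2 * k)^-1).
have s0 : 0 < s by rewrite sqrtr_gt0 invr_gt0 mulr_gt0.
have sE : s ^+ 2 = (2 * k)^-1 by rewrite sqr_sqrtr// invr_ge0 mulr_ge0// ltW.
have -> : (\int[lebesgue_measure]_x (expR (- (k * x ^+ 2)))%:E)%E =
    (\int[lebesgue_measure]_x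
      ((normal_peak s)^-1%:E * (normal_pdf 0 s x)%:E))%E.
  apply: eq_integral => x _; rewrite -EFinM /normal_pdf gt_eqF//.
  rewrite mulKf ?gt_eqF ?normal_peak_gt0 ?gt_eqF// /normal_fun subr0.
  congr (expR _)%:E; rewrite mulNr sE; congr (- _); field.
  by rewrite gt_eqF.
rewrite ge0_integralZl_EFin//; last 3 first.
- by move=> x _; rewrite lee_fin normal_pdf_ge0.
- by apply/measurable_EFinP; exact: measurable_normal_pdf.
- by rewrite invr_ge0 normal_peak_ge0.
by rewrite integral_normal_pdf mule1.
Qed.

Lemma integral_sqr3_expR_lty (k : R) : 0 < k ->
  (\int[lebesgue_rV p]_v ((\sum_(i < p) v 0 i ^+ 2) ^+ 3 *
     expR (- (k * \sum_(i < p) v 0 i ^+ 2)))%:E < +oo)%E.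
Proof.
move=> k0; set q := fun v : 'rV[R]_p => \sum_(i < p) v 0 i ^+ 2.
have mq : measurable_fun setT q.
  by apply: measurable_sum => i; apply: measurable_funX; exact: measurable_rV_coord.
have me c : measurable_fun setT (fun v => expR (- (c * q v))).
  apply: measurableT_comp => //; apply: measurableT_comp => //.
  exact: measurable_funM.
have q0 v : 0 <= q v by apply: sumr_ge0 => i _; exact: sqr_ge0.
apply: (@le_lt_trans _ _ (\int[lebesgue_rV p]_v
    (((6 / k) ^+ 3)%:E * (expR (- (k / 2 * q v)))%:E))%E).
  apply: ge0_le_integral => //.
  - by move=> v _; rewrite lee_fin mulr_ge0 ?exprn_ge0 ?expR_ge0 ?q0.
  - apply/measurable_EFinP; apply: measurable_funM => //.
    exact: measurable_funX.
  - apply/measurable_EFinP; apply: measurable_funM; first exact: measurable_cst.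
    exact: me.
  - move=> v _; rewrite -EFinM lee_fin -/(q v).
    (* From t <= e^t at t = k q / 6 one gets q <= (6 / k) e^(k q / 6); its cube absorbs q^3 and
       costs half of the exponent. *)
    have -> : - (k / 2 * q v) = 3%:R * (k / 6 * q v) + - (k * q v) by lra.
    rewrite expRD [leRHS]mulrA; apply: ler_wpM2r; first exact: expR_ge0.
    rewrite expRM_natl -exprMn lerXn2r ?nnegrE//.
      by rewrite mulr_ge0 ?expR_ge0// divr_ge0// ltW.
    rewrite mulrC -ler_pdivrMr ?divr_gt0//.
    apply: le_trans (expR_ge1Dx _); rewrite invf_div; nra.
rewrite ge0_integralZl_EFin; last 4 first.
- by [].
- by move=> x _; rewrite lee_fin expR_ge0.
- by apply/measurable_EFinP; exact: me.
- by rewrite exprn_ge0// divr_ge0// ltW.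
apply: lte_mul_pinfty => //; first by rewrite lee_fin exprn_ge0// divr_ge0// ltW.
by apply: integral_expR_sqr_lty; rewrite divr_gt0.
Qed.

End gaussian_vector.

(** * Smooth strongly convex potentials *)

Section euclidean.
Context {R : realType} {p : nat}.
Implicit Types (u v w : 'rV[R]_p) (c : R).

Lemma dotVC u v : dotV u v = dotV v u.
Proof. by apply: eq_bigr => i _; rewrite mulrC. Qed.

Lemma dotVDl u v w : dotV (u + v) w = dotV u w + dotV v w.
Proof. by rewrite -big_split; apply: eq_bigr => i _; rewrite mxE mulrDl. Qed.

Lemma dotVZl c u v : dotV (c *: u) v = c * dotV u v.
Proof. by rewrite mulr_sumr; apply: eq_bigr => i _; rewrite mxE mulrA. Qed.

Lemma dotVNl u v : dotV (- u) v = - dotV u v.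
Proof. by rewrite -scaleN1r dotVZl mulN1r. Qed.

Lemma dotVBl u v w : dotV (u - v) w = dotV u w - dotV v w.
Proof. by rewrite dotVDl dotVNl. Qed.

Lemma dotVDr u v w : dotV w (u + v) = dotV w u + dotV w v.
Proof. by rewrite ![dotV w _]dotVC dotVDl. Qed.

Lemma dotVZr c u v : dotV v (c *: u) = c * dotV v u.
Proof. by rewrite ![dotV v _]dotVC dotVZl. Qed.

Lemma dotVNr u v : dotV v (- u) = - dotV v u.
Proof. by rewrite ![dotV v _]dotVC dotVNl. Qed.

Lemma dotVBr u v w : dotV w (u - v) = dotV w u - dotV w v.
Proof. by rewrite dotVDr dotVNr. Qed.

Lemma norm2_ge0 u : 0 <= norm2 u. Proof. exact: sqrtr_ge0. Qed.

Lemma norm2_sqE u : norm2 u ^+ 2 = \sum_(i < p) u 0 i ^+ 2.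
Proof. by rewrite sqr_sqrtr// sumr_ge0// => i _; exact: sqr_ge0. Qed.

Lemma norm2_sq u : norm2 u ^+ 2 = dotV u u.
Proof. by rewrite norm2_sqE; apply: eq_bigr => i _; rewrite expr2. Qed.

Lemma norm2_sqD u v :
  norm2 (u + v) ^+ 2 = norm2 u ^+ 2 + 2 * dotV u v + norm2 v ^+ 2.
Proof. by rewrite !norm2_sq dotVDl !dotVDr (dotVC v u); lra. Qed.

Lemma norm2_sqB u v :
  norm2 (u - v) ^+ 2 = norm2 u ^+ 2 - 2 * dotV u v + norm2 v ^+ 2.
Proof. by rewrite !norm2_sq dotVBl !dotVBr (dotVC v u); lra. Qed.

Lemma norm2_sqZ c u : norm2 (c *: u) ^+ 2 = c ^+ 2 * norm2 u ^+ 2.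
Proof. by rewrite !norm2_sq dotVZl dotVZr mulrA expr2. Qed.

Lemma norm2N u : norm2 (- u) = norm2 u.
Proof. by rewrite /norm2; under eq_bigr do rewrite mxE sqrrN. Qed.

Lemma norm2_distC u v : norm2 (u - v) = norm2 (v - u).
Proof. by rewrite -opprB norm2N. Qed.

Lemma dotV_young c u v : 0 < c ->
  2 * dotV u v <= c * norm2 u ^+ 2 + norm2 v ^+ 2 / c.
Proof.
move=> c0; have := sqr_ge0 (norm2 (c *: u - v)).
rewrite norm2_sqB norm2_sqZ dotVZl => H.
rewrite -(ler_pM2l c0) mulrDr [c * (_ / c)]mulrCA divff ?gt_eqF//; lra.
Qed.

Lemma dotV_sq_le u v : dotV u v ^+ 2 <= norm2 u ^+ 2 * norm2 v ^+ 2.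
Proof.
have := sqr_ge0 (norm2 v); rewrite le_eqVlt => /predU1P[v0|v0].
  suff -> : dotV u v = 0 by rewrite expr0n/= -v0 mulr0.
  move/eqP: v0; rewrite eq_sym norm2_sqE psumr_eq0; last first.
    by move=> i _; exact: sqr_ge0.
  move=> /allP v0; rewrite /dotV big1// => i _.
  have /= := v0 i (mem_index_enum _); rewrite sqrf_eq0 => /eqP ->.
  by rewrite mulr0.
have := sqr_ge0 (norm2 (norm2 v ^+ 2 *: u - dotV u v *: v)).
rewrite norm2_sqB !norm2_sqZ dotVZl dotVZr => H.
by rewrite -(ler_pM2l v0); lra.
Qed.

Lemma dotV_le u v : `|dotV u v| <= norm2 u * norm2 v.
Proof.
rewrite -[leRHS]ger0_norm ?mulr_ge0 ?norm2_ge0//.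
by rewrite -ler_sqr ?nnegrE// !real_normK ?num_real// exprMn dotV_sq_le.
Qed.

Lemma norm2D u v : norm2 (u + v) <= norm2 u + norm2 v.
Proof.
rewrite -ler_sqr ?nnegrE ?addr_ge0 ?norm2_ge0// norm2_sqD sqrrD.
have := ler_normlW (dotV_le u v); lra.
Qed.

Lemma norm2_sqD_le u v : norm2 (u + v) ^+ 2 <= 2 * norm2 u ^+ 2 + 2 * norm2 v ^+ 2.
Proof. by have := sqr_ge0 (norm2 (u - v)); rewrite norm2_sqB norm2_sqD; lra. Qed.

Lemma norm2_sqB_le u v : norm2 (u - v) ^+ 2 <= 2 * norm2 u ^+ 2 + 2 * norm2 v ^+ 2.
Proof. by have := sqr_ge0 (norm2 (u + v)); rewrite norm2_sqB norm2_sqD; lra. Qed.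

End euclidean.

Section smooth_strongly_convex.
Context {R : realType} {p : nat} (f : 'rV[R]_p -> R) (m M : R).
Hypothesis m0 : 0 < m.
Hypothesis M0 : 0 < M.
Hypothesis f_convex : strong_convexity f m.
Hypothesis f_lip : gradient_lipschitz f M.
Implicit Types x y : 'rV[R]_p.

Lemma grad_monotone x y :
  m * norm2 (x - y) ^+ 2 <= dotV (grad f x - grad f y) (x - y).
Proof.
have := f_convex x y; have := f_convex y x.
by rewrite dotVBl -(opprB x y) norm2N dotVNr; lra.
Qed.

(** Convexity used at both end points encloses the remainder between 0 and <grad f y - grad f x, y -
    x>, which is at most M |y - x|^2. The constant is M rather than M / 2; in exchange nothing is
    integrated along the segment. *)
Lemma taylor1_le x y :
  `|f y - f x - dotV (grad f x) (y - x)| <= M * norm2 (y - x) ^+ 2.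
Proof.
have h1 := f_convex x y; have h2 := f_convex y x.
have h3 := ler_normlW (dotV_le (grad f y - grad f x) (y - x)).
have h4 : norm2 (grad f y - grad f x) * norm2 (y - x) <= M * norm2 (y - x) ^+ 2.
  by rewrite expr2 mulrA ler_wpM2r ?norm2_ge0.
have h5 := sqr_ge0 (norm2 (y - x)).
move: h1; rewrite -(opprB y x) norm2N dotVNr => h1.
have h6 : 0 <= m / 2 * norm2 (y - x) ^+ 2 by rewrite mulr_ge0// divr_ge0// ltW.
have h7 : 0 <= M * norm2 (y - x) ^+ 2 by rewrite mulr_ge0// ltW.
rewrite dotVBl in h3; rewrite ler_norml; apply/andP; split; lra.
Qed.

(** After expansion of the square, strong monotonicity bounds the cross term and the Lipschitz
    condition the quadratic one. *)
Lemma gradient_step_contraction (h : R) x y : 0 <= h ->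
  norm2 (x - y - h *: (grad f x - grad f y)) ^+ 2 <=
  (1 - 2 * m * h + M ^+ 2 * h ^+ 2) * norm2 (x - y) ^+ 2.
Proof.
move=> h0; rewrite (norm2_sqB (x - y)) norm2_sqZ dotVZr dotVC.
have h1 := grad_monotone x y.
have h2 : norm2 (grad f x - grad f y) ^+ 2 <= M ^+ 2 * norm2 (x - y) ^+ 2.
  by rewrite -exprMn ler_sqr ?nnegrE ?mulr_ge0 ?norm2_ge0// ltW.
have h3 : h * (m * norm2 (x - y) ^+ 2) <= h * dotV (grad f x - grad f y) (x - y).
  exact: ler_wpM2l.
have h4 : h ^+ 2 * norm2 (grad f x - grad f y) ^+ 2 <= h ^+ 2 * (M ^+ 2 * norm2 (x - y) ^+ 2).
  by rewrite ler_wpM2l// sqr_ge0.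
by lra.
Qed.

Lemma norm2_grad_le x y :
  norm2 (grad f x) ^+ 2 <= 2 * norm2 (grad f y) ^+ 2 + 2 * M ^+ 2 * norm2 (x - y) ^+ 2.
Proof.
have h2 : norm2 (grad f x - grad f y) ^+ 2 <= M ^+ 2 * norm2 (x - y) ^+ 2.
  by rewrite -exprMn ler_sqr ?nnegrE ?mulr_ge0 ?norm2_ge0// ltW.
have := norm2_sqD_le (grad f y) (grad f x - grad f y).
by rewrite addrC subrK; lra.
Qed.

(** Logarithm of the Metropolis-Hastings ratio pi(y') q(y', y) / (pi(y) q(y, y')), where q is the
    density of the Langevin proposal: the terms in |y' - y|^2 of the two Gaussian exponents
    cancel. *)
Definition mala_log_ratio (h : R) y y' : R :=
  f y - f y' + 2^-1 * dotV (grad f y + grad f y') (y' - y)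
  - h / 4 * (norm2 (grad f y') ^+ 2 - norm2 (grad f y) ^+ 2).

(** The part free of [h] is half the difference of the Taylor remainders of [f] at y' and at y,
    hence of second order in y' - y; the other part is a difference of squares of gradient norms,
    controlled by the Lipschitz condition. *)
Lemma mala_log_ratio_le (h : R) y y' : 0 <= h ->
  `|mala_log_ratio h y y'| <=
  M * norm2 (y' - y) ^+ 2 +
  h / 4 * (M * norm2 (y' - y) * (2 * norm2 (grad f y) + M * norm2 (y' - y))).
Proof.
move=> h0; rewrite /mala_log_ratio.
apply: le_trans (ler_normB _ _) _; apply: lerD.
  have h1 := taylor1_le y y'; have h2 := taylor1_le y' y.
  move: h2; rewrite -(opprB y' y) norm2N dotVNr => h2.
  rewrite dotVDl; move: h1 h2; rewrite !ler_norml => /andP[? ?] /andP[? ?].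
  by apply/andP; split; lra.
rewrite normrM (ger0_norm (divr_ge0 h0 _))//; apply: ler_wpM2l; first by rewrite divr_ge0.
have h1 := f_lip y' y.
have h2 : norm2 (grad f y') <= norm2 (grad f y) + norm2 (grad f y' - grad f y).
  by rewrite -{1}(subrK (grad f y) (grad f y')) addrC norm2D.
have h3 : norm2 (grad f y) <= norm2 (grad f y') + norm2 (grad f y' - grad f y).
  by rewrite -{1}(subrK (grad f y') (grad f y)) addrC norm2_distC norm2D.
rewrite subr_sqr normrM; apply: ler_pM => //.
  by rewrite ler_norml; apply/andP; split; lra.
rewrite ger0_norm ?addr_ge0 ?norm2_ge0//; lra.
Qed.

End smooth_strongly_convex.

(** * The Metropolis-adjusted Langevin chain *)

Section measurable_euclidean.
Context {R : realType} {p : nat} {d : measure_display} {T : measurableType d}.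
Implicit Types F G : T -> 'rV[R]_p.

Lemma measurable_funD_rV F G : measurable_fun setT F -> measurable_fun setT G ->
  measurable_fun setT (fun t => F t + G t).
Proof.
move=> mF mG; apply: measurable_fun_rV => i; under eq_fun do rewrite mxE.
by apply: measurable_funD; exact: measurableT_comp (measurable_rV_coord i) _.
Qed.

Lemma measurable_funZ_rV (c : T -> R) F : measurable_fun setT c ->
  measurable_fun setT F -> measurable_fun setT (fun t => c t *: F t).
Proof.
move=> mc mF; apply: measurable_fun_rV => i; under eq_fun do rewrite mxE.
by apply: measurable_funM => //; exact: measurableT_comp (measurable_rV_coord i) _.
Qed.

Lemma measurable_funB_rV F G : measurable_fun setT F -> measurable_fun setT G ->
  measurable_fun setT (fun t => F t - G t).
Proof.
move=> mF mG; apply: measurable_funD_rV => //.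
under eq_fun do rewrite -scaleN1r.
by apply: measurable_funZ_rV.
Qed.

Lemma measurable_dotV F G : measurable_fun setT F -> measurable_fun setT G ->
  measurable_fun setT (fun t => dotV (F t) (G t)).
Proof.
move=> mF mG; apply: measurable_sum => i.
by apply: measurable_funM; exact: measurableT_comp (measurable_rV_coord i) _.
Qed.

Lemma measurable_norm2_sq F : measurable_fun setT F ->
  measurable_fun setT (fun t => norm2 (F t) ^+ 2).
Proof. by move=> mF; under eq_fun do rewrite norm2_sq; exact: measurable_dotV. Qed.

End measurable_euclidean.

Lemma gaussian_pdfE (R : realType) (p : nat) (mu y : 'rV[R]_p) (s : R) : 0 < s ->
  gaussian_pdf mu s y =
  normal_peak s ^+ p * expR (- norm2 (y - mu) ^+ 2 / (s ^+ 2 *+ 2)).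
Proof.
move=> s0; rewrite norm2_sqE -sumrN mulr_suml expR_sum.
rewrite -[in X in X * _](card_ord p) -prodr_const -big_split/=.
apply: eq_bigr => i _; rewrite /normal_pdf gt_eqF//; congr (_ * expR _).
by rewrite !mxE.
Qed.

Section mala.
Context {R : realType} {p : nat} (f : 'rV[R]_p -> R) (h : R).
Hypothesis h0 : 0 < h.
Hypothesis mf : measurable_fun setT f.
Hypothesis mgrad : measurable_fun setT (grad f).
Implicit Types y v : 'rV[R]_p.

Definition mala_proposal (y v : 'rV[R]_p) : 'rV[R]_p :=
  y - h *: grad f y + Num.sqrt (2 * h) *: v.

Definition mala_accept (y y' : 'rV[R]_p) : R :=
  Num.min 1 (expR (mala_log_ratio f h y y')).

(** Unfolding equation, for use once [mala_proposal] is opaque. *)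
Lemma mala_proposalE y v :
  mala_proposal y v = y - h *: grad f y + Num.sqrt (2 * h) *: v.
Proof. by []. Qed.

Lemma mala_accept_ge0 y y' : 0 <= mala_accept y y'.
Proof. by rewrite /mala_accept le_min ler01 expR_ge0. Qed.

Lemma mala_accept_le1 y y' : mala_accept y y' <= 1.
Proof. by rewrite /mala_accept ge_min lexx. Qed.

(** For the log-ratio l, e^l >= 1 + l gives min(1, e^l) >= 1 - |l|. *)
Lemma mala_reject_le y y' : 1 - mala_accept y y' <= `|mala_log_ratio f h y y'|.
Proof.
set l := mala_log_ratio f h y y'; rewrite /mala_accept -/l.
have := expR_ge1Dx l; have := ler_norm (- l); have := normr_ge0 l.
by rewrite normrN minEle; case: ifP => _; lra.
Qed.

(** Up to normalisation, the joint density of a stationary state and its proposal. *)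
Definition mala_joint (y y' : 'rV[R]_p) : R :=
  expR (- f y) * gaussian_pdf (y - h *: grad f y) (Num.sqrt (2 * h)) y'.

Let s0 : 0 < Num.sqrt (2 * h). Proof. by rewrite sqrtr_gt0 mulr_gt0. Qed.

Lemma mala_jointC y y' :
  mala_joint y' y = mala_joint y y' * expR (mala_log_ratio f h y y').
Proof.
rewrite /mala_joint !gaussian_pdfE// [LHS]mulrCA -!mulrA [RHS]mulrCA.
congr (_ * _); rewrite -!expRD; congr expR.
have -> : Num.sqrt (2 * h) ^+ 2 *+ 2 = 4 * h.
  by rewrite sqr_sqrtr ?mulr_ge0 ?(ltW h0)//; lra.
have -> : y' - (y - h *: grad f y) = (y' - y) + h *: grad f y.
  by rewrite opprB addrA addrAC.
have -> : y - (y' - h *: grad f y') = - ((y' - y) - h *: grad f y').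
  by rewrite !opprB addrCA.
rewrite norm2N (norm2_sqD (y' - y) (h *: grad f y))
  (norm2_sqB (y' - y) (h *: grad f y')) !norm2_sqZ !dotVZr.
rewrite /mala_log_ratio (dotVDl (grad f y)) !(dotVC (y' - y)).
by field; rewrite gt_eqF.
Qed.

Lemma mala_joint_ge0 y y' : 0 <= mala_joint y y'.
Proof. by rewrite mulr_ge0 ?expR_ge0 ?gaussian_pdf_ge0. Qed.

(** Both sides equal the smaller of the two joint densities. *)
Lemma mala_detailed_balance y y' :
  mala_joint y y' * mala_accept y y' = mala_joint y' y * mala_accept y' y.
Proof.
have H (w e w' : R) : 0 <= w -> w' = w * e -> w * Num.min 1 e = Num.min w w'.
  by move=> w0 ->; rewrite minr_pMr// mulr1.
have H1 := (H _ _ _ (mala_joint_ge0 y y') (mala_jointC y y')).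
have H2 := (H _ _ _ (mala_joint_ge0 y' y) (mala_jointC y' y)).
by apply: (etrans H1); apply: (etrans (minC _ _)); apply/esym.
Qed.

End mala.

(** * Invariance of the Gibbs measure *)

Section mala_invariance.
Local Open Scope ereal_scope.
Context {R : realType} {p : nat} (f : 'rV[R]_p -> R) (h : R).
Hypothesis h0 : (0 < h)%R.
Hypothesis mf : measurable_fun setT f.
Hypothesis mgrad : measurable_fun setT (grad f).
Variables (pi gam : probability 'rV[R]_p R).
Hypothesis pi_gibbs : gibbs_measure f pi.
Hypothesis gamE : forall A : 'I_p -> set R, (forall i, measurable (A i)) ->
  gam (rV_box A) = \prod_(i < p) normal_prob 0 1 (A i).
Local Notation leb := (lebesgue_rV p).

Lemma integral_gaussian_affine (mu : 'rV[R]_p) (s : R) (psi : 'rV[R]_p -> \bar R) :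
  (0 < s)%R -> measurable_fun setT psi -> (forall y, 0 <= psi y) ->
  \int[gam]_v psi (mu + s *: v)%R =
  \int[leb]_y (psi y * (gaussian_pdf mu s y)%:E).
Proof.
move=> s0 mpsi psi0.
rewrite -(@ge0_integral_density _ _ _ leb (measure_with_density leb
  (measurable_gaussian_pdf mu s) (gaussian_pdf_ge0 mu s)) (gaussian_pdf mu s))//; last 2 first.
- exact: measurable_gaussian_pdf.
- exact: gaussian_pdf_ge0.
transitivity (\int[pushforward_measure gam (measurable_rV_affine mu s)]_v psi v).
  by rewrite ge0_integral_pushforward//; exact: measurable_rV_affine.
by apply: eq_measure_integral => A mA _; exact: (gaussian_affine mu gamE s0 mA).
Qed.

Lemma measurable_mala_accept : measurable_fun setT
  (fun yz : 'rV[R]_p * 'rV[R]_p => mala_accept f h yz.1 yz.2).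
Proof.
have mf1 := measurableT_comp mf (@measurable_fst _ _ 'rV[R]_p 'rV[R]_p).
have mf2 := measurableT_comp mf (@measurable_snd _ _ 'rV[R]_p 'rV[R]_p).
have mg1 := measurableT_comp mgrad (@measurable_fst _ _ 'rV[R]_p 'rV[R]_p).
have mg2 := measurableT_comp mgrad (@measurable_snd _ _ 'rV[R]_p 'rV[R]_p).
apply: measurable_minr => //; apply: measurableT_comp => //.
rewrite /mala_log_ratio; apply: measurable_funB.
  apply: measurable_funD; first exact: measurable_funB.
  apply: measurable_funM => //; apply: measurable_dotV.
    exact: measurable_funD_rV.
  by apply: measurable_funB_rV.
apply: measurable_funM => //; apply: measurable_funB; exact: measurable_norm2_sq.
Qed.

Lemma measurable_proposal_pdf : measurable_fun setT
  (fun yz : 'rV[R]_p * 'rV[R]_p =>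
    gaussian_pdf (yz.1 - h *: grad f yz.1)%R (Num.sqrt (2 * h)) yz.2).
Proof.
have mg1 := measurableT_comp mgrad (@measurable_fst _ _ 'rV[R]_p 'rV[R]_p).
have s0 : (0 < Num.sqrt (2 * h))%R by rewrite sqrtr_gt0 mulr_gt0.
under eq_fun do rewrite gaussian_pdfE//.
apply: measurable_funM => //; apply: measurableT_comp => //.
apply: measurable_funM => //; apply: measurableT_comp => //.
apply: measurable_norm2_sq; apply: measurable_funB_rV => //.
apply: measurable_funB_rV => //; exact: measurable_funZ_rV.
Qed.

Lemma measurable_mala_joint : measurable_fun setT
  (fun yz : 'rV[R]_p * 'rV[R]_p => mala_joint f h yz.1 yz.2).
Proof.
have mf1 := measurableT_comp mf (@measurable_fst _ _ 'rV[R]_p 'rV[R]_p).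
apply: measurable_funM; last exact: measurable_proposal_pdf.
by apply: measurableT_comp => //; apply: measurableT_comp.
Qed.

Lemma measurable_mala_proposal : measurable_fun setT
  (fun yv : 'rV[R]_p * 'rV[R]_p => mala_proposal f h yv.1 yv.2).
Proof.
have mg1 := measurableT_comp mgrad (@measurable_fst _ _ 'rV[R]_p 'rV[R]_p).
apply: measurable_funD_rV; last exact: measurable_funZ_rV.
by apply: measurable_funB_rV => //; exact: measurable_funZ_rV.
Qed.

Opaque mala_joint mala_accept mala_proposal.

(** Expectations over a stationary state and a Gaussian vector become Lebesgue integrals against
    [mala_joint], the form in which detailed balance applies. *)
Lemma integral_mala (Z : R) (phi : 'rV[R]_p * 'rV[R]_p -> \bar R) :
  (0 < Z)%R ->
  (forall A, measurable A -> pi A = \int[leb]_(x in A) (Z^-1 * expR (- f x))%:E) ->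
  measurable_fun setT phi -> (forall z, 0 <= phi z) ->
  \int[pi]_y \int[gam]_v phi (y, mala_proposal f h y v) =
  \int[leb]_y \int[leb]_y' (phi (y, y') * (Z^-1 * mala_joint f h y y')%:E).
Proof.
move=> Z0 piE mphi phi0.
pose s := Num.sqrt (2 * h).
have s0 : (0 < s)%R by rewrite sqrtr_gt0 mulr_gt0.
pose mu y := (y - h *: grad f y)%R.
pose G (z : 'rV[R]_p * 'rV[R]_p) := phi z * (gaussian_pdf (mu z.1) s z.2)%:E.
have mphiy y : measurable_fun setT (fun y' => phi (y, y')).
  exact: (measurableT_comp mphi (measurable_pair1 y)).
have mG : measurable_fun setT G.
  apply: emeasurable_funM => //; apply/measurable_EFinP.
  exact: measurable_proposal_pdf.
have G0 z : 0 <= G z by rewrite mule_ge0// lee_fin gaussian_pdf_ge0.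
transitivity (\int[pi]_y \int[leb]_y' G (y, y')).
  apply: eq_integral => y _.
  exact: (integral_gaussian_affine (mu y) s0 (mphiy y) (fun y' => phi0 (y, y'))).
have mw : measurable_fun setT (fun y => (Z^-1 * expR (- f y))%R).
  apply: measurable_funM => //; apply: measurableT_comp => //.
  exact: measurableT_comp.
rewrite (ge0_integral_density mw _ piE)//; last 3 first.
- by move=> y; rewrite mulr_ge0 ?expR_ge0// invr_ge0 ltW.
- exact: (@measurable_fun_fubini_tonelli_F _ _ _ _ _ leb G).
- by move=> y; apply: integral_ge0.
apply: eq_integral => y _.
transitivity (\int[leb]_y' (G (y, y') * (Z^-1 * expR (- f y))%:E)).
  have k0 : 0 <= (Z^-1 * expR (- f y))%:E.
    by rewrite lee_fin mulr_ge0 ?expR_ge0// invr_ge0 ltW.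
  have mGy : measurable_fun setT (fun y' => G (y, y')).
    exact: (measurableT_comp mG (measurable_pair1 y)).
  have := @ge0_integralZr _ _ _ leb _ measurableT _ mGy _ (fun y' _ => G0 (y, y')) k0.
  by move=> ->.
apply: eq_integral => y' _; rewrite /G -muleA; congr (_ * _).
Transparent mala_joint.
by rewrite -EFinM /mala_joint [in RHS]mulrA [in RHS]mulrC.
Qed.

Opaque mala_joint.

(** Tonelli's theorem exchanges the roles of state and proposal; detailed balance restores the
    density. *)
Lemma mala_reversible (A : set 'rV[R]_p) : measurable A ->
  \int[pi]_y \int[gam]_v (mala_accept f h y (mala_proposal f h y v) *
    \1_A (mala_proposal f h y v))%:E =
  \int[pi]_y \int[gam]_v (mala_accept f h y (mala_proposal f h y v) *
    \1_A y)%:E.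
Proof.
move=> mA; have [Z Z0 piE] := pi_gibbs.
have m1 : measurable_fun setT (\1_A : 'rV[R]_p -> R) by exact: measurable_indic.
have ma := measurable_mala_accept; have mj := measurable_mala_joint.
pose phi1 (z : 'rV[R]_p * 'rV[R]_p) := (mala_accept f h z.1 z.2 * \1_A z.2)%:E.
pose phi2 (z : 'rV[R]_p * 'rV[R]_p) := (mala_accept f h z.1 z.2 * \1_A z.1)%:E.
have mphi1 : measurable_fun setT phi1.
  apply/measurable_EFinP; apply: measurable_funM => //.
  exact: (measurableT_comp m1).
have mphi2 : measurable_fun setT phi2.
  apply/measurable_EFinP; apply: measurable_funM => //.
  exact: (measurableT_comp m1).
have phi10 z : 0 <= phi1 z by rewrite lee_fin mulr_ge0// mala_accept_ge0.
have phi20 z : 0 <= phi2 z by rewrite lee_fin mulr_ge0// mala_accept_ge0.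
apply: (etrans (integral_mala Z0 piE mphi1 phi10)); apply/esym.
apply: (etrans (integral_mala Z0 piE mphi2 phi20)); apply/esym.
pose G z := phi1 z * (Z^-1 * mala_joint f h z.1 z.2)%:E.
have -> : \int[leb]_y \int[leb]_y' G (y, y') = \int[leb]_y' \int[leb]_y G (y, y').
  apply: fubini_tonelli.
  - by apply: emeasurable_funM => //; apply/measurable_EFinP; exact: measurable_funM.
  - by move=> z; rewrite mule_ge0// lee_fin mulr_ge0 ?mala_joint_ge0// invr_ge0 ltW.
apply: eq_integral => y _; apply: eq_integral => y' _.
have bal := mala_detailed_balance f h0 y y'.
move: bal; rewrite /G /phi1 /phi2 ![(_, _).1]/fst ![(_, _).2]/snd.
move: (mala_joint f h y y') (mala_joint f h y' y) (mala_accept f h y y')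
  (mala_accept f h y' y) => c d a b bal.
rewrite -!EFinM; congr EFin.
have -> : (b * \1_A y * (Z^-1 * d) = \1_A y * Z^-1 * (d * b))%R by ring.
by rewrite -bal; ring.
Qed.

(** By reversibility the accepted moves that land in [A] have the same mass as those that start in
    [A]; together with the rejected moves from [A] they make up the mass of [A]. *)
Lemma mala_invariant (A : set 'rV[R]_p) : measurable A ->
  \int[pi]_y \int[gam]_v
    (mala_accept f h y (mala_proposal f h y v) * \1_A (mala_proposal f h y v) +
     (1 - mala_accept f h y (mala_proposal f h y v)) * \1_A y)%:E = pi A.
Proof.
move=> mA.
pose a y v := mala_accept f h y (mala_proposal f h y v).
have ma : measurable_fun setT (fun z : 'rV[R]_p * 'rV[R]_p => a z.1 z.2).
  have mz : measurable_fun setT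
      (fun z : 'rV[R]_p * 'rV[R]_p => (z.1, mala_proposal f h z.1 z.2)).
    apply/measurable_fun_pairP; split; first exact: measurable_fst.
    exact: measurable_mala_proposal.
  exact: (measurableT_comp measurable_mala_accept mz).
have m1 : measurable_fun setT (\1_A : 'rV[R]_p -> R) by exact: measurable_indic.
have mF : measurable_fun setT (fun z : 'rV[R]_p * 'rV[R]_p =>
    (a z.1 z.2 * \1_A (mala_proposal f h z.1 z.2))%:E).
  apply/measurable_EFinP; apply: measurable_funM => //.
  exact: (measurableT_comp m1 measurable_mala_proposal).
have mG : measurable_fun setT (fun z : 'rV[R]_p * 'rV[R]_p => ((1 - a z.1 z.2) * \1_A z.1)%:E).
  apply/measurable_EFinP; apply: measurable_funM; first exact: measurable_funB.
  exact: (measurableT_comp m1).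
have mH : measurable_fun setT (fun z : 'rV[R]_p * 'rV[R]_p => (a z.1 z.2 * \1_A z.1)%:E).
  apply/measurable_EFinP; apply: measurable_funM => //.
  exact: (measurableT_comp m1).
have F0 y v : 0 <= (a y v * \1_A (mala_proposal f h y v))%:E.
  by rewrite lee_fin mulr_ge0// mala_accept_ge0.
have G0 y v : 0 <= ((1 - a y v) * \1_A y)%:E.
  by rewrite lee_fin mulr_ge0// subr_ge0 mala_accept_le1.
have H0 y v : 0 <= (a y v * \1_A y)%:E.
  by rewrite lee_fin mulr_ge0// mala_accept_ge0.
have slice (g : 'rV[R]_p * 'rV[R]_p -> \bar R) y : measurable_fun setT g ->
    measurable_fun setT (fun v => g (y, v)).
  by move=> mg; exact: (measurableT_comp mg (measurable_pair1 y)).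
pose I1 y := \int[gam]_v (a y v * \1_A (mala_proposal f h y v))%:E.
pose I2 y := \int[gam]_v ((1 - a y v) * \1_A y)%:E.
pose I3 y := \int[gam]_v (a y v * \1_A y)%:E.
have mI1 : measurable_fun setT I1.
  exact: (measurable_fun_fubini_tonelli_F _ mF (fun z => F0 z.1 z.2)).
have mI2 : measurable_fun setT I2.
  exact: (measurable_fun_fubini_tonelli_F _ mG (fun z => G0 z.1 z.2)).
have mI3 : measurable_fun setT I3.
  exact: (measurable_fun_fubini_tonelli_F _ mH (fun z => H0 z.1 z.2)).
have I10 y : setT y -> 0 <= I1 y by move=> _; apply: integral_ge0 => v _; exact: F0.
have I20 y : setT y -> 0 <= I2 y by move=> _; apply: integral_ge0 => v _; exact: G0.
have I30 y : setT y -> 0 <= I3 y by move=> _; apply: integral_ge0 => v _; exact: H0.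
transitivity (\int[pi]_y (I1 y + I2 y)).
  apply: eq_integral => y _.
  exact: (ge0_integralD gam measurableT (fun v _ => F0 y v) (slice _ y mF)
    (fun v _ => G0 y v) (slice _ y mG)).
have -> := ge0_integralD pi measurableT I10 mI1 I20 mI2.
have -> : \int[pi]_y I1 y = \int[pi]_y I3 y by exact: mala_reversible.
have <- := ge0_integralD pi measurableT I30 mI3 I20 mI2.
transitivity (\int[pi]_y (\1_A y)%:E); last first.
  by rewrite integral_indic// setIT.
apply: eq_integral => y _.
have <- := ge0_integralD gam measurableT (fun v _ => H0 y v) (slice _ y mH)
    (fun v _ => G0 y v) (slice _ y mG).
transitivity (\int[gam]_v (cst (\1_A y)%:E v)).
  apply: eq_integral => v _; rewrite /= -EFinD -mulrDl.
  by rewrite [X in (X * _)%R]addrC subrK mul1r.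
by rewrite integral_cst//= probability_setT mule1.
Qed.

End mala_invariance.

(** * Bias and variance of the SPSA gradient *)

Section finite_differences.
Context {R : realType}.
Implicit Types phi : R -> R.

Lemma mean_value_le phi phi' (K a b : R) :
  (forall x : R, is_derive x 1 phi (phi' x)) -> a <= b ->
  (forall x, a <= x <= b -> `|phi' x| <= K) -> `|phi b - phi a| <= K * (b - a).
Proof.
move=> dphi ab phiK.
have [c + ->] : exists2 c, c \in `[a, b] & phi b - phi a = phi' c * (b - a).
  apply: MVT_segment => // x; apply: derivable_within_continuous => z _.
  by have [] := dphi z.
rewrite in_itv/= => /phiK phic; rewrite normrM (ger0_norm (_ : 0 <= b - a)) ?subr_ge0//.
by rewrite ler_wpM2r// subr_ge0.
Qed.

(** The function phi(t) + phi(-t) has derivative phi'(t) - phi'(-t), at most 2 K t in size by the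
    mean value theorem; a second application bounds the increment over [0, c]. *)
Lemma symmetric_difference2_le phi phi' phi'' (K c : R) :
  (forall x : R, is_derive x 1 phi (phi' x)) ->
  (forall x : R, is_derive x 1 phi' (phi'' x)) ->
  (forall x, `|phi'' x| <= K) -> 0 <= c ->
  `|phi c + phi (- c) - 2 * phi 0| <= 2 * K * c ^+ 2.
Proof.
move=> d1 d2 phiK c0.
pose chi t := phi t + phi (- t).
pose chi' t := phi' t - phi' (- t).
have dchi (x : R) : is_derive x 1 chi (chi' x).
  rewrite /chi /chi'.
  have dN : is_derive x 1 (fun t => phi (- t)) (- phi' (- x)).
    by apply: is_derive_eq; rewrite mulrN1.
  exact: is_deriveD.
have -> : phi c + phi (- c) - 2 * phi 0 = chi c - chi 0.
  by rewrite /chi oppr0; ring.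
have -> : 2 * K * c ^+ 2 = 2 * K * c * (c - 0) by ring.
apply: (mean_value_le dchi c0).
move=> x /andP[x0 xc]; rewrite /chi'.
have := @mean_value_le phi' phi'' K (- x) x d2.
rewrite opprK => /(_ _ (fun z _ => phiK z)) H.
have K0 : 0 <= K by apply: le_trans (phiK 0).
apply: (le_trans (H _)); first lra.
nra.
Qed.

(** The derivative of the central-difference error is the symmetric second difference of phi', so
    the bound of second order applies under the mean value theorem. The constant is not sharp. *)
Lemma symmetric_difference3_le phi phi' phi'' phi''' (K c : R) :
  (forall x : R, is_derive x 1 phi (phi' x)) ->
  (forall x : R, is_derive x 1 phi' (phi'' x)) ->
  (forall x : R, is_derive x 1 phi'' (phi''' x)) ->
  (forall x, `|phi''' x| <= K) -> 0 <= c ->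
  `|phi c - phi (- c) - 2 * c * phi' 0| <= 2 * K * c ^+ 3.
Proof.
move=> d1 d2 d3 phiK c0.
pose chi t := phi t - phi (- t) - 2 * t * phi' 0.
pose chi' t := phi' t + phi' (- t) - 2 * phi' 0.
have dchi (x : R) : is_derive x 1 chi (chi' x).
  rewrite /chi /chi'.
  have dN : is_derive x 1 (fun t => phi (- t)) (- phi' (- x)).
    by apply: is_derive_eq; rewrite mulrN1.
  have dl : is_derive x 1 (fun t => 2 * t * phi' 0) (2 * phi' 0).
    by apply: is_derive_eq; rewrite scaler0 add0r /GRing.scale/=; lra.
  apply: is_derive_eq; lra.
have -> : phi c - phi (- c) - 2 * c * phi' 0 = chi c - chi 0.
  by rewrite /chi oppr0; ring.
have -> : 2 * K * c ^+ 3 = 2 * K * c ^+ 2 * (c - 0) by ring.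
apply: (mean_value_le dchi c0).
move=> x /andP[x0 xc]; rewrite /chi'.
apply: (le_trans (symmetric_difference2_le d2 d3 phiK x0)).
have K0 : 0 <= K by apply: le_trans (phiK 0).
rewrite ler_wpM2l ?mulr_ge0// ler_sqr ?nnegrE//.
Qed.

Lemma is_derive_line (p : nat) (g : 'rV[R]_p -> R) (u e : 'rV[R]_p) (t : R) :
  differentiable g (u + t *: e) ->
  is_derive t 1 (fun t => g (u + t *: e)) ('D_e g (u + t *: e)).
Proof.
move=> dg; have {}dg : derivable g (u + t *: e) e by exact: diff_derivable.
have E : (fun h : R => h^-1 *: (g (u + (h *: 1 + t) *: e) - g (u + t *: e))) =
    (fun h : R => h^-1 *: (g (h *: e + (u + t *: e)) - g (u + t *: e))).
  apply/funext => h; congr (_ *: (g _ - _)).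
  by rewrite scalerDl /GRing.scale/= mulr1 addrCA.
by split; [rewrite /derivable E|rewrite /derive E].
Qed.

End finite_differences.

(** * Averages over all sign vectors *)

Section sign_averages.
Context {R : realType} {p : nat}.
Implicit Types (s : {ffun 'I_p -> bool}) (J : {set 'I_p}) (g : 'rV[R]_p -> R).

Definition bsign (b : bool) : R := if b then 1 else -1.

Lemma bsign_sq b : bsign b ^+ 2 = 1.
Proof. by case: b; rewrite /bsign ?sqrrN expr1n. Qed.

Lemma bsignN b : bsign (~~ b) = - bsign b.
Proof. by case: b; rewrite /bsign ?opprK. Qed.

Definition signv s : 'rV[R]_p := \row_i bsign (s i).

(** Interpolates between 0 and [signv s], one coordinate at a time. *)
Definition mask_signv J s : 'rV[R]_p :=
  \row_i (if i \in J then bsign (s i) else 0).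

Definition flip J s : {ffun 'I_p -> bool} :=
  [ffun i => if i \in J then ~~ s i else s i].

Lemma flipK J : involutive (flip J).
Proof.
move=> s; apply/ffunP => i; rewrite !ffunE.
by case: (i \in J) => //; rewrite negbK.
Qed.

Lemma sum_flip J (F : {ffun 'I_p -> bool} -> R) :
  \sum_s F (flip J s) = \sum_s F s.
Proof.
rewrite (reindex_inj (inv_inj (flipK J)))/=.
by apply: eq_bigr => s _; rewrite flipK.
Qed.

(** Sign reversal permutes the sign vectors, so a sum may be symmetrised; [J] is picked so that its
    reversal cancels the odd terms. *)
Lemma sum_flip_half J (F : {ffun 'I_p -> bool} -> R) :
  2 * \sum_s F s = \sum_s (F s + F (flip J s)).
Proof. by rewrite big_split/= sum_flip; ring. Qed.

Lemma norm2_signv s : norm2 (signv s) ^+ 2 = p%:R.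
Proof.
rewrite norm2_sqE; under eq_bigr do rewrite mxE bsign_sq.
by rewrite sumr_const card_ord.
Qed.

Lemma signv_flipT s : signv (flip [set: 'I_p]%SET s) = - signv s.
Proof. by apply/rowP => i; rewrite !mxE ffunE inE bsignN. Qed.

Lemma mask_signvU1 (j : 'I_p) J s : j \notin J ->
  mask_signv (j |: J) s = mask_signv J s + bsign (s j) *: delta_mx 0 j.
Proof.
move=> jJ; apply/rowP => i; rewrite !mxE !inE eqxx/=.
case: (eqVneq i j) => [->|ij]/=; first by rewrite (negbTE jJ) add0r mulr1.
by rewrite mulr0 addr0.
Qed.

Lemma mask_signv_flip (j : 'I_p) J s : j \notin J ->
  mask_signv J (flip [set j] s) = mask_signv J s.
Proof.
move=> jJ; apply/rowP => i; rewrite !mxE; case: ifP => // iJ.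
rewrite ffunE inE; case: eqP => // ij.
by rewrite -ij iJ in jJ.
Qed.

Lemma card_sign_ffun : #|{ffun 'I_p -> bool}| = (2 ^ p)%N.
Proof. by rewrite card_ffun card_bool card_ord. Qed.

(* Adding the coordinates of [J] one at a time, the two signs of the new
   coordinate pair up into a symmetric second difference. *)
Lemma sum_mask_signv_le g (K c : R) J (x : 'rV[R]_p) :
  times_differentiable 2 g ->
  (forall j y, `|partial j (partial j g) y| <= K) -> 0 <= c ->
  `|\sum_s (g (x + c *: mask_signv J s) - g x)| <=
  2 ^+ p * (#|J|%:R * (K * c ^+ 2)).
Proof.
move=> [dg dg'] gK c0.
move En : #|J| => n; elim: n J En => [|n IH] J Jn.
  rewrite mul0r mulr0; move/eqP: Jn; rewrite cards_eq0 => /eqP ->.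
  rewrite big1 ?normr0// => s _.
  rewrite (_ : mask_signv finset.set0 s = 0) ?scaler0 ?addr0 ?subrr//.
  by apply/rowP => i; rewrite !mxE inE.
have [j jJ] : exists j, j \in J by apply/card_gt0P; rewrite Jn.
pose J' := J :\ j.
have jJ' : j \notin J' by rewrite !inE eqxx.
have J'n : #|J'| = n by have := cardsD1 j J; rewrite jJ Jn => -[->].
have {}IH := IH _ J'n.
have -> : J = j |: J' by rewrite finset.setD1K.
(* Increment due to the new coordinate [j]; what remains is the sum of the induction hypothesis. *)
pose F s := g (x + c *: mask_signv (j |: J') s) - g (x + c *: mask_signv J' s).
have -> : \sum_s (g (x + c *: mask_signv (j |: J') s) - g x) =
    \sum_s F s + \sum_s (g (x + c *: mask_signv J' s) - g x).
  by rewrite -big_split; apply: eq_bigr => s _ /=; rewrite /F addrA subrK.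
apply: (le_trans (ler_normD _ _)).
rewrite -(natr1 n) mulrDl mul1r [in leRHS]addrC mulrDr lerD//.
rewrite -(ler_pM2l (_ : 0 < 2 :> R))// -[X in X * `|_|]ger0_norm// -normrM.
rewrite (sum_flip_half [set j]).
apply: (le_trans (ler_norm_sum _ _ _)).
have -> : 2 * (2 ^+ p * (K * c ^+ 2)) = \sum_(s : {ffun 'I_p -> bool}) (2 * K * c ^+ 2).
  by rewrite sumr_const card_sign_ffun -[RHS]mulr_natl natrX; ring.
apply: ler_sum => s _.
pose u := x + c *: mask_signv J' s.
pose e : 'rV[R]_p := delta_mx 0 j.
have -> : F s + F (flip [set j] s) = g (u + c *: e) + g (u + (- c) *: e) - 2 * g (u + 0 *: e).
  rewrite /F !mask_signvU1// mask_signv_flip// ffunE inE eqxx bsignN.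
  rewrite !scalerDr !addrA -/u scale0r addr0 /bsign.
  by case: (s j); rewrite ?opprK ?scale1r ?scaleN1r ?scaleNr ?scalerN; ring.
have d1 (t : R) := is_derive_line (dg (u + t *: e)).
have d2 (t : R) := is_derive_line ((dg' j).1 (u + t *: e)).
exact: (symmetric_difference2_le d1 d2 (fun t => gK j (u + t *: e)) c0).
Qed.

Definition spsa_quotient g (c : R) (x D : 'rV[R]_p) : R :=
  (g (x + c *: D) - g (x - c *: D)) / (2 * c).

(* Pairing the directions that differ only in the sign of [q] leaves a central
   difference along [q], at a point displaced by the other coordinates. *)
Lemma spsa_bias_le g (K c : R) (q : 'I_p) (x : 'rV[R]_p) :
  times_differentiable 3 g -> third_derivative_bound g K -> 0 < c ->
  `|\sum_s (spsa_quotient g c x (signv s) * bsign (s q) - partial q g x)| <=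
  2 ^+ p * (p%:R * (K * c ^+ 2)).
Proof.
move=> dg gK c0.
have c_neq0 : c != 0 by rewrite gt_eqF.
pose e : 'rV[R]_p := delta_mx 0 q.
pose J : {set 'I_p} := [set~ q]%SET.
pose u s := x + c *: mask_signv J s.
have qJ : q \notin J by rewrite !inE eqxx.
have uE s : x + c *: signv s = u s + (c * bsign (s q)) *: e.
  have -> : signv s = mask_signv (q |: J) s.
    by apply/rowP => i; rewrite !mxE !inE orbN.
  by rewrite mask_signvU1// scalerDr addrA scalerA.
(* Two sources of bias: the central difference along [q] at the displaced point [u s], and the
   displacement of the partial derivative from [x] to [u s], whose average is of second order by
   symmetry. *)
have -> : \sum_s (spsa_quotient g c x (signv s) * bsign (s q) - partial q g x) =
   (2 * c)^-1 * \sum_s (g (u s + c *: e) - g (u s - c *: e) - 2 * c * partial q g (u s)) +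
   \sum_s (partial q g (u s) - partial q g x).
  (* Reversing all the signs exchanges forward and backward values and changes the sign of the
     weight. *)
  have E1 : \sum_s g (x - c *: signv s) * bsign (s q) = - \sum_s g (x + c *: signv s) * bsign (s q).
    rewrite -(sum_flip [set: 'I_p]%SET) -sumrN; apply: eq_bigr => s _.
    by rewrite signv_flipT scalerN opprK ffunE inE bsignN mulrN.
  have E2 : 2 * \sum_s g (x + c *: signv s) * bsign (s q) =
      \sum_s (g (u s + c *: e) - g (u s - c *: e)).
    rewrite (sum_flip_half [set q]); apply: eq_bigr => s _.
    rewrite !uE /u mask_signv_flip// ffunE inE eqxx bsignN -/(u s) /bsign.
    by case: (s q); rewrite ?opprK !mulr1 !mulrN1 ?scaleNr; ring.
  have E3 : \sum_s spsa_quotient g c x (signv s) * bsign (s q) =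
      (2 * c)^-1 * \sum_s (g (u s + c *: e) - g (u s - c *: e)).
    rewrite -E2; transitivity ((2 * c)^-1 *
        (\sum_s g (x + c *: signv s) * bsign (s q) -
         \sum_s g (x - c *: signv s) * bsign (s q))); last by rewrite E1; ring.
    rewrite -sumrB mulr_sumr; apply: eq_bigr => s _.
    by rewrite /spsa_quotient mulrAC -mulrBl mulrC.
  have -> : \sum_s (g (u s + c *: e) - g (u s - c *: e) - 2 * c * partial q g (u s)) =
      \sum_s (g (u s + c *: e) - g (u s - c *: e)) - 2 * c * \sum_s partial q g (u s).
    by rewrite sumrB -mulr_sumr.
  rewrite [LHS]sumrB E3 [\sum_s (partial q g (u s) - _)]sumrB.
  by field; rewrite c_neq0.
have p0 : (0 < p)%N by rewrite (leq_ltn_trans _ (ltn_ord q)).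
have [dg0 dg1] := dg; have [dg2 dg3] := dg1 q.
have K0 : 0 <= K by apply: le_trans (gK x q q q).
have H1 : `|\sum_s (g (u s + c *: e) - g (u s - c *: e) - 2 * c * partial q g (u s))| <=
    2 ^+ p * (2 * K * c ^+ 3).
  apply: (le_trans (ler_norm_sum _ _ _)).
  have -> : 2 ^+ p * (2 * K * c ^+ 3) = \sum_(s : {ffun 'I_p -> bool}) (2 * K * c ^+ 3).
    by rewrite sumr_const card_sign_ffun -[RHS]mulr_natl natrX.
  apply: ler_sum => s _.
  have d1 (t : R) := is_derive_line (dg0 (u s + t *: e)).
  have d2 (t : R) := is_derive_line (dg2 (u s + t *: e)).
  have d3 (t : R) := is_derive_line ((dg3 q).1 (u s + t *: e)).
  have := symmetric_difference3_le d1 d2 d3 (fun t => gK (u s + t *: e) q q q) (ltW c0).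
  by rewrite scale0r addr0 scaleNr.
have H2 : `|\sum_s (partial q g (u s) - partial q g x)| <=
    2 ^+ p * (p.-1%:R * (K * c ^+ 2)).
  (* Each of the p - 1 coordinates other than [q] contributes one K c^2; the central difference
     contributes one more, which makes p in all. *)
  have -> : p.-1 = #|J| by rewrite cardsC1 card_ord.
  by apply: sum_mask_signv_le => //; rewrite ltW.
apply: (le_trans (ler_normD _ _)); rewrite normrM (ger0_norm (_ : 0 <= (2 * c)^-1)); last first.
  by rewrite invr_ge0 mulr_ge0// ltW.
apply: (@le_trans _ _ ((2 * c)^-1 * (2 ^+ p * (2 * K * c ^+ 3)) + 2 ^+ p * (p.-1%:R * (K * c ^+ 2)))).
  by rewrite lerD// ler_wpM2l// invr_ge0 mulr_ge0// ltW.
have -> : p%:R = p.-1%:R + 1 :> R by rewrite natr1 prednK.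
rewrite le_eqVlt; apply/orP; left; apply/eqP.
by field; rewrite c_neq0.
Qed.

End sign_averages.

Section spsa_step.
Context {R : realType} {p : nat} (f : 'rV[R]_p -> R) (m M K : R).
Hypothesis m0 : 0 < m.
Hypothesis M0 : 0 < M.
Hypothesis f_convex : strong_convexity f m.
Hypothesis f_lip : gradient_lipschitz f M.
Hypothesis df : times_differentiable 3 f.
Hypothesis f_third : third_derivative_bound f K.

Definition spsa_error (c : R) (x D : 'rV[R]_p) : 'rV[R]_p :=
  spsa_quotient f c x D *: D - grad f x.

(** By the Taylor bound at both points the quotient is <grad f x, D> plus a remainder of size at
    most M c p; Cauchy-Schwarz with |D|^2 = p does the rest. *)
Lemma spsa_quotient_sq_le (c : R) (x : 'rV[R]_p) (s : {ffun 'I_p -> bool}) :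
  0 < c -> spsa_quotient f c x (signv s) ^+ 2 <=
  2 * p%:R * norm2 (grad f x) ^+ 2 + 2 * M ^+ 2 * c ^+ 2 * p%:R ^+ 2.
Proof.
move=> c0; set D := signv s.
have Dp : norm2 D ^+ 2 = p%:R := norm2_signv s.
have h1 := taylor1_le m0 M0 f_convex f_lip x (x + c *: D).
have h2 := taylor1_le m0 M0 f_convex f_lip x (x - c *: D).
move: h1 h2; rewrite !(addrC x) !addrK norm2N norm2_sqZ Dp dotVNr dotVZr.
rewrite -!(addrC x) /spsa_quotient.
set fp := f (x + _); set fm := f (x - _); set g := dotV (grad f x) D => h1 h2.
pose r := (fp - fm) / (2 * c) - g.
have rE : (fp - fm) / (2 * c) = g + r by rewrite /r; ring.
have hr : `|r| <= M * c * p%:R.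
  have -> : r = (fp - f x - c * g - (fm - f x - - (c * g))) / (2 * c).
    by rewrite /r; field; rewrite gt_eqF.
  rewrite normrM [`|_^-1|]ger0_norm ?invr_ge0 ?mulr_ge0 ?(ltW c0)//.
  rewrite ler_pdivrMr ?mulr_gt0//.
  apply: (le_trans (ler_normB _ _)); apply: (le_trans (lerD h1 h2)).
  by rewrite le_eqVlt; apply/orP; left; apply/eqP; ring.
rewrite rE; have hg := dotV_sq_le (grad f x) D.
rewrite -/g Dp in hg.
have hr2 : r ^+ 2 <= (M * c * p%:R) ^+ 2.
  by rewrite -(real_normK (num_real r)) ler_sqr ?nnegrE// !mulr_ge0// ltW.
have hgr := sqr_ge0 (g - r); rewrite sqrrB in hgr.
rewrite !exprMn in hr2; clearbody r g.
by move: hgr; rewrite (sqrrD g r); lra.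
Qed.

Lemma spsa_error_sq_le (c : R) (x : 'rV[R]_p) (s : {ffun 'I_p -> bool}) :
  0 < c -> norm2 (spsa_error c x (signv s)) ^+ 2 <=
  (4 * p%:R ^+ 2 + 2) * norm2 (grad f x) ^+ 2 + 4 * M ^+ 2 * c ^+ 2 * p%:R ^+ 3.
Proof.
move=> c0; apply: (le_trans (norm2_sqB_le _ _)).
rewrite norm2_sqZ norm2_signv.
have := ler_wpM2l (ler0n R p) (spsa_quotient_sq_le x s c0).
set q := _ ^+ 2; set g := norm2 _ ^+ 2; set P := p%:R; lra.
Qed.

Lemma spsa_mean_error_le (c : R) (x : 'rV[R]_p) : 0 < c ->
  norm2 (\sum_s spsa_error c x (signv s)) ^+ 2 <=
  (2 ^+ p) ^+ 2 * (K ^+ 2 * c ^+ 4 * p%:R ^+ 3).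
Proof.
move=> c0; rewrite norm2_sqE.
have -> : (2 ^+ p) ^+ 2 * (K ^+ 2 * c ^+ 4 * p%:R ^+ 3) =
    \sum_(i < p) (2 ^+ p * (p%:R * (K * c ^+ 2))) ^+ 2.
  by rewrite sumr_const card_ord -[RHS]mulr_natl; ring.
apply: ler_sum => i _; rewrite -[leLHS]real_normK ?num_real//.
rewrite ler_sqr ?nnegrE//; last first.
  by apply: le_trans (spsa_bias_le i x df f_third c0).
rewrite summxE; under eq_bigr do rewrite !mxE.
exact: spsa_bias_le.
Qed.

(** The cross term with [B] is linear in the error and sees only its mean, the bias; fluctuations
    enter through the second moment, hence with h^2. Young's inequality spends eta h |B|^2 on the
    cross term. *)
Lemma spsa_average_step (B x : 'rV[R]_p) (c h eta : R) : 0 < c -> 0 <= h -> 0 < eta ->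
  \sum_s norm2 (B - h *: spsa_error c x (signv s)) ^+ 2 <=
  2 ^+ p * ((1 + eta * h) * norm2 B ^+ 2 + h / eta * (K ^+ 2 * c ^+ 4 * p%:R ^+ 3) +
    h ^+ 2 * ((4 * p%:R ^+ 2 + 2) * norm2 (grad f x) ^+ 2 +
              4 * M ^+ 2 * c ^+ 2 * p%:R ^+ 3)).
Proof.
move=> c0 h0 eta0; set N := fun s => spsa_error c x (signv s).
pose b := \sum_s N s.
have sum_cst (a : R) : \sum_(s : {ffun 'I_p -> bool}) a = 2 ^+ p * a.
  by rewrite sumr_const card_sign_ffun -[LHS]mulr_natl natrX.
have dot_b : dotV B b = \sum_s dotV B (N s).
  rewrite /dotV /b exchange_big/=; apply: eq_bigr => i _.
  by rewrite summxE mulr_sumr.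
have -> : \sum_s norm2 (B - h *: N s) ^+ 2 =
    2 ^+ p * norm2 B ^+ 2 + h * (2 * dotV (- B) b) + h ^+ 2 * \sum_s norm2 (N s) ^+ 2.
  transitivity (\sum_s (norm2 B ^+ 2 + (- (2 * h) * dotV B (N s) + h ^+ 2 * norm2 (N s) ^+ 2))).
    by apply: eq_bigr => s _; rewrite norm2_sqB norm2_sqZ dotVZr; ring.
  by rewrite !big_split/= sum_cst -!mulr_sumr -dot_b dotVNl; ring.
have P0 : 0 < 2 ^+ p :> R by rewrite exprn_gt0.
(* [b] is a sum of 2^p vectors and not their average, so the weight carries the factor 2^p. *)
have h1 := dotV_young (- B) b (mulr_gt0 P0 eta0).
rewrite norm2N in h1.
have h2 : norm2 b ^+ 2 / (2 ^+ p * eta) <= 2 ^+ p / eta * (K ^+ 2 * c ^+ 4 * p%:R ^+ 3).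
  rewrite ler_pdivrMr ?mulr_gt0//; apply: (le_trans (spsa_mean_error_le x c0)).
  by rewrite le_eqVlt; apply/orP; left; apply/eqP; field; rewrite gt_eqF.
have h3 : \sum_s norm2 (N s) ^+ 2 <= 2 ^+ p * ((4 * p%:R ^+ 2 + 2) * norm2 (grad f x) ^+ 2 +
              4 * M ^+ 2 * c ^+ 2 * p%:R ^+ 3).
  by rewrite -sum_cst; apply: ler_sum => s _; exact: spsa_error_sq_le.
have h4 := ler_wpM2l h0 (le_trans h1 (lerD (lexx _) h2)).
have h5 := ler_wpM2l (sqr_ge0 h) h3.
apply: (le_trans (lerD (lerD (lexx _) h4) h5)).
by rewrite le_eqVlt; apply/orP; left; apply/eqP; ring.
Qed.

End spsa_step.

(** * The scalar recursion *)

Section asymptotics.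
Context {R : realType}.

(** (1 + 1/n)^(-s) = exp(- s ln(1 + 1/n)) is at least 1 - s/n, because ln(1 + x) <= x and e^x >= 1 +
    x. *)
Lemma powR_succ_ge (n s : R) : 0 < n -> 0 <= s ->
  n `^ (- s) * (1 - s / n) <= (n + 1) `^ (- s).
Proof.
move=> n0 s0; have n1 : 0 < n + 1 by lra.
rewrite /powR !gt_eqF//.
have -> : ln (n + 1) = ln n + ln (1 + n^-1).
  by rewrite -lnM ?posrE ?addr_gt0 ?invr_gt0// mulrDr mulr1 divff ?gt_eqF.
rewrite (mulrDr (- s) (ln n)) expRD ler_wpM2l ?expR_ge0//.
apply: le_trans (expR_ge1Dx _).
have : ln (1 + n^-1) <= n^-1.
  apply: le_ln1Dx; have : 0 < n^-1 by rewrite invr_gt0.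
  lra.
move=> /(ler_wpM2l s0); lra.
Qed.

(** Here x = 1/n, A = n^(-2/3) and B = n^(-5/6). For lam >= 1 the term 4 b A loses 4 b A x, which
    pays for the forcing b A x and for the decay (8/3) b A x of the bound. The term K' B has K' B x
    / 6 to spare: half absorbs K x^2 K' B and half the other terms in K x^2, whence the two
    conditions with 12 K. *)
Lemma recursion_step_le (x lam K b K' A B : R) :
  0 <= x -> 1 <= lam -> 0 <= K -> 0 <= b -> 0 <= A -> A <= 1 -> x <= B ->
  12 * K * x <= 1 -> 12 * K * (1 + 4 * b) <= K' ->
  (1 - lam * x + K * x ^+ 2) * (4 * b * A + K' * B) + b * A * x + K * x ^+ 2 <=
  4 * b * (A * (1 - 2 / 3 * x)) + K' * (B * (1 - 5 / 6 * x)).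
Proof.
move=> x0 lam1 K0 b0 A0 A1 xB Kx K'K.
have B0 : 0 <= B by lra.
have K'0 : 0 <= K' by apply: le_trans K'K; rewrite !mulr_ge0// addr_ge0// mulr_ge0.
have xB0 : 0 <= x * B by rewrite mulr_ge0.
have h1 : K * x * (x * (4 * b * A)) <= K * (4 * b) * (x * B).
  have : x * A <= B * 1 by apply: ler_pM.
  move=> /(ler_wpM2l (_ : 0 <= K * x * (4 * b))).
  by rewrite !mulr_ge0// => /(_ isT); lra.
have h2 : K * x * x <= K * (x * B).
  by rewrite -mulrA; apply: ler_wpM2l => //; apply: ler_wpM2l.
have h3 : K * x * (x * (K' * B)) <= 12^-1 * (K' * (x * B)).
  have -> : K * x * (x * (K' * B)) = (K * x) * (K' * (x * B)) by ring.
  by apply: ler_wpM2r; [rewrite mulr_ge0|lra].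
have h4 : 12 * K * (1 + 4 * b) * (x * B) <= K' * (x * B) by apply: ler_wpM2r.
have h5 : 0 <= (lam - 1) * (x * (4 * b * A + K' * B)).
  by rewrite mulr_ge0 ?subr_ge0// mulr_ge0// addr_ge0 ?mulr_ge0.
have h6 : 0 <= b * A * x by rewrite !mulr_ge0.
lra.
Qed.

(* In place of 5/6, any exponent strictly between 2/3 and 1 would do. *)
Lemma recursion_bound (e : nat -> R) (k0 lam b K : R) :
  1 <= k0 -> 1 <= lam -> 0 <= b -> 0 <= K -> (forall k, 0 <= e k) ->
  (forall k, e k.+1 <= (1 - lam / (k%:R + k0) + K / (k%:R + k0) ^+ 2) * e k
     + b * (k%:R + k0) `^ (- (2 / 3)) / (k%:R + k0) + K / (k%:R + k0) ^+ 2) ->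
  exists2 K' : R, 0 < K' & forall k,
    e k <= 4 * b * (k%:R + k0) `^ (- (2 / 3)) + K' * (k%:R + k0) `^ (- (5 / 6)).
Proof.
move=> k01 lam1 b0 K0 e0 eS.
pose n k : R := k%:R + k0.
have n1 k : 1 <= n k by rewrite /n (le_trans k01)// lerDr.
have n0 k : 0 < n k by rewrite (lt_le_trans _ (n1 k)).
(* From index [N] on, n k is at least lam + 12 K: the coefficient of [e] is then nonnegative, so the
   induction hypothesis can be inserted, and 12 K / n k <= 1. *)
pose N := (Num.truncn (lam + 12 * K)).+1.
have NlamK : lam + 12 * K <= N%:R.
  by rewrite ltW// truncnS_gt.
pose S := \sum_(i < N.+1) e i.
(* The first summand feeds the induction step, the second dominates the terms up to index [N], and
   the last makes [K'] positive. *)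
pose K' := 12 * K * (1 + 4 * b) + S * (n N) `^ (5 / 6) + 1.
have S0 : 0 <= S by apply: sumr_ge0 => i _; exact: e0.
have K'1 : 12 * K * (1 + 4 * b) <= K'.
  by rewrite /K' -addrA lerDl addr_ge0 ?mulr_ge0 ?powR_ge0.
have h0 : 0 <= 12 * K * (1 + 4 * b) by rewrite !mulr_ge0//; lra.
have K'0 : 0 < K'.
  by rewrite /K' ltr_wpDl// addr_ge0 ?mulr_ge0 ?powR_ge0//; lra.
exists K' => // k.
have [kN|Nk] := leqP k N.
  apply: (@le_trans _ _ (K' * n k `^ (- (5 / 6)))); last first.
    by rewrite lerDr !mulr_ge0 ?powR_ge0.
  apply: (@le_trans _ _ (K' * n N `^ (- (5 / 6)))); last first.
    rewrite ler_wpM2l ?(ltW K'0)// !powRN lef_pV2 ?posrE ?powR_gt0//.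
    apply: ge0_ler_powR; rewrite ?nnegrE ?(ltW (n0 _))//.
    by rewrite /n lerD2r ler_nat.
  rewrite powRN ler_pdivlMr ?powR_gt0//.
  apply: (@le_trans _ _ (S * n N `^ (5 / 6))); last by rewrite /K'; lra.
  rewrite ler_wpM2r ?powR_ge0// /S (bigD1 (Ordinal (kN : (k < N.+1)%N)))//=.
  by rewrite lerDl sumr_ge0.
rewrite -(subnK (ltnW Nk)); elim: (k - N)%N => [|j IH].
  rewrite add0n.
  apply: (@le_trans _ _ (K' * n N `^ (- (5 / 6)))); last first.
    by rewrite lerDr !mulr_ge0 ?powR_ge0.
  rewrite powRN ler_pdivlMr ?powR_gt0//.
  apply: (@le_trans _ _ (S * n N `^ (5 / 6))); last by rewrite /K'; lra.
  rewrite ler_wpM2r ?powR_ge0// /S big_ord_recr/=.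
  by rewrite lerDr sumr_ge0.
rewrite addSn; set i := (j + N)%N in IH *.
have iN : lam + 12 * K <= n i.
  apply: (le_trans NlamK); rewrite /n /i natrD; have := ler0n R j; lra.
pose x := (n i)^-1.
have x0 : 0 < x by rewrite invr_gt0.
have lamx : lam * x <= 1 by rewrite ler_pdivrMr// mul1r; lra.
have Kx : 12 * K * x <= 1 by rewrite ler_pdivrMr// mul1r; lra.
apply: (le_trans (eS i)).
rewrite -/(n i) -/(n i.+1) -exprVn -/x.
have -> : n i.+1 = n i + 1 by rewrite /n -natr1; ring.
set A := n i `^ (- (2 / 3)); set B := n i `^ (- (5 / 6)).
have coef0 : 0 <= 1 - lam * x + K * x ^+ 2.
  by rewrite addr_ge0 ?subr_ge0// mulr_ge0// exprn_ge0 ?ltW.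
have A1 : A <= 1.
  by rewrite -(powRr0 (n i)) ler_powR ?n1//; lra.
have xB : x <= B.
  by rewrite /x -powR_inv1 ?(ltW (n0 i))// ler_powR ?n1//; lra.
have := recursion_step_le (ltW x0) lam1 K0 b0 (powR_ge0 _ _) A1 xB Kx K'1.
have hA : A * (1 - 2 / 3 * x) <= (n i + 1) `^ (- (2 / 3)) by apply: powR_succ_ge.
have hB : B * (1 - 5 / 6 * x) <= (n i + 1) `^ (- (5 / 6)) by apply: powR_succ_ge.
have hA' := ler_wpM2l (_ : 0 <= 4 * b) hA.
have hB' := ler_wpM2l (ltW K'0) hB.
have := ler_wpM2l coef0 IH; rewrite -/(n i) -/A -/B.
have {}hA' := hA' (mulr_ge0 (ler0n R 4) b0).
lra.
Qed.

End asymptotics.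

(** * Adapted couplings *)

Section metropolis_mixture.
Local Open Scope ereal_scope.
Context d (T : measurableType d) (R : realType) (Q : probability T R).
Variables (S : T -> T) (a : T -> R).
Hypotheses (mS : measurable_fun setT S) (ma : measurable_fun setT a).
Hypotheses (a0 : forall z, (0 <= a z)%R) (a1 : forall z, (a z <= 1)%R).

Let mb : measurable_fun setT (fun z => 1 - a z)%R.
Proof. exact: measurable_funB. Qed.

Let b0 z : (0 <= 1 - a z)%R. Proof. by rewrite subr_ge0. Qed.

Let mix : {measure set T -> \bar R} := measure_add
  (pushforward_measure (measure_with_density Q ma a0) mS)
  (measure_with_density Q mb b0).

Let integral_mix (phi : T -> \bar R) : measurable_fun setT phi ->
  (forall z, 0 <= phi z) ->
  \int[mix]_z phi z =
  \int[Q]_z ((a z)%:E * phi (S z) + (1 - a z)%:E * phi z).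
Proof.
move=> mphi phi0.
rewrite /mix (ge0_integral_measure_add _ _ measurableT)//.
rewrite ge0_integral_pushforward//= preimage_setT.
rewrite (@ge0_integral_density _ _ _ Q (measure_with_density Q ma a0) a)//; last first.
  exact: measurableT_comp.
rewrite (@ge0_integral_density _ _ _ Q (measure_with_density Q mb b0) (fun z => 1 - a z)%R)//.
rewrite -ge0_integralD//; last 4 first.
- by move=> z _; rewrite mule_ge0// lee_fin.
- by apply: emeasurable_funM; [exact: measurableT_comp|exact/measurable_EFinP].
- by move=> z _; rewrite mule_ge0// lee_fin.
- by apply: emeasurable_funM => //; exact/measurable_EFinP.
by apply: eq_integral => z _; congr (_ + _); rewrite muleC.
Qed.

(** [Q'] is a Q pushed forward by [S] plus (1 - a) Q: an accept-reject step with the uniform draw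
    integrated out, on the same space as [Q]. *)
Lemma metropolis_mixture : exists Q' : probability T R,
  forall phi : T -> \bar R, measurable_fun setT phi -> (forall z, 0 <= phi z) ->
  \int[Q']_z phi z =
  \int[Q]_z ((a z)%:E * phi (S z) + (1 - a z)%:E * phi z).
Proof.
have mix1 : mix setT = 1%:E.
  rewrite -[LHS]mul1e -(@integral_cst _ _ _ mix setT measurableT 1%E).
  rewrite integral_mix//.
  transitivity (\int[Q]_z (cst 1%E z)).
    by apply: eq_integral => z _; rewrite /= !mule1 -EFinD addrC subrK.
  by rewrite integral_cst//= probability_setT mule1.
pose Q' : probability T R :=
  HB.pack (mix : set T -> \bar R) (Measure.class mix)
    (@Measure_isProbability.Build _ _ R mix mix1).
by exists Q'; exact: integral_mix.
Qed.

End metropolis_mixture.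

Section conditional_independence.
Local Open Scope ereal_scope.
Context d (Omega : measurableType d) d' (T : measurableType d') (R : realType).
Variable P : probability Omega R.
Implicit Types (G : set (set Omega)) (Q : probability (Omega * T)%type R).

(* Under [Q] the conditional law of the second component given the first is
   [G]-measurable; this dual formulation avoids disintegrations. *)
Definition second_adapted G Q : Prop :=
  forall psi1 psi2 : Omega -> R,
    measurable_fun setT psi1 -> measurable_fun setT psi2 ->
    (forall w, 0 <= psi1 w)%R -> (forall w, 0 <= psi2 w)%R ->
    \int[P]_w (psi1 w)%:E < +oo -> \int[P]_w (psi2 w)%:E < +oo ->
    (forall C, G C -> \int[P]_(w in C) (psi1 w)%:E = \int[P]_(w in C) (psi2 w)%:E) ->
    forall B, measurable B ->
      \int[Q]_z (psi1 z.1 * \1_B z.2)%:E = \int[Q]_z (psi2 z.1 * \1_B z.2)%:E.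

Lemma first_marginal_integral Q (phi : Omega -> \bar R) :
  (forall A, measurable A -> Q (A `*` setT) = P A) ->
  measurable_fun setT phi -> (forall w, 0 <= phi w) ->
  \int[Q]_z phi z.1 = \int[P]_w phi w.
Proof.
move=> QP mphi phi0.
transitivity (\int[pushforward_measure Q (@measurable_fst _ _ Omega T)]_w phi w).
  by rewrite ge0_integral_pushforward//; exact: measurable_fst.
apply: eq_measure_integral.
move=> A mA _; apply: etrans (QP A mA); congr (Q _).
by apply/seteqP; split => -[w t] //= [].
Qed.

Lemma second_marginal_integral Q (mu : probability T R) (phi : T -> \bar R) :
  (forall B, measurable B -> Q (setT `*` B) = mu B) ->
  measurable_fun setT phi -> (forall t, 0 <= phi t) ->
  \int[Q]_z phi z.2 = \int[mu]_t phi t.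
Proof.
move=> Qmu mphi phi0.
transitivity (\int[pushforward_measure Q (@measurable_snd _ _ Omega T)]_t phi t).
  by rewrite ge0_integral_pushforward//; exact: measurable_snd.
apply: eq_measure_integral.
move=> B mB _; apply: etrans (Qmu B mB); congr (Q _).
by apply/seteqP; split => -[w t] //= [].
Qed.

(** Weighting [psi1] and [psi2] by the indicator of an event of [v] keeps their integrals over sets
    of [G] equal, since intersecting with that event stays in [G']. The identity thus holds on
    rectangles and extends by uniqueness of measures. [G'] may exceed [G], so that [v] may be a
    variable revealed only at the current step. *)
Lemma second_adapted_integral d2 (V : measurableType d2) (v : Omega -> V)
    G G' Q (psi1 psi2 : Omega -> R) (phi : V * T -> \bar R) :
  (forall A, measurable A -> Q (A `*` setT) = P A) ->
  second_adapted G Q -> G `<=` G' -> setI_closed G' ->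
  (forall C, G C -> measurable C) ->
  measurable_fun setT v -> (forall E, measurable E -> G' (v @^-1` E)) ->
  measurable_fun setT psi1 -> measurable_fun setT psi2 ->
  (forall w, 0 <= psi1 w)%R -> (forall w, 0 <= psi2 w)%R ->
  \int[P]_w (psi1 w)%:E < +oo -> \int[P]_w (psi2 w)%:E < +oo ->
  (forall C, G' C -> \int[P]_(w in C) (psi1 w)%:E = \int[P]_(w in C) (psi2 w)%:E) ->
  measurable_fun setT phi -> (forall u, 0 <= phi u) ->
  \int[Q]_z ((psi1 z.1)%:E * phi (v z.1, z.2)) =
  \int[Q]_z ((psi2 z.1)%:E * phi (v z.1, z.2)).
Proof.
move=> QP GQ GG' IG' mG mv vG' m1 m2 p10 p20 i1 i2 E12 mphi phi0.
pose F (z : Omega * T) := (v z.1, z.2).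
have mF : measurable_fun setT F.
  apply/measurable_fun_pairP; split; last exact: measurable_snd.
  exact: (measurableT_comp mv measurable_fst).
have mpsi (psi : Omega -> R) : measurable_fun setT psi ->
    measurable_fun setT (fun z : Omega * T => psi z.1).
  by move=> mpsi; exact: (measurableT_comp mpsi measurable_fst).
pose mu (psi : Omega -> R) (mpsi1 : measurable_fun setT psi) (psi0 : forall w, (0 <= psi w)%R) :=
  pushforward_measure (measure_with_density Q (mpsi psi mpsi1) (fun z => psi0 z.1)) mF.
have muE (psi : Omega -> R) (mpsi1 : measurable_fun setT psi) (psi0 : forall w, (0 <= psi w)%R) :
    \int[Q]_z ((psi z.1)%:E * phi (v z.1, z.2)) = \int[mu psi mpsi1 psi0]_u phi u.
  rewrite ge0_integral_pushforward//= preimage_setT.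
  rewrite (@ge0_integral_density _ _ _ Q (measure_with_density Q (mpsi psi mpsi1) (fun z => psi0 z.1)) (fun z => psi z.1))//.
  - by apply: eq_integral => z _; rewrite muleC.
  - exact: (mpsi psi mpsi1).
  - exact: (measurableT_comp mphi mF).
rewrite (muE _ m1 p10) (muE _ m2 p20); apply: eq_measure_integral => A mA _.
have rect (psi : Omega -> R) (mpsi1 : measurable_fun setT psi) (psi0 : forall w, (0 <= psi w)%R) E B :
    measurable E -> measurable B ->
    mu psi mpsi1 psi0 (E `*` B) =
    \int[Q]_z ((fun w => (psi w * \1_(v @^-1` E) w)%R) z.1 * \1_B z.2)%:E.
  move=> mE mB.
  rewrite -[LHS]/(\int[Q]_(z in F @^-1` (E `*` B)) (psi z.1)%:E).
  rewrite integral_mkcond; apply: eq_integral => z _; rewrite patchE /= !indicE.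
  have -> : (z \in F @^-1` (E `*` B)) = (z.1 \in v @^-1` E) && (z.2 \in B).
    by apply/idP/andP => [/[!inE] -[]//|[]]; rewrite !inE.
  by case: (z.1 \in _); case: (z.2 \in _); rewrite ?mulr1 ?mulr0 ?mul0r.
have mvE E : measurable E -> measurable (v @^-1` E).
  by move=> mE; rewrite -[X in measurable X]setTI; exact: mv.
have m1' (psi : Omega -> R) E : measurable_fun setT psi -> measurable E ->
    measurable_fun setT (fun w => (psi w * \1_(v @^-1` E) w)%R).
  move=> mp mE; apply: measurable_funM => //.
  by apply: measurable_indic; exact: mvE.
have ge0' (psi : Omega -> R) E : (forall w, 0 <= psi w)%R ->
    forall w, (0 <= (fun w => (psi w * \1_(v @^-1` E) w)%R) w)%R.
  by move=> p0 w; rewrite mulr_ge0.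
have int' (psi : Omega -> R) E : measurable_fun setT psi -> (forall w, 0 <= psi w)%R ->
    \int[P]_w (psi w)%:E < +oo -> measurable E ->
    \int[P]_w ((fun w => (psi w * \1_(v @^-1` E) w)%R) w)%:E < +oo.
  move=> mp p0 ip mE; apply: le_lt_trans ip; apply: ge0_le_integral => //.
  - by move=> w _; rewrite lee_fin ge0'.
  - by apply/measurable_EFinP; exact: m1'.
  - exact/measurable_EFinP.
  - by move=> w _; rewrite lee_fin/= ler_piMr// indicE; case: (_ \in _).
have intC (psi : Omega -> R) E C : measurable E -> measurable_fun setT psi -> (forall w, 0 <= psi w)%R ->
    \int[P]_(w in C) ((fun w => (psi w * \1_(v @^-1` E) w)%R) w)%:E =
    \int[P]_(w in C `&` v @^-1` E) (psi w)%:E.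
  move=> mE mp p0; rewrite integral_mkcond [RHS]integral_mkcond.
  apply: eq_integral => w _; rewrite !patchE/= in_setI indicE.
  by case: (w \in C) => //=; case: (w \in _); rewrite ?mulr1 ?mulr0.
pose C0 : set (set (V * T)) := [set A `*` B | A in measurable & B in measurable].
apply: (measure_unique C0 (fun=> setT)) => //.
- by rewrite measurable_prod_measurableType.
- move=> _ _ [A1 mA1 [B1 mB1 <-]] [A2 mA2 [B2 mB2 <-]]; rewrite -setXI.
  by exists (A1 `&` A2); [exact: measurableI|exists (B1 `&` B2) => //; exact: measurableI].
- by move=> _; exists setT => //; exists setT => //; rewrite setXTT.
- by apply/seteqP; split => // z _; exists 0%N.
- move=> _ [E mE [B mB <-]]; rewrite !rect//.
  apply: (GQ _ _ (m1' _ _ m1 mE) (m1' _ _ m2 mE) (ge0' _ E p10) (ge0' _ E p20)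
    (int' _ _ m1 p10 i1 mE) (int' _ _ m2 p20 i2 mE) _ _ mB) => C GC.
  rewrite !intC//; apply: E12; apply: IG'; first exact: GG'.
  exact: vG'.
(* The uniqueness argument wants finite total mass: it is the integral of [psi1] under the first
   marginal. *)
- move=> _; rewrite -setXTT rect//.
  rewrite (_ : \int[Q]_z _ = \int[Q]_z (psi1 z.1)%:E).
    rewrite (first_marginal_integral QP (phi := fun w => (psi1 w)%:E))//.
    exact/measurable_EFinP.
  by apply: eq_integral => z _; rewrite /= preimage_setT !indicT !mulr1.
Qed.

End conditional_independence.

(** * Drift of the coupled pair *)

Section spsa_drift.
Context {R : realType} {p : nat} (f : 'rV[R]_p -> R) (m M K : R).
Hypothesis m0 : 0 < m.
Hypothesis M0 : 0 < M.
Hypothesis f_convex : strong_convexity f m.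
Hypothesis f_lip : gradient_lipschitz f M.
Hypothesis df : times_differentiable 3 f.
Hypothesis f_third : third_derivative_bound f K.
Hypothesis mf : measurable_fun setT f.
Hypothesis mgrad : measurable_fun setT (grad f).

(** Gap between the step from [u.1] in direction [s], without measurement noise, and the Langevin
    proposal from [u.2]; the shared Gaussian vector has cancelled. *)
Definition spsa_drift (h c : R) (s : {ffun 'I_p -> bool})
    (u : 'rV[R]_p * 'rV[R]_p) : 'rV[R]_p :=
  u.1 - u.2 - h *: (grad f u.1 - grad f u.2) - h *: spsa_error f c u.1 (signv s).

Lemma measurable_spsa_quotient d (T : measurableType d) (c : R) (F D : T -> 'rV[R]_p) :
  measurable_fun setT F -> measurable_fun setT D ->
  measurable_fun setT (fun t => spsa_quotient f c (F t) (D t)).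
Proof.
move=> mF mD; apply: measurable_funM => //; apply: measurable_funB.
  apply: (measurableT_comp mf); apply: measurable_funD_rV => //.
  exact: measurable_funZ_rV.
apply: (measurableT_comp mf); apply: measurable_funB_rV => //.
exact: measurable_funZ_rV.
Qed.

Lemma measurable_spsa_drift h c s : measurable_fun setT (spsa_drift h c s).
Proof.
have mg1 := measurableT_comp mgrad (@measurable_fst _ _ 'rV[R]_p 'rV[R]_p).
have mg2 := measurableT_comp mgrad (@measurable_snd _ _ 'rV[R]_p 'rV[R]_p).
apply: measurable_funB_rV.
  apply: measurable_funB_rV; first exact: measurable_funB_rV.
  by apply: measurable_funZ_rV => //; exact: measurable_funB_rV.
apply: measurable_funZ_rV => //; apply: measurable_funB_rV => //.
by apply: measurable_funZ_rV => //; exact: measurable_spsa_quotient.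
Qed.

Definition drift_rate (eta h : R) : R :=
  (1 + eta * h) * (1 - 2 * m * h + M ^+ 2 * h ^+ 2) +
  h ^+ 2 * (2 * M ^+ 2 * (4 * p%:R ^+ 2 + 2)).

Definition drift_bias (eta h c : R) : R :=
  h / eta * (K ^+ 2 * c ^+ 4 * p%:R ^+ 3) +
  h ^+ 2 * (4 * M ^+ 2 * c ^+ 2 * p%:R ^+ 3).

(** The gradient at [u.1] is traded for the one at [u.2], whose law will be pi; the price,
    proportional to |u.1 - u.2|^2, is the last term of [drift_rate]. *)
Lemma spsa_drift_le (eta h c : R) (u : 'rV[R]_p * 'rV[R]_p) :
  0 < eta -> 0 <= h -> 0 < c ->
  \sum_s norm2 (spsa_drift h c s u) ^+ 2 <=
  2 ^+ p * (drift_rate eta h * norm2 (u.1 - u.2) ^+ 2 +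
    h ^+ 2 * (8 * p%:R ^+ 2 + 4) * norm2 (grad f u.2) ^+ 2 + drift_bias eta h c).
Proof.
move=> eta0 h0 c0.
apply: (le_trans (spsa_average_step m0 M0 f_convex f_lip df f_third _ u.1 c0 h0 eta0)).
apply: ler_wpM2l; first by rewrite exprn_ge0.
have h1 := gradient_step_contraction M0 f_convex f_lip u.1 u.2 h0.
have h2 := norm2_grad_le M0 f_lip u.1 u.2.
have h3 : 0 <= 1 + eta * h by rewrite addr_ge0// mulr_ge0// ltW.
have h4 : 0 <= h ^+ 2 * (4 * p%:R ^+ 2 + 2).
  by rewrite mulr_ge0 ?sqr_ge0// addr_ge0// mulr_ge0// sqr_ge0.
have := ler_wpM2l h3 h1; have := ler_wpM2l h4 h2.
rewrite /drift_rate /drift_bias.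
move: (norm2 _ ^+ 2) (norm2 (u.1 - u.2) ^+ 2) (norm2 (grad f u.1) ^+ 2)
  (norm2 (grad f u.2) ^+ 2) (_ / eta * _) (p%:R ^+ 2) => B D g1 g2 b P.
lra.
Qed.

End spsa_drift.

Section ge0_real_integral.
Local Open Scope ereal_scope.
Context d (T : measurableType d) (R : realType) (Q : {measure set T -> \bar R}).
Implicit Types g : T -> R.

Lemma ge0_integralD_EFin g1 g2 : measurable_fun setT g1 -> measurable_fun setT g2 ->
  (forall t, 0 <= g1 t)%R -> (forall t, 0 <= g2 t)%R ->
  \int[Q]_t (g1 t + g2 t)%:E = \int[Q]_t (g1 t)%:E + \int[Q]_t (g2 t)%:E.
Proof.
move=> m1 m2 p1 p2; under eq_integral do rewrite EFinD.
by rewrite ge0_integralD//; [move=> t _; rewrite lee_fin|exact/measurable_EFinP|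
  move=> t _; rewrite lee_fin|exact/measurable_EFinP].
Qed.

Lemma ge0_integralZ_EFin (k : R) g : measurable_fun setT g ->
  (forall t, 0 <= g t)%R -> (0 <= k)%R ->
  \int[Q]_t (k * g t)%:E = k%:E * \int[Q]_t (g t)%:E.
Proof.
move=> mg g0 k0; under eq_integral do rewrite EFinM.
by rewrite ge0_integralZl_EFin//; [move=> t _; rewrite lee_fin|exact/measurable_EFinP].
Qed.

Lemma ge0_le_integral_EFin g1 g2 : measurable_fun setT g1 -> measurable_fun setT g2 ->
  (forall t, 0 <= g1 t)%R -> (forall t, g1 t <= g2 t)%R ->
  \int[Q]_t (g1 t)%:E <= \int[Q]_t (g2 t)%:E.
Proof.
move=> m1 m2 p1 p12; apply: ge0_le_integral => //.
- by move=> t _; rewrite lee_fin.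
- exact/measurable_EFinP.
- exact/measurable_EFinP.
- by move=> t _; rewrite lee_fin.
Qed.

Lemma ge0_integral_sum_EFin (I : finType) (g : I -> T -> R) :
  (forall i, measurable_fun setT (g i)) -> (forall i t, 0 <= g i t)%R ->
  \int[Q]_t (\sum_i g i t)%:E = \sum_i \int[Q]_t (g i t)%:E.
Proof.
move=> mg g0; under eq_integral do rewrite -sumEFin.
rewrite ge0_integral_sum//; first by move=> i; exact/measurable_EFinP.
by move=> i t _; rewrite lee_fin.
Qed.

End ge0_real_integral.

Lemma max0B (R : realDomainType) (x : R) : Num.max x 0 - Num.max (- x) 0 = x.
Proof. by case: (leP x 0) => hx; case: (leP (- x) 0) => hy; lra. Qed.

Lemma max0_sqD (R : realDomainType) (x : R) :
  Num.max x 0 ^+ 2 + Num.max (- x) 0 ^+ 2 = x ^+ 2.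
Proof.
case: (leP x 0) => hx; case: (leP (- x) 0) => hy; last by lra.
- have -> : x = 0 by lra.
  by rewrite expr0n addr0.
- by rewrite sqrrN expr0n add0r.
- by rewrite expr0n addr0.
Qed.

(** * Orthogonality of centered noise *)

Section centered_noise.
Local Open Scope ereal_scope.
Context d (T : measurableType d) (R : realType) (Q : {measure set T -> \bar R}) (p : nat).
Variables (i e : T -> R) (U : T -> 'rV[R]_p) (D : 'rV[R]_p) (t : R).
Hypotheses (mi : measurable_fun setT i) (me : measurable_fun setT e).
Hypothesis mU : measurable_fun setT U.
Hypotheses (i0 : forall z, (0 <= i z)%R) (t0 : (0 <= t)%R).
Let u z := dotV (U z) D.
Let pos (x : R) := Num.max x 0%R.
Let neg (x : R) := Num.max (- x)%R 0%R.

Hypothesis e_u_pos : \int[Q]_z (i z * pos (e z) * pos (u z))%:E =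
  \int[Q]_z (i z * neg (e z) * pos (u z))%:E.
Hypothesis e_u_neg : \int[Q]_z (i z * pos (e z) * neg (u z))%:E =
  \int[Q]_z (i z * neg (e z) * neg (u z))%:E.
Hypothesis U_fin : \int[Q]_z (i z * norm2 (U z) ^+ 2)%:E < +oo.
Hypothesis e_fin : \int[Q]_z (i z * e z ^+ 2)%:E < +oo.

(* The expansion of the square is split into positive and negative parts so
   that only integrals of nonnegative functions occur. *)
Lemma integral_centered_noise :
  \int[Q]_z (i z * norm2 (U z - (t * e z) *: D) ^+ 2)%:E =
  \int[Q]_z (i z * norm2 (U z) ^+ 2)%:E +
  (t ^+ 2 * norm2 D ^+ 2)%:E * \int[Q]_z (i z * e z ^+ 2)%:E.
Proof.
have pos0 x : (0 <= pos x)%R by rewrite /pos le_max lexx orbT.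
have neg0 x : (0 <= neg x)%R by rewrite /neg le_max lexx orbT.
have posneg x : (x = pos x - neg x)%R.
  by rewrite /pos /neg max0B.
have mu : measurable_fun setT u by exact: measurable_dotV.
have mpos (g : T -> R) : measurable_fun setT g -> measurable_fun setT (fun z => pos (g z)).
  by move=> mg; apply: measurable_maxr.
have mneg (g : T -> R) : measurable_fun setT g -> measurable_fun setT (fun z => neg (g z)).
  by move=> mg; apply: measurable_maxr => //; exact: measurableT_comp.
have m4 (a b : T -> R) : measurable_fun setT a -> measurable_fun setT b ->
    measurable_fun setT (fun z => i z * a z * b z)%R.
  by move=> ma mb; apply: measurable_funM => //; exact: measurable_funM.
pose pp z := (i z * pos (e z) * pos (u z))%R.
pose np z := (i z * neg (e z) * pos (u z))%R.
pose pn z := (i z * pos (e z) * neg (u z))%R.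
pose nn z := (i z * neg (e z) * neg (u z))%R.
have mpp : measurable_fun setT pp by apply: m4; exact: mpos.
have mnp : measurable_fun setT np by apply: m4; [exact: mneg|exact: mpos].
have mpn : measurable_fun setT pn by apply: m4; [exact: mpos|exact: mneg].
have mnn : measurable_fun setT nn by apply: m4; exact: mneg.
have pp0 z : (0 <= pp z)%R by rewrite !mulr_ge0.
have np0 z : (0 <= np z)%R by rewrite !mulr_ge0.
have pn0 z : (0 <= pn z)%R by rewrite !mulr_ge0.
have nn0 z : (0 <= nn z)%R by rewrite !mulr_ge0.
pose L z := (i z * norm2 (U z - (t * e z) *: D) ^+ 2)%R.
pose V z := (i z * norm2 (U z) ^+ 2)%R.
pose W z := (i z * e z ^+ 2)%R.
have mL : measurable_fun setT L.
  apply: measurable_funM => //; apply: measurable_norm2_sq.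
  apply: measurable_funB_rV => //; apply: measurable_funZ_rV => //.
  exact: measurable_funM.
have mV : measurable_fun setT V.
  by apply: measurable_funM => //; exact: measurable_norm2_sq.
have mW : measurable_fun setT W.
  by apply: measurable_funM => //; exact: measurable_funX.
have L0 z : (0 <= L z)%R by rewrite mulr_ge0 ?sqr_ge0.
have V0 z : (0 <= V z)%R by rewrite mulr_ge0 ?sqr_ge0.
have W0 z : (0 <= W z)%R by rewrite mulr_ge0 ?sqr_ge0.
have k0 : (0 <= t ^+ 2 * norm2 D ^+ 2)%R by rewrite mulr_ge0 ?sqr_ge0.
have t20 : (0 <= 2 * t)%R by rewrite mulr_ge0.
(* The product of noise and drift has four parts; those that enter with a minus sign are moved
   across, so that every integrand is nonnegative. *)
have key z : (L z + 2 * t * (pp z + nn z) =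
    (V z + t ^+ 2 * norm2 D ^+ 2 * W z) + 2 * t * (np z + pn z))%R.
  rewrite /L norm2_sqB norm2_sqZ dotVZr -/(u z) /V /W /pp /nn /np /pn.
  rewrite {1}(posneg (u z)) {1}(posneg (e z)).
  have -> : ((t * e z) ^+ 2 = t ^+ 2 * e z ^+ 2)%R by rewrite exprMn.
  ring.
set a := \int[Q]_z (2 * t * (pp z + nn z))%:E.
have aE : a = \int[Q]_z (2 * t * (np z + pn z))%:E.
  rewrite /a !ge0_integralZ_EFin//.
  - rewrite !ge0_integralD_EFin//; congr (_ * (_ + _)); first exact: e_u_pos.
    exact: esym e_u_neg.
  - exact: measurable_funD.
  - by move=> z; rewrite addr_ge0.
  - exact: measurable_funD.
  - by move=> z; rewrite addr_ge0.
(* Finiteness licenses the cancellation of [a] in the extended reals; the products are bounded by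
   the two second moments assumed finite. *)
have afin : a \is a fin_num.
  rewrite ge0_fin_numE; last first.
    by apply: integral_ge0 => z _; rewrite lee_fin mulr_ge0 ?addr_ge0.
  have h1 : a <= \int[Q]_z (2 * t * (W z + norm2 D ^+ 2 * V z))%:E.
    apply: ge0_le_integral_EFin.
    - by apply: measurable_funM => //; exact: measurable_funD.
    - apply: measurable_funM => //; apply: measurable_funD => //.
      exact: measurable_funM.
    - by move=> z; rewrite mulr_ge0 ?addr_ge0.
    - move=> z; apply: ler_wpM2l => //.
      have hu : (u z ^+ 2 <= norm2 (U z) ^+ 2 * norm2 D ^+ 2)%R by exact: dotV_sq_le.
      have -> : (W z + norm2 D ^+ 2 * V z = i z * (e z ^+ 2 + norm2 (U z) ^+ 2 * norm2 D ^+ 2))%R.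
        by rewrite /W /V; ring.
      have -> : (pp z + nn z = i z * (pos (e z) * pos (u z) + neg (e z) * neg (u z)))%R.
        by rewrite /pp /nn; ring.
      apply: ler_wpM2l => //.
      apply: (@le_trans _ _ (e z ^+ 2 + u z ^+ 2)%R); last by rewrite lerD2l.
      have h x : (pos x ^+ 2 + neg x ^+ 2 = x ^+ 2)%R.
        exact: max0_sqD.
      rewrite -(h (e z)) -(h (u z)).
      have := sqr_ge0 (pos (e z) - pos (u z))%R.
      have := sqr_ge0 (neg (e z) - neg (u z))%R.
      have := sqr_ge0 (pos (e z) + pos (u z))%R.
      have := sqr_ge0 (neg (e z) + neg (u z))%R.
      lra.
  apply: (le_lt_trans h1).
  rewrite ge0_integralZ_EFin//; last 2 first.
  - by apply: measurable_funD => //; exact: measurable_funM.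
  - by move=> z; rewrite addr_ge0// mulr_ge0// sqr_ge0.
  apply: lte_mul_pinfty => //.
  rewrite ge0_integralD_EFin//; last 2 first.
  - exact: measurable_funM.
  - by move=> z; rewrite mulr_ge0// sqr_ge0.
  apply: lte_add_pinfty => //.
  rewrite ge0_integralZ_EFin// ?sqr_ge0//.
  by apply: lte_mul_pinfty => //; rewrite lee_fin sqr_ge0.
have L_a : \int[Q]_z (L z)%:E + a =
    (\int[Q]_z (V z)%:E + (t ^+ 2 * norm2 D ^+ 2)%:E * \int[Q]_z (W z)%:E) + a.
  rewrite {2}aE /a -ge0_integralD_EFin//; last 2 first.
  - by apply: measurable_funM => //; exact: measurable_funD.
  - by move=> z; rewrite mulr_ge0 ?addr_ge0.
  under eq_integral do rewrite key.
  rewrite ge0_integralD_EFin//; last 4 first.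
  - by apply: measurable_funD => //; exact: measurable_funM.
  - by apply: measurable_funM => //; exact: measurable_funD.
  - by move=> z; rewrite addr_ge0// mulr_ge0.
  - by move=> z; rewrite mulr_ge0 ?addr_ge0.
  congr (_ + _).
  rewrite ge0_integralD_EFin//; last 2 first.
  - exact: measurable_funM.
  - by move=> z; rewrite mulr_ge0.
  by rewrite ge0_integralZ_EFin.
by have := congr1 (fun x => x - a) L_a; rewrite !addeK.
Qed.

End centered_noise.

Lemma bsign_inj (R : realType) : injective (@bsign R).
Proof. by move=> [] [] //; rewrite /bsign => H; exfalso; lra. Qed.

Lemma signv_inj (R : realType) (p : nat) : injective (@signv R p).
Proof.
move=> s s' ss'; apply/ffunP => i; apply: (@bsign_inj R).
by have := congr1 (fun v : 'rV[R]_p => v 0 i) ss'; rewrite !mxE.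
Qed.

Lemma measurable_set1_rV (R : realType) (p : nat) (v : 'rV[R]_p) :
  measurable [set v].
Proof.
rewrite (_ : [set v] = rV_box (fun i => [set v 0 i])).
  exact: measurable_rV_box.
by apply/seteqP; split => [u -> //|u uv]; apply/rowP => i; exact: uv.
Qed.

Lemma lee_affine2 (R : realType) (r1 r2 b a1 a2 : R) (I1 I2 : \bar R) :
  0 <= r1 -> 0 <= r2 -> (I1 <= a1%:E -> I2 <= a2%:E ->
  r1%:E * I1 + r2%:E * I2 + b%:E <= (r1 * a1 + r2 * a2 + b)%:E)%E.
Proof.
move=> r10 r20 Ia1 Ia2; rewrite !EFinD !EFinM; apply: leeD => //.
by apply: leeD; apply: lee_wpmul2l; rewrite ?lee_fin.
Qed.

Lemma drift_decomposition (R : pzRingType) (V : lmodType R) (h : R)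
    (x y a b q r : V) :
  x - y - h *: (q + r - b) =
  x - y - h *: (a - b) - h *: (q - a) - h *: r.
Proof.
rewrite -!addrA -!opprD -!scalerDr; congr (_ - (_ + h *: _)).
by rewrite [RHS]addrA [(a - b) + _]addrC subrKA [LHS]addrA [LHS]addrAC.
Qed.

(** * Drift with random directions and measurement noise *)

Section noisy_drift.
Local Open Scope ereal_scope.
Context {R : realType} {p : nat} (f : 'rV[R]_p -> R) (m M K : R).
Hypothesis m0 : (0 < m)%R.
Hypothesis M0 : (0 < M)%R.
Hypothesis f_convex : strong_convexity f m.
Hypothesis f_lip : gradient_lipschitz f M.
Hypothesis df : times_differentiable 3 f.
Hypothesis f_third : third_derivative_bound f K.
Hypothesis mf : measurable_fun setT f.
Hypothesis mgrad : measurable_fun setT (grad f).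
Variables (d : measure_display) (Omega : measurableType d) (P : probability Omega R).
Variables (X Delta : Omega -> 'rV[R]_p) (eps : Omega -> R) (G : set (set Omega)).
Hypotheses (mX : measurable_fun setT X) (mDelta : measurable_fun setT Delta).
Hypothesis meps : measurable_fun setT eps.
Hypothesis mG : forall C, G C -> measurable C.
Hypothesis IG : setI_closed G.
Hypothesis XG : forall E, measurable E -> G (X @^-1` E).
Hypothesis Delta_sign : forall w, exists s, Delta w = signv s.
Local Notation event s := (Delta @^-1` [set signv s]).
Hypothesis DeltaG : forall C s, G C ->
  \int[P]_(w in C) (\1_(event s) w)%:E = \int[P]_(w in C) ((2 ^+ p)^-1)%:E.
Hypothesis epsG : forall C s, G C ->
  \int[P]_(w in C) (\1_(event s) w * Num.max (eps w) 0)%:E =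
  \int[P]_(w in C) (\1_(event s) w * Num.max (- eps w) 0)%:E.
Variable delta : R.
Hypothesis eps2 : \int[P]_w (eps w ^+ 2)%:E <= (2 * delta ^+ 2)%:E.
Variables (pi : probability 'rV[R]_p R) (Q : probability (Omega * 'rV[R]_p)%type R).
Hypothesis Q_fst : forall A, measurable A -> Q (A `*` setT) = P A.
Hypothesis Q_snd : forall B, measurable B -> Q (setT `*` B) = pi B.
Hypothesis Q_adapted : second_adapted P G Q.
Variables (e g2 eta h c : R).
Hypothesis e_bound : \int[Q]_z (norm2 (X z.1 - z.2) ^+ 2)%:E <= e%:E.
Hypothesis g2_bound : \int[pi]_y (norm2 (grad f y) ^+ 2)%:E <= g2%:E.
Hypotheses (eta0 : (0 < eta)%R) (h0 : (0 <= h)%R) (c0 : (0 < c)%R).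
Hypothesis rate0 : (0 <= drift_rate (p := p) m M eta h)%R.
Hypothesis bias0 : (0 <= drift_bias (p := p) M K eta h c)%R.

(** Gap between the next state of the chain and the Langevin proposal from [z.2], with the common
    Gaussian vector already cancelled. *)
Definition noisy_drift (z : Omega * 'rV[R]_p) : 'rV[R]_p :=
  X z.1 - z.2 - h *: (spsa_quotient f c (X z.1) (Delta z.1) *: Delta z.1 +
    (eps z.1 / (2 * c)) *: Delta z.1 - grad f z.2).

Let event_measurable s : measurable (event s).
Proof.
rewrite -[X in measurable X]setTI; apply: mDelta => //.
exact: measurable_set1_rV.
Qed.

Let mXy : measurable_fun setT (fun z : Omega * 'rV[R]_p => (X z.1, z.2)).
Proof.
apply/measurable_fun_pairP; split; last exact: measurable_snd.
exact: (measurableT_comp mX measurable_fst).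
Qed.

Let meps1 : measurable_fun setT (fun z : Omega * 'rV[R]_p => eps z.1).
Proof. exact: (measurableT_comp meps measurable_fst). Qed.

Let mevent s : measurable_fun setT (fun z : Omega * 'rV[R]_p => \1_(event s) z.1 : R).
Proof. by apply: (measurableT_comp _ measurable_fst); exact: measurable_indic. Qed.

Let mdrift s : measurable_fun setT
  (fun z : Omega * 'rV[R]_p => spsa_drift f h c s (X z.1, z.2)).
Proof. exact: (measurableT_comp (measurable_spsa_drift mf mgrad h c s) mXy). Qed.

Lemma integral_spsa_drift_le :
  \sum_s ((2 ^+ p)^-1)%:E * \int[Q]_z (norm2 (spsa_drift f h c s (X z.1, z.2)) ^+ 2)%:E <=
  (drift_rate (p := p) m M eta h * e + h ^+ 2 * (8 * p%:R ^+ 2 + 4) * g2 +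
   drift_bias (p := p) M K eta h c)%:E.
Proof.
have k0 : (0 <= h ^+ 2 * (8 * p%:R ^+ 2 + 4))%R.
  by rewrite mulr_ge0 ?sqr_ge0// addr_ge0// mulr_ge0// sqr_ge0.
have P0 : (0 <= (2 ^+ p)^-1 :> R)%R by rewrite invr_ge0 exprn_ge0.
have mN s : measurable_fun setT (fun z : Omega * 'rV[R]_p =>
    norm2 (spsa_drift f h c s (X z.1, z.2)) ^+ 2)%R by exact: measurable_norm2_sq.
have mXYn : measurable_fun setT (fun z : Omega * 'rV[R]_p => norm2 (X z.1 - z.2) ^+ 2)%R.
  apply: measurable_norm2_sq; apply: measurable_funB_rV => //.
  exact: (measurableT_comp mX measurable_fst).
have mgn : measurable_fun setT (fun y => norm2 (grad f y) ^+ 2)%R by exact: measurable_norm2_sq.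
have mgn2 : measurable_fun setT (fun z : Omega * 'rV[R]_p => norm2 (grad f z.2) ^+ 2)%R.
  exact: (measurableT_comp mgn measurable_snd).
rewrite -ge0_sume_distrr; last first.
  by move=> s _; apply: integral_ge0 => z _; rewrite lee_fin sqr_ge0.
rewrite -ge0_integral_sum_EFin//; last by move=> s z; exact: sqr_ge0.
rewrite -ge0_integralZ_EFin//; last 2 first.
- exact: measurable_sum.
- by move=> z; rewrite sumr_ge0// => s _; exact: sqr_ge0.
apply: (@le_trans _ _ (\int[Q]_z (drift_rate (p := p) m M eta h * norm2 (X z.1 - z.2) ^+ 2 +
   h ^+ 2 * (8 * p%:R ^+ 2 + 4) * norm2 (grad f z.2) ^+ 2 +
   drift_bias (p := p) M K eta h c)%:E)).
  apply: ge0_le_integral_EFin.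
  - by apply: measurable_funM => //; exact: measurable_sum.
  - apply: measurable_funD => //; apply: measurable_funD; exact: measurable_funM.
  - by move=> z; rewrite mulr_ge0// sumr_ge0// => s _; exact: sqr_ge0.
  - move=> z; rewrite mulrC ler_pdivrMr ?exprn_gt0// mulrC.
    exact: (spsa_drift_le m0 M0 f_convex f_lip df f_third (X z.1, z.2) eta0 h0 c0).
rewrite ge0_integralD_EFin//; last 2 first.
- by apply: measurable_funD; exact: measurable_funM.
- by move=> z; rewrite addr_ge0// mulr_ge0 ?sqr_ge0.
rewrite ge0_integralD_EFin//; last 4 first.
- exact: measurable_funM.
- exact: measurable_funM.
- by move=> z; rewrite mulr_ge0 ?sqr_ge0.
- by move=> z; rewrite mulr_ge0 ?sqr_ge0.
rewrite !ge0_integralZ_EFin//; last 2 first.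
- by move=> z; exact: sqr_ge0.
- by move=> z; exact: sqr_ge0.
rewrite integral_cst//= [Q _]probability_setT mule1.
rewrite (second_marginal_integral Q_snd (phi := fun y => (norm2 (grad f y) ^+ 2)%:E)); last 2 first.
- exact/measurable_EFinP.
- by move=> y; rewrite lee_fin sqr_ge0.
exact: lee_affine2.
Qed.

Let event_sum1 (w : Omega) (F : {ffun 'I_p -> bool} -> R) s :
  Delta w = signv s -> (\sum_s' \1_(event s') w * F s' = F s)%R.
Proof.
move=> Ds; rewrite (bigD1 s)//= indicE mem_set// mul1r big1 ?addr0// => s' s's.
rewrite indicE memNset ?mul0r//= Ds => /signv_inj ss'.
by rewrite ss' eqxx in s's.
Qed.

Let event_ge0 s w : (0 <= (\1_(event s) w : R))%R. Proof. by []. Qed.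

Let mevent1 s : measurable_fun setT (\1_(event s) : Omega -> R).
Proof. exact: measurable_indic. Qed.

Let pos (x : R) := Num.max x 0%R.
Let pos0 x : (0 <= pos x)%R. Proof. by rewrite /pos le_max lexx orbT. Qed.

Let eps2_fin : \int[P]_w (eps w ^+ 2)%:E < +oo.
Proof. by apply: le_lt_trans eps2 _; rewrite ltry. Qed.

Let mpos (g : Omega -> R) : measurable_fun setT g ->
  measurable_fun setT (fun w => pos (g w)).
Proof. by move=> mg; apply: measurable_maxr. Qed.

Let event_pos_fin s (g : Omega -> R) : measurable_fun setT g ->
  (forall w, g w ^+ 2 = eps w ^+ 2)%R ->
  \int[P]_w (\1_(event s) w * pos (g w))%:E < +oo.
Proof.
move=> mg gE; apply: (@le_lt_trans _ _ (\int[P]_w (1 + eps w ^+ 2)%:E)).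
  apply: ge0_le_integral_EFin.
  - by apply: measurable_funM => //; exact: mpos.
  - by apply: measurable_funD => //; exact: measurable_funX.
  - by move=> w; rewrite mulr_ge0.
  - move=> w; apply: (@le_trans _ _ (pos (g w))).
      by rewrite ler_piMl.
    (* The square of g - 1/2 gives max(g, 0) <= 1 + g^2. *)
    rewrite -gE /pos; have := sqr_ge0 (g w - 2^-1)%R.
    by case: (leP (g w) 0%R) => hg; have := sqr_ge0 (g w); lra.
rewrite ge0_integralD_EFin//; last 2 first.
- exact: measurable_funX.
- by move=> w; exact: sqr_ge0.
rewrite integral_cst//= probability_setT mule1.
by apply: lte_add_pinfty => //; rewrite ltry.
Qed.

(** Given the history the direction is uniform, and adaptedness of [Q] makes this hold jointly with
    [z.2]: the indicator may be replaced by its probability. *)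
Lemma integral_event s (phi : 'rV[R]_p * 'rV[R]_p -> R) : measurable_fun setT phi ->
  (forall u, 0 <= phi u)%R ->
  \int[Q]_z (\1_(event s) z.1 * phi (X z.1, z.2))%:E =
  ((2 ^+ p)^-1)%:E * \int[Q]_z (phi (X z.1, z.2))%:E.
Proof.
move=> mphi phi0.
have P0 : (0 <= (2 ^+ p)^-1 :> R)%R by rewrite invr_ge0 exprn_ge0.
have mphi' : measurable_fun setT (EFin \o phi) by exact/measurable_EFinP.
have fin1 : \int[P]_w (\1_(event s) w)%:E < +oo.
  by rewrite integral_indic// (le_lt_trans (probability_le1 _ _)) ?ltry//; exact: measurableI.
have fin2 : \int[P]_w ((fun=> (2 ^+ p)^-1 : R) w)%:E < +oo.
  by rewrite integral_cst//= probability_setT mule1 ltry.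
have H := @second_adapted_integral _ _ _ _ _ P _ _ X G G Q (\1_(event s))
  (fun=> (2 ^+ p)^-1)%R (EFin \o phi) Q_fst Q_adapted (fun _ => id) IG mG mX XG
  (mevent1 s) (measurable_cst _) (event_ge0 s) (fun=> P0) fin1 fin2
  (fun C => @DeltaG C s) mphi' (fun u => phi0 u).
under eq_integral do rewrite EFinM.
rewrite [LHS]H -ge0_integralZ_EFin//.
exact: (measurableT_comp mphi mXy).
Qed.

(** On each event of the history and of the direction the two parts of the noise have equal
    integrals; adaptedness extends this to weights that involve [z.2]. *)
Lemma integral_event_noise s (phi : 'rV[R]_p * 'rV[R]_p -> R) :
  measurable_fun setT phi -> (forall u, 0 <= phi u)%R ->
  \int[Q]_z (\1_(event s) z.1 * Num.max (eps z.1) 0%R * phi (X z.1, z.2))%:E =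
  \int[Q]_z (\1_(event s) z.1 * Num.max (- eps z.1)%R 0%R * phi (X z.1, z.2))%:E.
Proof.
move=> mphi phi0.
have mphi' : measurable_fun setT (EFin \o phi) by exact/measurable_EFinP.
have mN : measurable_fun setT (fun w => - eps w)%R by exact: measurableT_comp.
have m1 : measurable_fun setT (fun w => \1_(event s) w * pos (eps w))%R.
  by apply: measurable_funM => //; exact: mpos.
have m2 : measurable_fun setT (fun w => \1_(event s) w * pos (- eps w))%R.
  by apply: measurable_funM => //; exact: mpos.
have H := @second_adapted_integral _ _ _ _ _ P _ _ X G G Q
  (fun w => \1_(event s) w * pos (eps w))%R
  (fun w => \1_(event s) w * pos (- eps w))%R (EFin \o phi)
  Q_fst Q_adapted (fun _ => id) IG mG mX XG m1 m2
  (fun w => mulr_ge0 (event_ge0 s w) (pos0 _)) (fun w => mulr_ge0 (event_ge0 s w) (pos0 _))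
  (event_pos_fin s meps (fun=> erefl)) (event_pos_fin s mN (fun w => sqrrN (eps w)))
  (fun C => @epsG C s) mphi' (fun u => phi0 u).
under eq_integral do rewrite EFinM.
by rewrite [LHS]H; apply: eq_integral => z _; rewrite [RHS]EFinM.
Qed.

(** On the event of a fixed direction the noise is orthogonal to the drift. Summed over the events,
    it contributes (h / (2 c))^2 p times its second moment, while the drift parts average to the
    noiseless bound. *)
Lemma noisy_drift_le :
  \int[Q]_z (norm2 (noisy_drift z) ^+ 2)%:E <=
  (drift_rate (p := p) m M eta h * e + h ^+ 2 * (8 * p%:R ^+ 2 + 4) * g2 +
   drift_bias (p := p) M K eta h c + h ^+ 2 * (p%:R * delta ^+ 2 / (2 * c ^+ 2)))%:E.
Proof.
pose t := (h / (2 * c))%R.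
have t0 : (0 <= t)%R by rewrite divr_ge0// mulr_ge0// ltW.
pose U s (z : Omega * 'rV[R]_p) := spsa_drift f h c s (X z.1, z.2).
have mN s : measurable_fun setT (fun u => norm2 (spsa_drift f h c s u) ^+ 2)%R.
  by apply: measurable_norm2_sq; exact: measurable_spsa_drift.
have mN' s : measurable_fun setT (fun z => norm2 (U s z) ^+ 2)%R.
  exact: (measurableT_comp (mN s) mXy).
have meps2 : measurable_fun setT (fun z : Omega * 'rV[R]_p => eps z.1 ^+ 2)%R.
  exact: measurable_funX.
have EU s : \int[Q]_z (\1_(event s) z.1 * norm2 (U s z) ^+ 2)%:E =
    ((2 ^+ p)^-1)%:E * \int[Q]_z (norm2 (U s z) ^+ 2)%:E.
  exact: (integral_event s (mN s) (fun u => sqr_ge0 _)).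
have Ufin s : \int[Q]_z (\1_(event s) z.1 * norm2 (U s z) ^+ 2)%:E < +oo.
  rewrite EU; apply: le_lt_trans (ltry _); apply: le_trans integral_spsa_drift_le.
  rewrite (bigD1 s)//=; apply: leeDl; apply: sume_ge0 => s' _.
  rewrite mule_ge0 ?lee_fin ?invr_ge0 ?exprn_ge0//.
  by apply: integral_ge0 => z _; rewrite lee_fin sqr_ge0.
have eps2Q : \int[Q]_z (eps z.1 ^+ 2)%:E = \int[P]_w (eps w ^+ 2)%:E.
  rewrite (first_marginal_integral Q_fst (phi := fun w => (eps w ^+ 2)%:E))//.
  - by apply/measurable_EFinP; exact: measurable_funX.
  - by move=> w; rewrite lee_fin sqr_ge0.
have mW s : measurable_fun setT (fun z : Omega * 'rV[R]_p => \1_(event s) z.1 * eps z.1 ^+ 2)%R.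
  exact: measurable_funM.
have W0 s (z : Omega * 'rV[R]_p) : (0 <= \1_(event s) z.1 * eps z.1 ^+ 2)%R.
  by rewrite mulr_ge0 ?sqr_ge0.
have Wfin s : \int[Q]_z (\1_(event s) z.1 * eps z.1 ^+ 2)%:E < +oo.
  apply: le_lt_trans eps2_fin; rewrite -eps2Q; apply: ge0_le_integral_EFin => //.
  by move=> z; rewrite ler_piMl ?sqr_ge0.
have mL s : measurable_fun setT (fun z : Omega * 'rV[R]_p =>
    \1_(event s) z.1 * norm2 (U s z - (t * eps z.1) *: signv s) ^+ 2)%R.
  apply: measurable_funM => //; apply: measurable_norm2_sq.
  apply: measurable_funB_rV; first exact: mdrift.
  by apply: measurable_funZ_rV => //; exact: measurable_funM.
have centered s : \int[Q]_z (\1_(event s) z.1 *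
      norm2 (U s z - (t * eps z.1) *: signv s) ^+ 2)%:E =
    ((2 ^+ p)^-1)%:E * \int[Q]_z (norm2 (U s z) ^+ 2)%:E +
    (t ^+ 2 * p%:R)%:E * \int[Q]_z (\1_(event s) z.1 * eps z.1 ^+ 2)%:E.
  rewrite -EU -(norm2_signv s); apply: integral_centered_noise => //.
  - exact: mdrift.
  - apply: (integral_event_noise s (phi := fun u => Num.max (dotV (spsa_drift f h c s u) (signv s)) 0%R)).
      by apply: measurable_maxr => //; apply: measurable_dotV => //; exact: measurable_spsa_drift.
    by move=> u; rewrite le_max lexx orbT.
  - apply: (integral_event_noise s (phi := fun u => Num.max (- dotV (spsa_drift f h c s u) (signv s))%R 0%R)).
      apply: measurable_maxr => //; apply: measurableT_comp => //.
      by apply: measurable_dotV => //; exact: measurable_spsa_drift.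
    by move=> u; rewrite le_max lexx orbT.
(* Exactly one event occurs, so the square can be spread over a sum in which each direction is
   deterministic. *)
have -> : \int[Q]_z (norm2 (noisy_drift z) ^+ 2)%:E =
    \int[Q]_z (\sum_s \1_(event s) z.1 * norm2 (U s z - (t * eps z.1) *: signv s) ^+ 2)%:E.
  apply: eq_integral => z _; congr EFin.
  have [s Ds] := Delta_sign z.1.
  rewrite (event_sum1 _ Ds) /noisy_drift Ds /U /spsa_drift /spsa_error /=.
  congr (norm2 _ ^+ 2)%R.
  have -> : (t * eps z.1 = h * (eps z.1 / (2 * c)))%R by rewrite /t; ring.
  by rewrite -(scalerA h); exact: drift_decomposition.
rewrite ge0_integral_sum_EFin//; last by move=> s z; rewrite mulr_ge0 ?sqr_ge0.
under eq_bigr do rewrite centered.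
rewrite big_split/=.
have <- : (t ^+ 2 * p%:R)%:E * \sum_s \int[Q]_z (\1_(event s) z.1 * eps z.1 ^+ 2)%:E =
    \sum_s (t ^+ 2 * p%:R)%:E * \int[Q]_z (\1_(event s) z.1 * eps z.1 ^+ 2)%:E.
  rewrite ge0_sume_distrr// => s _; apply: integral_ge0 => z _.
  by rewrite lee_fin W0.
rewrite [in leRHS]EFinD; apply: leeD; first exact: integral_spsa_drift_le.
rewrite -ge0_integral_sum_EFin//.
have -> : \int[Q]_z (\sum_s \1_(event s) z.1 * eps z.1 ^+ 2)%:E = \int[P]_w (eps w ^+ 2)%:E.
  rewrite -eps2Q; apply: eq_integral => z _; congr EFin.
  by have [s Ds] := Delta_sign z.1; exact: (event_sum1 (fun=> (eps z.1 ^+ 2)%R) Ds).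
have t2 : (0 <= t ^+ 2 * p%:R)%R by rewrite mulr_ge0 ?sqr_ge0.
apply: (@le_trans _ _ ((t ^+ 2 * p%:R)%:E * (2 * delta ^+ 2)%:E)).
  by apply: lee_wpmul2l => //; rewrite lee_fin.
rewrite -EFinM lee_fin /t le_eqVlt; apply/orP; left; apply/eqP.
by field; rewrite gt_eqF.
Qed.

End noisy_drift.

(** * One step of the coupled chains *)

Lemma measurable_mixture d (T : measurableType d) (R : realType) (a b c : T -> R) :
  measurable_fun setT a -> measurable_fun setT b -> measurable_fun setT c ->
  measurable_fun setT (fun t => a t * b t + (1 - a t) * c t).
Proof.
move=> ma mb mc; apply: measurable_funD; apply: measurable_funM => //.
exact: measurable_funB.
Qed.

Opaque mala_joint mala_accept mala_proposal mala_log_ratio.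

Section mala_coupling.
Local Open Scope ereal_scope.
Context {R : realType} {p : nat} (f : 'rV[R]_p -> R) (h : R).
Hypothesis h0 : (0 < h)%R.
Hypothesis mf : measurable_fun setT f.
Hypothesis mgrad : measurable_fun setT (grad f).
Variables (d : measure_display) (Omega : measurableType d) (P : probability Omega R).
Variables (xi : Omega -> 'rV[R]_p) (G G' : set (set Omega)).
Hypothesis mxi : measurable_fun setT xi.
Hypothesis xi_gauss : forall A : 'I_p -> set R, (forall i, measurable (A i)) ->
  P (xi @^-1` rV_box A) = \prod_(i < p) normal_prob 0 1 (A i).
Hypothesis mG : forall C, G C -> measurable C.
Hypothesis xiG : forall C E, G C -> measurable E ->
  P (C `&` xi @^-1` E) = P C * P (xi @^-1` E).
Hypothesis GG' : G `<=` G'.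
Hypothesis IG' : setI_closed G'.
Hypothesis xiG' : forall E, measurable E -> G' (xi @^-1` E).
Variables (pi : probability 'rV[R]_p R) (Q : probability (Omega * 'rV[R]_p)%type R).
Hypothesis pi_gibbs : gibbs_measure f pi.
Hypothesis Q_fst : forall A, measurable A -> Q (A `*` setT) = P A.
Hypothesis Q_snd : forall B, measurable B -> Q (setT `*` B) = pi B.
Hypothesis Q_adapted : second_adapted P G Q.

Let gam : probability 'rV[R]_p R := distribution P (mfun_of mxi).

Let mpair : measurable_fun setT (fun z : Omega * 'rV[R]_p => (z.2, xi z.1)).
Proof.
apply/measurable_fun_pairP; split; first exact: measurable_snd.
exact: (measurableT_comp mxi measurable_fst).
Qed.

Let xi_measurable E : measurable E -> measurable (xi @^-1` E).
Proof. by move=> mE; rewrite -[X in measurable X]setTI; exact: mxi. Qed.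

(** Under [Q] the state is independent of the fresh Gaussian vector: the indicator of an event of
    [xi] and its probability have equal integrals over the sets of [G], so adaptedness exchanges
    them against events of the state. *)
Lemma integral_state_gauss (phi : 'rV[R]_p * 'rV[R]_p -> \bar R) :
  measurable_fun setT phi -> (forall u, 0 <= phi u) ->
  \int[Q]_z phi (z.2, xi z.1) = \int[pi]_y \int[gam]_v phi (y, v).
Proof.
move=> mphi phi0.
transitivity (\int[pushforward_measure Q mpair]_u phi u).
  by rewrite ge0_integral_pushforward//=; exact: mpair.
rewrite -[RHS]fubini_tonelli1//; apply: eq_measure_integral => A mA _.
apply/esym; apply: product_measure_unique => //= B E mB mE.
rewrite -[LHS]/(Q [set z | (B `*` E) (z.2, xi z.1)]).
pose k : R := fine (P (xi @^-1` E)).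
have kE : k%:E = P (xi @^-1` E) by rewrite fineK// fin_num_measure//; exact: xi_measurable.
have k0 : (0 <= k)%R by rewrite -lee_fin kE.
have mE' := xi_measurable mE.
have fin1 : \int[P]_w ((\1_(xi @^-1` E) : Omega -> R) w)%:E < +oo.
  by rewrite integral_indic// (le_lt_trans (probability_le1 _ _)) ?ltry//; exact: measurableI.
have fin2 : \int[P]_w ((fun=> k) w)%:E < +oo.
  by rewrite integral_cst//= probability_setT mule1 ltry.
have m1 : measurable_fun setT (\1_(xi @^-1` E) : Omega -> R) by exact: measurable_indic.
have H C : G C -> \int[P]_(w in C) ((\1_(xi @^-1` E) : Omega -> R) w)%:E =
    \int[P]_(w in C) ((fun=> k) w)%:E.
  move=> GC; have mC := mG GC.
  rewrite integral_indic// integral_cst//= setIC xiG//.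
  by rewrite -kE muleC.
have := Q_adapted m1 (measurable_cst k) (fun w => ler0n R (w \in _)) (fun=> k0) fin1 fin2 H mB.
have mF : measurable [set z : Omega * 'rV[R]_p | (B `*` E) (z.2, xi z.1)].
  by rewrite -[X in measurable X]setTI; apply: mpair => //; exact: measurableX.
have -> : Q [set z | (B `*` E) (z.2, xi z.1)] =
    \int[Q]_z ((\1_(xi @^-1` E) z.1 : R) * \1_B z.2)%:E.
  rewrite -[X in Q X]setIT -(integral_indic _ measurableT mF).
  apply: eq_integral => z _; congr EFin; rewrite !indicE.
  have -> : (z \in [set z : Omega * 'rV[R]_p | (B `*` E) (z.2, xi z.1)]) =
      (z.1 \in xi @^-1` E) && (z.2 \in B).
    by apply/idP/andP => [/[!inE] -[]//|[]]; rewrite !inE.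
  by case: (z.1 \in _); case: (z.2 \in _); rewrite ?mulr1 ?mulr0.
move=> ->.
have mB1 : measurable_fun setT (fun z : Omega * 'rV[R]_p => \1_B z.2 : R).
  by apply: (measurableT_comp _ measurable_snd); exact: measurable_indic.
rewrite ge0_integralZ_EFin//.
rewrite (second_marginal_integral Q_snd (phi := fun y => (\1_B y)%:E))//; last first.
  by apply/measurable_EFinP; exact: measurable_indic.
by rewrite integral_indic// setIT muleC kE.
Qed.

Let gamE (A : 'I_p -> set R) : (forall i, measurable (A i)) ->
  gam (rV_box A) = \prod_(i < p) normal_prob 0 1 (A i).
Proof. exact: xi_gauss. Qed.

Let a (z : Omega * 'rV[R]_p) : R :=
  mala_accept f h z.2 (mala_proposal f h z.2 (xi z.1)).

Let prop (z : Omega * 'rV[R]_p) := mala_proposal f h z.2 (xi z.1).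

Let maccept : measurable_fun setT (fun u : 'rV[R]_p * 'rV[R]_p =>
  mala_accept f h u.1 (mala_proposal f h u.1 u.2)).
Proof.
have mz : measurable_fun setT
    (fun u : 'rV[R]_p * 'rV[R]_p => (u.1, mala_proposal f h u.1 u.2)).
  apply/measurable_fun_pairP; split; first exact: measurable_fst.
  exact: measurable_mala_proposal.
exact: (measurableT_comp (measurable_mala_accept h mf mgrad) mz).
Qed.

Let mprop : measurable_fun setT prop.
Proof. exact: (measurableT_comp (measurable_mala_proposal h mgrad) mpair). Qed.

Let ma : measurable_fun setT a.
Proof. exact: (measurableT_comp maccept mpair). Qed.

Let a0 z : (0 <= a z)%R. Proof. exact: mala_accept_ge0. Qed.

Let a1 z : (a z <= 1)%R. Proof. exact: mala_accept_le1. Qed.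

Let S (z : Omega * 'rV[R]_p) := (z.1, prop z).

Let mS : measurable_fun setT S.
Proof. by apply/measurable_fun_pairP; split => //; exact: measurable_fst. Qed.

(* [Q'] moves the second component to the Metropolis-adjusted Langevin proposal
   driven by the same Gaussian vector, or leaves it unchanged on rejection, so
   that its law remains exactly [pi]. *)
Lemma mala_coupling : exists Q' : probability (Omega * 'rV[R]_p)%type R,
  [/\ (forall A, measurable A -> Q' (A `*` setT) = P A),
      (forall B, measurable B -> Q' (setT `*` B) = pi B),
      second_adapted P G' Q' &
      forall phi : Omega * 'rV[R]_p -> R, measurable_fun setT phi ->
        (forall z, 0 <= phi z)%R ->
        \int[Q']_z (phi z)%:E =
        \int[Q]_z (a z * phi (z.1, prop z) + (1 - a z) * phi z)%:E].
Proof.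
have [Q' Q'E] := metropolis_mixture Q mS ma a0 a1.
have intQ' (phi : Omega * 'rV[R]_p -> R) : measurable_fun setT phi ->
    (forall z, 0 <= phi z)%R -> \int[Q']_z (phi z)%:E =
      \int[Q]_z (a z * phi (z.1, prop z) + (1 - a z) * phi z)%:E.
  move=> mphi phi0; rewrite (Q'E (fun z => (phi z)%:E))//.
  exact/measurable_EFinP.
have indQ' A : measurable A -> Q' A = \int[Q']_z (\1_A z)%:E.
  by move=> mA; rewrite integral_indic// setIT.
exists Q'; split=> //.
- move=> A mA; have mAT : measurable (A `*` [set: 'rV[R]_p]) by exact: measurableX.
  rewrite indQ'// intQ'//.
  rewrite -Q_fst// -[X in _ = Q X]setIT -(integral_indic _ measurableT mAT).
  apply: eq_integral => z _; congr EFin; rewrite !indicE.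
  have -> : ((z.1, prop z) \in A `*` setT) = (z \in A `*` setT).
    by apply/idP/idP => /[!inE] -[].
  by rewrite -mulrDl addrC subrK mul1r.
(* State and Gaussian vector being independent, the second marginal is given by the invariance of pi
   under the adjusted chain. *)
- move=> B mB; have mTB : measurable ([set: Omega] `*` B) by exact: measurableX.
  rewrite indQ'// intQ'//.
  rewrite -(mala_invariant h0 mf mgrad pi_gibbs gamE mB).
  pose phi (u : 'rV[R]_p * 'rV[R]_p) : R :=
    (mala_accept f h u.1 (mala_proposal f h u.1 u.2) * \1_B (mala_proposal f h u.1 u.2) +
     (1 - mala_accept f h u.1 (mala_proposal f h u.1 u.2)) * \1_B u.1)%R.
  have m1 : measurable_fun setT (\1_B : 'rV[R]_p -> R) by exact: measurable_indic.
  have mphi : measurable_fun setT phi.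
    exact: (measurable_mixture maccept
      (measurableT_comp m1 (measurable_mala_proposal h mgrad))
      (measurableT_comp m1 measurable_fst)).
  have phi0 u : (0 <= phi u)%R.
    by rewrite addr_ge0// mulr_ge0// ?mala_accept_ge0// subr_ge0 mala_accept_le1.
  have mphi' : measurable_fun setT (fun u => (phi u)%:E) by exact/measurable_EFinP.
  rewrite -(integral_state_gauss (phi := fun u => (phi u)%:E) mphi' (fun u => phi0 u)).
  apply: eq_integral => z _; congr EFin; rewrite /phi !indicE/=.
  have E (w : Omega) (y : 'rV[R]_p) : ((w, y) \in setT `*` B) = (y \in B).
    by apply/idP/idP => [/[!inE] -[]//|/[!inE]].
  by rewrite E; case: z => w y; rewrite E.
(* The new state is drawn from a kernel in the old state and [xi], and the events of [xi] belong to
   [G']. *)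
- move=> psi1 psi2 m1 m2 p10 p20 i1 i2 E12 B mB.
  have mB1 : measurable_fun setT (\1_B : 'rV[R]_p -> R) by exact: measurable_indic.
  pose phi (u : 'rV[R]_p * 'rV[R]_p) : R :=
    (mala_accept f h u.2 (mala_proposal f h u.2 u.1) * \1_B (mala_proposal f h u.2 u.1) +
     (1 - mala_accept f h u.2 (mala_proposal f h u.2 u.1)) * \1_B u.2)%R.
  have mswap : measurable_fun setT (fun u : 'rV[R]_p * 'rV[R]_p => (u.2, u.1)).
    by apply/measurable_fun_pairP; split; [exact: measurable_snd|exact: measurable_fst].
  have mac := measurableT_comp maccept mswap.
  have mpr := measurableT_comp (measurable_mala_proposal h mgrad) mswap.
  have mphi : measurable_fun setT phi.
    exact: (measurable_mixture mac (measurableT_comp mB1 mpr)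
      (measurableT_comp mB1 measurable_snd)).
  have phi0 u : (0 <= phi u)%R.
    by rewrite addr_ge0// mulr_ge0// ?mala_accept_ge0// subr_ge0 mala_accept_le1.
  have mphi' : measurable_fun setT (fun u => (phi u)%:E) by exact/measurable_EFinP.
  have H := second_adapted_integral (v := xi) Q_fst Q_adapted GG' IG' mG mxi xiG'
    m1 m2 p10 p20 i1 i2 E12 mphi' (fun u => phi0 u).
  have E (psi : Omega -> R) : measurable_fun setT psi -> (forall w, 0 <= psi w)%R ->
      \int[Q']_z (psi z.1 * \1_B z.2)%:E =
      \int[Q]_z ((psi z.1)%:E * (phi (xi z.1, z.2))%:E).
    move=> mpsi psi0; rewrite (intQ' (fun z => psi z.1 * \1_B z.2)%R); last 2 first.
    - apply: measurable_funM; first exact: (measurableT_comp mpsi measurable_fst).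
      exact: (measurableT_comp mB1 measurable_snd).
    - by move=> z; rewrite mulr_ge0.
    apply: eq_integral => z _; rewrite -EFinM /phi /a /prop/=; congr EFin.
    by rewrite [in RHS]mulrDr; congr (_ + _)%R; rewrite mulrCA.
  by rewrite !E.
Qed.

End mala_coupling.

(** 4 (a^3 + b^3) - (a + b)^3 = 3 (a + b) (a - b)^2. *)
Lemma exprD3_le (R : realDomainType) (a b : R) : 0 <= a -> 0 <= b ->
  (a + b) ^+ 3 <= 4 * (a ^+ 3 + b ^+ 3).
Proof.
move=> a0 b0; have : 0 <= (a + b) * (a - b) ^+ 2 by rewrite mulr_ge0 ?sqr_ge0 ?addr_ge0.
lra.
Qed.

Lemma sqr_le_1DX3 (R : realDomainType) (s : R) : 0 <= s -> s ^+ 2 <= 1 + s ^+ 3.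
Proof.
move=> s0; have [s1|/ltW s1] := leP s 1.
  by rewrite (le_trans (exprn_ile1 _ s0 s1))// lerDl exprn_ge0.
by rewrite (le_trans (ler_weXn2l s1 (_ : 2 <= 3)%N))// lerDr.
Qed.

Lemma le_1DX3 (R : realDomainType) (s : R) : 0 <= s -> s <= 1 + s ^+ 3.
Proof.
move=> s0; have [s1|/ltW s1] := leP s 1; first by rewrite (le_trans s1)// lerDl exprn_ge0.
by rewrite (le_trans (ler_eXnr (isT : (0 < 3)%N) s1))// lerDr.
Qed.

Lemma measurable_norm2_6 d (T : measurableType d) (R : realType) (p : nat)
    (F : T -> 'rV[R]_p) : measurable_fun setT F ->
  measurable_fun setT (fun t => norm2 (F t) ^+ 6).
Proof.
move=> mF; under eq_fun => v do rewrite (_ : 6 = 2 * 3)%N// exprM.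
by apply: measurable_funX; exact: measurable_norm2_sq.
Qed.

(** * Cost of rejected proposals *)

Section mala_error.
Context {R : realType} {p : nat} (f : 'rV[R]_p -> R) (m M a : R).
Hypothesis m0 : 0 < m.
Hypothesis M0 : 0 < M.
Hypothesis f_convex : strong_convexity f m.
Hypothesis f_lip : gradient_lipschitz f M.
Variables (eta h : R).
Hypotheses (eta0 : 0 < eta) (h0 : 0 < h) (ha : h <= a).
Implicit Types y v A : 'rV[R]_p.

(** The constants of this section do not involve [h]: surplus powers of [h] are estimated by h <=
    a. *)
Definition mala_move_const : R := 2 * a + 4.

Definition mala_reject_const : R :=
  M * mala_move_const + M / 4 + a / 4 * (M + M ^+ 2) * mala_move_const.

Definition mala_error_const : R :=
  4 * (mala_move_const * mala_reject_const +
       mala_reject_const ^+ 2 * mala_move_const / eta).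

Let a0 : 0 < a. Proof. exact: lt_le_trans ha. Qed.

Let k1 : 0 <= mala_move_const.
Proof. by rewrite /mala_move_const addr_ge0// mulr_ge0// ltW. Qed.

Let k2 : 0 <= mala_reject_const.
Proof.
rewrite /mala_reject_const !addr_ge0// ?mulr_ge0// ?(ltW M0) ?(ltW a0)//.
by rewrite addr_ge0 ?sqr_ge0// ltW.
Qed.

Lemma mala_error_const_ge0 : 0 <= mala_error_const.
Proof.
have h2 : 0 <= mala_reject_const ^+ 2 * mala_move_const / eta.
  by rewrite mulr_ge0 ?invr_ge0 ?(ltW eta0)// mulr_ge0// sqr_ge0.
by rewrite /mala_error_const mulr_ge0// addr_ge0// mulr_ge0.
Qed.

Lemma mala_move_le y v :
  norm2 (mala_proposal f h y v - y) ^+ 2 <=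
  mala_move_const * h * (norm2 (grad f y) ^+ 2 + norm2 v ^+ 2).
Proof.
have -> : mala_proposal f h y v - y = - (h *: grad f y) + Num.sqrt (2 * h) *: v.
  by rewrite mala_proposalE addrAC [y - _]addrC addrK.
apply: (le_trans (norm2_sqD_le _ _)).
have sq : Num.sqrt (2 * h) ^+ 2 = 2 * h by rewrite sqr_sqrtr// mulr_ge0// ltW.
rewrite norm2N !norm2_sqZ sq /mala_move_const.
move: (norm2 _ ^+ 2) (norm2 v ^+ 2) (sqr_ge0 (norm2 (grad f y))) (sqr_ge0 (norm2 v)).
move=> g n g0 n0.
have h1 : h ^+ 2 * g <= a * h * g by rewrite ler_wpM2r// expr2 ler_wpM2r// ltW.
have h2 : 0 <= a * h * n by rewrite !mulr_ge0// ltW.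
have h3 : 0 <= h * g by rewrite mulr_ge0// ltW.
lra.
Qed.

Lemma mala_reject_prob_le y v :
  1 - mala_accept f h y (mala_proposal f h y v) <=
  mala_reject_const * h * (norm2 (grad f y) ^+ 2 + norm2 v ^+ 2).
Proof.
apply: (le_trans (mala_reject_le _ _ _ _)).
apply: (le_trans (mala_log_ratio_le m0 M0 f_convex f_lip _ _ (ltW h0))).
have := mala_move_le y v.
have z0 := norm2_ge0 (mala_proposal f h y v - y).
have g0 := norm2_ge0 (grad f y).
have n0 := sqr_ge0 (norm2 v).
move: (norm2 (mala_proposal f h y v - y)) (norm2 (grad f y)) (norm2 v ^+ 2) z0 g0 n0.
move=> z g n z0 g0 n0 hz.
have hzg : 2 * (z * g) <= z ^+ 2 + g ^+ 2 by have := sqr_ge0 (z - g); lra.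
have h4 : h / 4 * (M * z * (2 * g + M * z)) <= h / 4 * (M * g ^+ 2 + (M + M ^+ 2) * z ^+ 2).
  apply: ler_wpM2l; first by rewrite divr_ge0// ltW.
  have := ler_wpM2l (ltW M0) hzg; lra.
have h5 : h / 4 * ((M + M ^+ 2) * z ^+ 2) <= a / 4 * (M + M ^+ 2) * z ^+ 2.
  rewrite mulrA ler_wpM2r ?sqr_ge0// ler_wpM2r//.
    by rewrite addr_ge0 ?sqr_ge0// ltW.
  by rewrite ler_pM2r// invr_gt0.
have c0 : 0 <= M + a / 4 * (M + M ^+ 2).
  by rewrite !(addr_ge0, mulr_ge0, sqr_ge0)// ltW// ?M0 ?a0// invr_ge0.
have h6 := ler_wpM2l c0 hz.
have h7 : 0 <= M / 4 * h * n by rewrite !mulr_ge0// ltW// invr_gt0.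
rewrite /mala_reject_const; move: h4 h5 h6 h7.
move: (mala_move_const) => k; lra.
Qed.

(** [A] is the gap if the proposal is accepted; a rejection adds the proposed displacement z. The
    rejection probability r and |z|^2 are both of order h s with s = |grad f y|^2 + |v|^2. So r
    |z|^2 is of order h^2 s^2, and Young's inequality with weight eta h turns the cross term 2 r <A,
    z> into r^2 |z|^2 / (eta h), of order h^2 s^3: hence the sixth powers. *)
Lemma mala_mixture_le y v A :
  mala_accept f h y (mala_proposal f h y v) * norm2 A ^+ 2 +
  (1 - mala_accept f h y (mala_proposal f h y v)) *
    norm2 (A + (mala_proposal f h y v - y)) ^+ 2 <=
  (1 + eta * h) * norm2 A ^+ 2 +
  h ^+ 2 * mala_error_const * (1 + norm2 (grad f y) ^+ 6 + norm2 v ^+ 6).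
Proof.
have r0 : 0 <= 1 - mala_accept f h y (mala_proposal f h y v).
  by rewrite subr_ge0 mala_accept_le1.
have hr := mala_reject_prob_le y v.
have hz := mala_move_le y v.
rewrite norm2_sqD.
have eh : 0 < eta * h by rewrite mulr_gt0.
have young := dotV_young A ((1 - mala_accept f h y (mala_proposal f h y v)) *: (mala_proposal f h y v - y)) eh.
rewrite dotVZr norm2_sqZ in young.
set s := norm2 (grad f y) ^+ 2 + norm2 v ^+ 2 in hr hz.
have s0 : 0 <= s by rewrite addr_ge0 ?sqr_ge0.
have s3 : s ^+ 3 <= 4 * (norm2 (grad f y) ^+ 6 + norm2 v ^+ 6).
  apply: (le_trans (exprD3_le (sqr_ge0 _) (sqr_ge0 _))).
  by rewrite -!exprM.
move: (mala_proposal f h y v - y) (mala_accept _ _ _ _) r0 hr hz young => z al r0 hr hz young.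
have -> : al = 1 - (1 - al) by lra.
move: (1 - al) r0 hr young => r r0 hr young.
have z0 := sqr_ge0 (norm2 z).
have e1 : r * norm2 z ^+ 2 <= h ^+ 2 * (mala_move_const * mala_reject_const) * s ^+ 2.
  have := ler_pM r0 z0 hr hz; lra.
have e2 : r ^+ 2 * norm2 z ^+ 2 / (eta * h) <=
    h ^+ 2 * (mala_reject_const ^+ 2 * mala_move_const / eta) * s ^+ 3.
  rewrite ler_pdivrMr//.
  have hr2 : r ^+ 2 <= (mala_reject_const * h * s) ^+ 2.
    by rewrite ler_sqr ?nnegrE// !mulr_ge0// ltW.
  apply: (le_trans (ler_pM (sqr_ge0 r) z0 hr2 hz)).
  by rewrite le_eqVlt; apply/orP; left; apply/eqP; field; rewrite gt_eqF.
set w := norm2 (grad f y) ^+ 6 + norm2 v ^+ 6 in s3.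
have -> : 1 + norm2 (grad f y) ^+ 6 + norm2 v ^+ 6 = 1 + w by rewrite /w addrA.
rewrite /mala_error_const.
set c1 := mala_move_const * mala_reject_const in e1 *.
set c2 := mala_reject_const ^+ 2 * mala_move_const / eta in e2 *.
have c10 : 0 <= c1 by rewrite mulr_ge0.
have c20 : 0 <= c2 by rewrite !mulr_ge0 ?sqr_ge0// invr_ge0 ltW.
have w0 : 0 <= 1 + w by rewrite !addr_ge0 ?exprn_ge0 ?norm2_ge0.
have s2 := sqr_le_1DX3 s0.
have h20 : 0 <= h ^+ 2 := sqr_ge0 h.
have e3 : h ^+ 2 * c1 * s ^+ 2 <= h ^+ 2 * c1 * (4 * (1 + w)).
  by apply: ler_wpM2l; [rewrite mulr_ge0|lra].
have e4 : h ^+ 2 * c2 * s ^+ 3 <= h ^+ 2 * c2 * (4 * (1 + w)).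
  by apply: ler_wpM2l; [rewrite mulr_ge0|lra].
lra.
Qed.

End mala_error.

(** * Sixth moments of the Gaussian and Gibbs measures *)

Section moments.
Local Open Scope ereal_scope.
Context {R : realType} {p : nat}.
Local Notation leb := (lebesgue_rV p).

Let q (v : 'rV[R]_p) : R := (\sum_(i < p) v 0 i ^+ 2)%R.

Let mq : measurable_fun setT q.
Proof. by apply: measurable_sum => i; apply: measurable_funX; exact: measurable_rV_coord. Qed.

Let q0 v : (0 <= q v)%R.
Proof. by apply: sumr_ge0 => i _; exact: sqr_ge0. Qed.

Lemma sixth_moment_density_lty (g : 'rV[R]_p -> R) (C k : R) :
  measurable_fun setT g -> (forall v, 0 <= g v)%R -> (0 < k)%R -> (0 <= C)%R ->
  (forall v, g v <= C * expR (- (k * norm2 v ^+ 2)))%R ->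
  \int[leb]_v ((norm2 v ^+ 6)%:E * (g v)%:E) < +oo.
Proof.
move=> mg g0 k0 C0 gC.
have q6 v : (norm2 v ^+ 6 = q v ^+ 3)%R by rewrite /q -norm2_sqE -exprM.
have me : measurable_fun setT (fun v => expR (- (k * q v)))%R.
  apply: measurableT_comp => //; apply: measurableT_comp => //.
  exact: measurable_funM.
have mq3 : measurable_fun setT (fun v => q v ^+ 3 * expR (- (k * q v)))%R.
  by apply: measurable_funM => //; exact: measurable_funX.
apply: (@le_lt_trans _ _ (\int[leb]_v (C * (q v ^+ 3 * expR (- (k * q v))))%:E)).
  apply: ge0_le_integral => //.
  - by move=> v _; rewrite -EFinM lee_fin mulr_ge0// q6 exprn_ge0.
  - under eq_fun do rewrite q6 -EFinM.
    by apply/measurable_EFinP; apply: measurable_funM => //; exact: measurable_funX.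
  - by apply/measurable_EFinP; exact: measurable_funM.
  - move=> v _; rewrite -EFinM lee_fin q6 mulrCA ler_wpM2l ?exprn_ge0//.
    by have := gC v; rewrite norm2_sqE.
under eq_integral do rewrite EFinM.
rewrite ge0_integralZl_EFin//; last 2 first.
- by move=> v _; rewrite lee_fin mulr_ge0 ?exprn_ge0 ?expR_ge0.
- exact/measurable_EFinP.
by apply: lte_mul_pinfty => //; exact: integral_sqr3_expR_lty.
Qed.

Let mn6 : measurable_fun setT (fun v : 'rV[R]_p => norm2 v ^+ 6)%R.
Proof. exact: measurable_norm2_6. Qed.

(** The bound is read off the density, so a single [n6] serves all the vectors [xi k]. *)
Lemma gaussian_sixth_moment : exists n6 : R, forall gam : probability 'rV[R]_p R,
  (forall A : 'I_p -> set R, (forall i, measurable (A i)) ->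
    gam (rV_box A) = \prod_(i < p) normal_prob 0 1 (A i)) ->
  \int[gam]_v (norm2 v ^+ 6)%:E <= n6%:E.
Proof.
have fin : \int[leb]_v ((norm2 v ^+ 6)%:E * (gaussian_pdf (0 : 'rV[R]_p)%R (1 : R)%R v)%:E) < +oo.
  apply: (@sixth_moment_density_lty _ (normal_peak 1 ^+ p) 2^-1).
  - exact: measurable_gaussian_pdf.
  - exact: gaussian_pdf_ge0.
  - by rewrite invr_gt0.
  - by rewrite exprn_ge0// normal_peak_ge0.
  - move=> v; rewrite gaussian_pdfE// subr0 expr1n mulNr.
    by rewrite (mulrC 2^-1%R).
exists (fine (\int[leb]_v ((norm2 v ^+ 6)%:E * (gaussian_pdf (0 : 'rV[R]_p)%R (1 : R)%R v)%:E))) => gam gamE.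
rewrite (_ : \int[gam]_v _ =
    \int[gam]_v (fun v => (norm2 v ^+ 6)%:E) (0 + 1%R *: v)%R); last first.
  by apply: eq_integral => v _; rewrite add0r scale1r.
rewrite (integral_gaussian_affine gamE 0 (ltr01 : (0 < 1 :> R)%R) (psi := fun v => (norm2 v ^+ 6)%:E)); last 2 first.
- exact/measurable_EFinP.
- by move=> v; rewrite lee_fin exprn_ge0// norm2_ge0.
rewrite fineK// ge0_fin_numE//; apply: integral_ge0 => v _.
by rewrite -EFinM lee_fin mulr_ge0 ?gaussian_pdf_ge0// exprn_ge0// norm2_ge0.
Qed.

(** Strong convexity at 0 dominates e^(-f) by a Gaussian; the Lipschitz condition transfers the
    moment to the gradient. *)
Lemma gibbs_sixth_moment (f : 'rV[R]_p -> R) (m M : R) (pi : probability 'rV[R]_p R) :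
  (0 < m)%R -> (0 < M)%R -> strong_convexity f m -> gradient_lipschitz f M ->
  measurable_fun setT f -> measurable_fun setT (grad f) -> gibbs_measure f pi ->
  \int[pi]_y (norm2 y ^+ 6)%:E < +oo /\
  \int[pi]_y (norm2 (grad f y) ^+ 6)%:E < +oo.
Proof.
move=> m0 M0 f_convex f_lip mf mgrad [Z Z0 piE].
have mw : measurable_fun setT (fun y => Z^-1 * expR (- f y))%R.
  by apply: measurable_funM => //; apply: measurableT_comp => //; exact: measurableT_comp.
have w0 y : (0 <= Z^-1 * expR (- f y))%R by rewrite mulr_ge0 ?expR_ge0// invr_ge0 ltW.
have n60 (v : 'rV[R]_p) : (0 <= norm2 v ^+ 6)%R by rewrite exprn_ge0// norm2_ge0.
(* Half of the quadratic term (m/2) |v|^2 absorbs <grad f 0, v> by Young's inequality, which leaves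
   the rate m/4 and this constant in the exponent. *)
pose b : R := (norm2 (grad f 0) ^+ 2 / m - f 0)%R.
have fin : \int[pi]_y (norm2 y ^+ 6)%:E < +oo.
  rewrite (ge0_integral_density mw w0 piE)//; last first.
    exact/measurable_EFinP.
  apply: (@sixth_moment_density_lty _ (Z^-1 * expR b) (m / 4)) => //.
  - by rewrite divr_gt0.
  - by rewrite mulr_ge0 ?expR_ge0// invr_ge0 ltW.
  - move=> v; rewrite -(mulrA Z^-1%R); apply: ler_wpM2l; first by rewrite invr_ge0 ltW.
    rewrite -expRD ler_expR /b.
    have := f_convex v (0 : 'rV[R]_p)%R; rewrite !subr0.
    have := dotV_young (- grad f 0)%R v (_ : 0 < 2 / m)%R.
    rewrite divr_gt0// => /(_ isT); rewrite dotVNl norm2N invf_div.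
    by move: (norm2 _ ^+ 2)%R (norm2 v ^+ 2)%R => g n; lra.
split=> //.
pose c : R := (32 * norm2 (grad f 0) ^+ 6)%R.
have c0 : (0 <= c)%R by rewrite mulr_ge0.
apply: (@le_lt_trans _ _ (\int[pi]_y (c + 32 * M ^+ 6 * norm2 y ^+ 6)%:E)).
  apply: ge0_le_integral => //.
  - by move=> y _; rewrite lee_fin.
  - by apply/measurable_EFinP; exact: (measurableT_comp mn6 mgrad).
  - apply/measurable_EFinP; apply: measurable_funD => //; exact: measurable_funM.
  - move=> y _; rewrite lee_fin.
    have H := norm2_grad_le M0 f_lip y (0 : 'rV[R]_p)%R; rewrite subr0 in H.
    have -> : (norm2 (grad f y) ^+ 6 = (norm2 (grad f y) ^+ 2) ^+ 3)%R by rewrite -exprM.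
    apply: (@le_trans _ _ ((2 * norm2 (grad f 0) ^+ 2 + 2 * M ^+ 2 * norm2 y ^+ 2) ^+ 3)%R).
      rewrite lerXn2r ?nnegrE ?sqr_ge0//.
      by apply: addr_ge0; do ?apply: mulr_ge0; rewrite ?norm2_ge0 ?(ltW M0).
    apply: (le_trans (exprD3_le _ _)).
    + by do ?apply: mulr_ge0; rewrite ?norm2_ge0 ?(ltW M0).
    + by do ?apply: mulr_ge0; rewrite ?norm2_ge0 ?(ltW M0).
    by rewrite le_eqVlt; apply/orP; left; apply/eqP; rewrite /c; ring.
have c6 : (0 <= 32 * M ^+ 6)%R by rewrite mulr_ge0// exprn_ge0// ltW.
rewrite ge0_integralD_EFin//; last 2 first.
- exact: measurable_funM.
- by move=> y; rewrite mulr_ge0.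
rewrite integral_cst//= probability_setT mule1 ge0_integralZ_EFin//.
by apply: lte_add_pinfty; rewrite ?ltry//; apply: lte_mul_pinfty.
Qed.

End moments.

(** * Filtration of the chain *)

Section history.
Context {R : realType} {d : measure_display} {Omega : measurableType d}
  (P : probability Omega R) {p : nat}.
Variables (X Delta xi : nat -> {RV P >-> 'rV[R]_p}) (epsp epsm : nat -> {RV P >-> R}).
Local Notation H := (history X Delta xi epsp epsm).
Local Notation Hd := (history_dir X Delta xi epsp epsm).

Lemma preimage_measurable d' (T : measurableType d') (Y : {RV P >-> T}) (C : set Omega) :
  g_sigma_algebra_preimage Y C -> measurable C.
Proof. by move=> [B mB <-]; exact: measurable_funP. Qed.

Lemma history_measurable k C : H k C -> measurable C.
Proof.
move: C; apply: smallest_sub; first exact: sigma_algebra_measurable.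
move=> C [|[j _ [[[|]|]|]]]; exact: preimage_measurable.
Qed.

Lemma g_sigma_setI_closed (U : set (set Omega)) : setI_closed <<s U >>.
Proof.
move=> A B UA UB.
exact: (@measurableI _ (g_sigma_algebraType U) A B UA UB).
Qed.

Lemma history_subS k : H k `<=` H k.+1.
Proof.
apply: smallest_sub; first exact: smallest_sigma_algebra.
move=> C HC; apply: sub_sigma_algebra.
case: HC => [HC|[j jk HC]]; [by left|right].
by exists j => //; exact: (ltn_trans jk).
Qed.

Lemma history_sub_dir k : H k `<=` Hd k.
Proof. by move=> C HC; apply: sub_sigma_algebra; left. Qed.

Lemma history_gen d' (T : measurableType d') (Y : {RV P >-> T}) k (E : set T) :
  (g_sigma_algebra_preimage Y `<=` (g_sigma_algebra_preimage (Delta k) `|`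
         g_sigma_algebra_preimage (xi k) `|`
         g_sigma_algebra_preimage (epsp k) `|`
         g_sigma_algebra_preimage (epsm k))) ->
  measurable E -> H k.+1 (Y @^-1` E).
Proof.
move=> sub mE; apply: sub_sigma_algebra; right; exists k => //=.
by apply: sub; exists E => //; rewrite setTI.
Qed.

Section chain.
Variables (f : 'rV[R]_p -> R) (h c : nat -> R).
Hypothesis chain : noisy_lmc_spsa f h c X Delta xi epsp epsm.
Hypothesis mf : measurable_fun setT f.

Lemma direction_sign k w : exists s, Delta k w = signv s.
Proof.
exists [ffun i => Delta k w 0 i == 1]; apply/rowP => i; rewrite !mxE ffunE /bsign.
case: eqP => // D1; have [//|->//] := spsa_dir_sign chain k w i.
Qed.

Lemma map_inv_direction k w : map_mx GRing.inv (Delta k w) = Delta k w.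
Proof.
apply/rowP => i; rewrite mxE.
by have [->|->] := spsa_dir_sign chain k w i; rewrite ?invrN invr1.
Qed.

Lemma chain_step k w : X k.+1 w = X k w -
  h k *: (spsa_quotient f (c k) (X k w) (Delta k w) *: Delta k w +
    ((epsp k w - epsm k w) / (2 * c k)) *: Delta k w) +
  Num.sqrt (2 * h k) *: xi k w.
Proof.
rewrite (spsa_step chain) /spsa_gradient map_inv_direction /spsa_quotient.
set fp := f (_ + _); set fm := f (_ - _).
have -> : (fp + epsp k w - (fm + epsm k w)) / (2 * c k) =
    (fp - fm) / (2 * c k) + (epsp k w - epsm k w) / (2 * c k).
  by rewrite -mulrDl opprD addrACA.
by rewrite scalerDl.
Qed.

Lemma state_history k (E : set 'rV[R]_p) : measurable E -> H k (X k @^-1` E).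
Proof.
elim: k E => [|k IH] E mE.
  by apply: sub_sigma_algebra; left; exists E => //; rewrite setTI.
(* With [Omega] re-equipped with the sigma-algebra of the history, the right-hand side of the
   recursion is measurable by the ordinary closure lemmas. *)
pose T := g_sigma_algebraType (g_sigma_algebra_preimage (X 0) `|`
      \bigcup_(j in [set j | (j < k.+1)%N])
        (g_sigma_algebra_preimage (Delta j) `|`
         g_sigma_algebra_preimage (xi j) `|`
         g_sigma_algebra_preimage (epsp j) `|`
         g_sigma_algebra_preimage (epsm j))).
have mT d' (T' : measurableType d') (Y : Omega -> T') :
    (forall E, measurable E -> H k.+1 (Y @^-1` E)) ->
    measurable_fun setT (Y : T -> T').
  by move=> HY _ B mB; rewrite setTI; exact: HY.
have mX : measurable_fun setT (X k : T -> 'rV[R]_p).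
  by apply: mT => B mB; apply: history_subS; exact: IH.
have mD : measurable_fun setT (Delta k : T -> 'rV[R]_p).
  by apply: mT => B mB; apply: history_gen => // C HC; left; left; left.
have mxi : measurable_fun setT (xi k : T -> 'rV[R]_p).
  by apply: mT => B mB; apply: history_gen => // C HC; left; left; right.
have mep : measurable_fun setT (epsp k : T -> R).
  by apply: mT => B mB; apply: history_gen => // C HC; left; right.
have mem : measurable_fun setT (epsm k : T -> R).
  by apply: mT => B mB; apply: history_gen => // C HC; right.
have mX1 : measurable_fun setT (X k.+1 : T -> 'rV[R]_p).
  rewrite (_ : (X k.+1 : T -> 'rV[R]_p) = (fun w : T => X k w -
    h k *: (spsa_quotient f (c k) (X k w) (Delta k w) *: Delta k w +
      ((epsp k w - epsm k w) / (2 * c k)) *: Delta k w) +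
    Num.sqrt (2 * h k) *: xi k w)); last by apply/funext => w; exact: chain_step.
  apply: measurable_funD_rV; last exact: measurable_funZ_rV.
  apply: measurable_funB_rV => //; apply: measurable_funZ_rV => //.
  apply: measurable_funD_rV; apply: measurable_funZ_rV => //.
    exact: measurable_spsa_quotient.
  by apply: measurable_funM => //; exact: measurable_funB.
by have := mX1 measurableT E mE; rewrite setTI.
Qed.

Lemma rademacher_sign b : rademacher [set @bsign R b] = ((2^-1)%:E)%E.
Proof.
rewrite /rademacher !diracE; case: b; rewrite /bsign.
  rewrite mem_set// memNset ?adde0 ?mule1//= => H1; lra.
rewrite memNset ?add0e ?mem_set ?mule1//= => H1; lra.
Qed.

Lemma direction_prob k C s : H k C ->
  (\int[P]_(w in C) (\1_(Delta k @^-1` [set signv s]) w)%:E =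
   \int[P]_(w in C) ((2 ^+ p)^-1)%:E)%E.
Proof.
move=> HC; have mC := history_measurable HC.
have mE : measurable (Delta k @^-1` [set signv s]).
  by apply: measurable_funPTI; exact: measurable_set1_rV.
rewrite integral_indic// integral_cst//= setIC.
rewrite (spsa_dir_indep chain HC); last first.
  by exists [set signv s]; [exact: measurable_set1_rV|rewrite setTI].
rewrite muleC; congr (_ * _)%E.
have := spsa_dir_rademacher chain k (fun i => measurable_set1 (bsign (s i) : R)).
under eq_bigr do rewrite rademacher_sign.
rewrite prodEFin prodr_const card_ord exprVn => <-; congr (P _).
apply/seteqP; split => w /=; first by move=> -> i; rewrite mxE.
by move=> Dw; apply/rowP => i; rewrite mxE; exact: Dw.
Qed.

Lemma gauss_indep k C (E : set 'rV[R]_p) : H k C -> measurable E ->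
  P (C `&` xi k @^-1` E) = (P C * P (xi k @^-1` E))%E.
Proof.
move=> HC mE; apply: (spsa_gauss_indep chain); first exact: (history_sub_dir HC).
by exists E => //; rewrite setTI.
Qed.

End chain.

Section noise.
Variable delta : R.
Hypothesis noise : noise_assumption X Delta xi epsp epsm delta.
Local Notation eps k := (fun w => epsp k w - epsm k w).

Lemma measurable_noise k : measurable_fun setT (eps k).
Proof. exact: measurable_funB. Qed.

(** [C] intersected with the event of the direction lies in [history_dir], over which the noise
    integrates to 0; by integrability this is equality of the integrals of its two parts. *)
Lemma noise_balance k C s : H k C ->
  (\int[P]_(w in C) (\1_(Delta k @^-1` [set signv s]) w * Num.max (eps k w) 0)%:E =
   \int[P]_(w in C) (\1_(Delta k @^-1` [set signv s]) w * Num.max (- eps k w) 0)%:E)%E.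
Proof.
move=> HC; have mC := history_measurable HC.
have [ieps _ _ E0] := noise_centered noise k.
set D := Delta k @^-1` [set signv s].
have mD : measurable D.
  by apply: measurable_funPTI; exact: measurable_set1_rV.
have HCD : Hd k (C `&` D).
  apply: g_sigma_setI_closed; first exact: (history_sub_dir HC).
  apply: sub_sigma_algebra; right.
  by exists [set signv s]; [exact: measurable_set1_rV|rewrite setTI].
have restr (g : Omega -> R) :
    (\int[P]_(w in C) (\1_D w * g w)%:E = \int[P]_(w in C `&` D) (g w)%:E)%E.
  rewrite integral_mkcond [RHS]integral_mkcond; apply: eq_integral => w _.
  rewrite !patchE in_setI indicE; case: (w \in C) => //=.
  by case: (w \in D); rewrite ?mul1r ?mul0r.
rewrite !restr; have := E0 _ HCD; rewrite integral0_eq//.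
have iCD := integrableS measurableT (measurableI _ _ mC mD) (@subsetT _ _) ieps.
have fp := integrable_pos_fin_num (measurableI _ _ mC mD) iCD.
have fn := integrable_neg_fin_num (measurableI _ _ mC mD) iCD.
rewrite integralE -(fineK fp) -(fineK fn) -EFinB => /(congr1 fine)/= /esym/eqP.
rewrite subr_eq0 => /eqP E1.
have E := congr1 EFin E1; rewrite !fineK// in E.
have -> : (\int[P]_(w in C `&` D) (Num.max (eps k w) 0)%:E =
    \int[P]_(w in C `&` D) ((EFin \o eps k)^\+ w))%E.
  by apply: eq_integral => w _; rewrite funeposE/= EFin_max.
rewrite E; apply: eq_integral => w _.
by rewrite funenegE/= EFin_max.
Qed.

Lemma noise_second_moment k :
  (\int[P]_w (eps k w ^+ 2)%:E <= (2 * delta ^+ 2)%:E)%E.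
Proof.
have [V [ie iV _ EV] Vle] := noise_variance noise k.
rewrite -EV; last exact: (@measurableT _ (g_sigma_algebraType _)).
have mV : measurable_fun setT V by apply/measurable_EFinP; exact: measurable_int iV.
have d0 : 0 <= 2 * delta ^+ 2 by rewrite mulr_ge0 ?sqr_ge0.
(* [V] is a version of a conditional expectation, not known to be nonnegative everywhere and bounded
   only almost everywhere; its positive part suits the comparison of nonnegative integrals. *)
apply: (@le_trans _ _ (\int[P]_w (Num.max (V w) 0)%:E)%E).
  apply: le_integral => //.
  - rewrite (_ : (fun w => _) = (EFin \o V)^\+%E); first exact: integrable_funepos.
    by apply/funext => w; rewrite funeposE/= EFin_max.
  - by move=> w _; rewrite lee_fin le_max lexx.
apply: (@le_trans _ _ (\int[P]_w (cst (2 * delta ^+ 2)%:E w))%E); last first.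
  by rewrite integral_cst//= probability_setT mule1.
apply: ae_ge0_le_integral => //.
- by move=> w _; rewrite lee_fin le_max lexx orbT.
- by apply/measurable_EFinP; exact: measurable_maxr.
- apply: filterS Vle => w Vw _; rewrite /= lee_fin ge_max Vw.
  exact: d0.
Qed.

End noise.

End history.

Lemma coupled_step (R : pzRingType) (V : lmodType R) (h : R) (x y u g v : V) :
  x - h *: u + v - (y - h *: g + v) = x - y - h *: (u - g).
Proof.
by rewrite [y - _ + v]addrC addrKA scalerBr !opprB addrACA [RHS]addrACA [- (h *: u) - y]addrC. Qed.

(** * Coupled chains through time *)

Section chain_coupling.
Local Open Scope ereal_scope.
Context {R : realType} {p : nat} (f : 'rV[R]_p -> R) (m M K a : R).
Hypothesis m0 : (0 < m)%R.
Hypothesis M0 : (0 < M)%R.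
Hypothesis f_convex : strong_convexity f m.
Hypothesis f_lip : gradient_lipschitz f M.
Hypothesis df : times_differentiable 3 f.
Hypothesis f_third : third_derivative_bound f K.
Context {d : measure_display} {Omega : measurableType d} (P : probability Omega R).
Variables (X Delta xi : nat -> {RV P >-> 'rV[R]_p}) (epsp epsm : nat -> {RV P >-> R}).
Variables (h c : nat -> R) (delta : R).
Hypothesis chain : noisy_lmc_spsa f h c X Delta xi epsp epsm.
Hypothesis noise : noise_assumption X Delta xi epsp epsm delta.
Variable pi : probability 'rV[R]_p R.
Hypothesis pi_gibbs : gibbs_measure f pi.
Local Notation H := (history X Delta xi epsp epsm).

Let mf : measurable_fun setT f.
Proof.
by apply: continuous_measurable_rV => x; apply: differentiable_continuous; case: df.
Qed.

Let mgrad : measurable_fun setT (grad f).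
Proof.
apply: measurable_fun_rV => i; under eq_fun do rewrite mxE.
apply: continuous_measurable_rV => x; apply: differentiable_continuous.
by case: df => _ /(_ i)[].
Qed.

(** The invariant of the induction on [k]. The first component of [Q] is all of [Omega] and not just
    the current state, because the directions, noises and Gaussian vectors still to come must remain
    available. *)
Definition coupled_within (k : nat) (e : R) : Prop :=
  exists Q : probability (Omega * 'rV[R]_p)%type R,
  [/\ (forall A, measurable A -> Q (A `*` setT) = P A),
      (forall B, measurable B -> Q (setT `*` B) = pi B),
      second_adapted P (H k) Q &
      \int[Q]_z (norm2 (X k z.1 - z.2) ^+ 2)%:E <= e%:E].

Let mXy k : measurable_fun setT (fun z : Omega * 'rV[R]_p => (X k z.1, z.2)).
Proof.
apply/measurable_fun_pairP; split; last exact: measurable_snd.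
exact: (measurableT_comp (measurable_funPT (X k)) measurable_fst).
Qed.

Let mdist2 : measurable_fun setT
  (fun u : 'rV[R]_p * 'rV[R]_p => norm2 (u.1 - u.2) ^+ 2)%R.
Proof.
by apply: measurable_norm2_sq; apply: measurable_funB_rV;
  [exact: measurable_fst|exact: measurable_snd].
Qed.

Lemma coupled_within_ge0 k e : coupled_within k e -> (0 <= e)%R.
Proof.
move=> [Q [_ _ _ Qe]]; rewrite -lee_fin; apply: le_trans Qe.
by apply: integral_ge0 => z _; rewrite lee_fin sqr_ge0.
Qed.

Lemma coupled_within_le k e e' : (e <= e')%R -> coupled_within k e -> coupled_within k e'.
Proof.
move=> ee' [Q [Q_fst Q_snd Q_ad Qe]]; exists Q; split => //.
by apply: le_trans Qe _; rewrite lee_fin.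
Qed.

Lemma wasserstein2_le k e : coupled_within k e ->
  wasserstein2 (distribution P (X k)) pi <= (Num.sqrt e)%:E.
Proof.
move=> ke; have e0 := coupled_within_ge0 ke.
have [Q [Q_fst Q_snd _ Qe]] := ke.
pose gamma : probability ('rV[R]_p * 'rV[R]_p)%type R :=
  distribution Q (mfun_of (mXy k)).
have gammaE : \int[gamma]_u (norm2 (u.1 - u.2) ^+ 2)%:E =
    \int[Q]_z (norm2 (X k z.1 - z.2) ^+ 2)%:E.
  rewrite (ge0_integral_distribution (mfun_of (mXy k))
    (f := fun u => (norm2 (u.1 - u.2) ^+ 2)%:E))//.
  - exact/measurable_EFinP.
  - by move=> u; rewrite lee_fin sqr_ge0.
apply: (@le_trans _ _ ((\int[gamma]_u (norm2 (u.1 - u.2) ^+ 2)%:E) `^ 2^-1)).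
  apply: ereal_inf_lbound; exists gamma => // A mA; split.
    rewrite -[LHS]/(Q [set z | (A `*` setT) (X k z.1, z.2)]).
    have mXA : measurable (X k @^-1` A) by exact: measurable_funPTI.
    apply: etrans (Q_fst _ mXA); congr (Q _).
  rewrite -[LHS]/(Q [set z | (setT `*` A) (X k z.1, z.2)]) -Q_snd//.
rewrite gammaE; apply: (@le_trans _ _ (e%:E `^ 2^-1)).
  apply: gt0_ler_poweR => //; rewrite ?invr_ge0// in_itv/= leey andbT.
    by apply: integral_ge0 => z _; rewrite lee_fin sqr_ge0.
  by rewrite lee_fin.
by rewrite poweR_EFin powR12_sqrt.
Qed.

(** The product of [P] and pi is adapted by independence. Its cost is finite because some coupling
    of finite cost, together with the moments of pi, bounds the second moment of the initial
    state. *)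
Lemma coupled_within0 : wasserstein2 (distribution P (X 0%N)) pi < +oo ->
  exists e, coupled_within 0 e.
Proof.
move=> /ereal_inf_lt[_ [gamma gammaP <-] gammaoo].
have m6 := gibbs_sixth_moment m0 M0 f_convex f_lip mf mgrad pi_gibbs.
have mX : measurable_fun setT (X 0%N) by exact: measurable_funPT.
have mn2 : measurable_fun setT (fun v : 'rV[R]_p => norm2 v ^+ 2)%R.
  exact: measurable_norm2_sq.
have n20 (v : 'rV[R]_p) : (0 <= norm2 v ^+ 2)%R by exact: sqr_ge0.
have pi2 : \int[pi]_y (norm2 y ^+ 2)%:E < +oo.
  apply: (@le_lt_trans _ _ (\int[pi]_y (1 + norm2 y ^+ 6)%:E)).
    apply: ge0_le_integral_EFin => //.
    - by apply: measurable_funD => //; exact: measurable_norm2_6.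
    - by move=> y; rewrite (_ : 6 = 2 * 3)%N// exprM le_1DX3 ?sqr_ge0.
  rewrite ge0_integralD_EFin//; last 2 first.
  - exact: measurable_norm2_6.
  - by move=> y; rewrite exprn_ge0// norm2_ge0.
  rewrite integral_cst//= probability_setT mule1.
  by apply: lte_add_pinfty; rewrite ?ltry//; exact: m6.1.
have X2 : \int[P]_w (norm2 (X 0%N w) ^+ 2)%:E < +oo.
  have gfin : \int[gamma]_u (norm2 (u.1 - u.2) ^+ 2)%:E < +oo.
    by apply: lty_poweRy gammaoo.
  have g1 : \int[gamma]_u (norm2 u.1 ^+ 2)%:E = \int[P]_w (norm2 (X 0%N w) ^+ 2)%:E.
    rewrite (first_marginal_integral (P := distribution P (X 0%N))
      (phi := fun v => (norm2 v ^+ 2)%:E)); last 3 first.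
    - by move=> A mA; have [] := gammaP A mA.
    - exact/measurable_EFinP.
    - by move=> v; rewrite lee_fin.
    rewrite (ge0_integral_distribution (X 0%N) (f := fun v => (norm2 v ^+ 2)%:E))//.
    exact/measurable_EFinP.
  have g2 : \int[gamma]_u (norm2 u.2 ^+ 2)%:E = \int[pi]_y (norm2 y ^+ 2)%:E.
    apply: (second_marginal_integral (phi := fun v => (norm2 v ^+ 2)%:E)).
    - by move=> A mA; have [] := gammaP A mA.
    - exact/measurable_EFinP.
    - by move=> v; rewrite lee_fin.
  have mu2 : measurable_fun setT (fun u : 'rV[R]_p * 'rV[R]_p => norm2 u.2 ^+ 2)%R.
    exact: (measurableT_comp mn2 measurable_snd).
  have mu1 : measurable_fun setT (fun u : 'rV[R]_p * 'rV[R]_p => norm2 u.1 ^+ 2)%R.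
    exact: (measurableT_comp mn2 measurable_fst).
  rewrite -g1; apply: (@le_lt_trans _ _ (\int[gamma]_u
      (2 * norm2 (u.1 - u.2) ^+ 2 + 2 * norm2 u.2 ^+ 2)%:E)).
    apply: ge0_le_integral_EFin => //.
    - by apply: measurable_funD; exact: measurable_funM.
    - by move=> u; have := norm2_sqD_le (u.1 - u.2) u.2; rewrite subrK.
  rewrite ge0_integralD_EFin//; last 4 first.
  - exact: measurable_funM.
  - exact: measurable_funM.
  - by move=> u; rewrite mulr_ge0.
  - by move=> u; rewrite mulr_ge0.
  rewrite !ge0_integralZ_EFin// g2.
  by apply: lte_add_pinfty; apply: lte_mul_pinfty => //; rewrite lee_fin.
pose mu : {measure set (Omega * 'rV[R]_p) -> \bar R} := (P \x pi)%E.
have mu1 : mu setT = 1%E.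
  rewrite -setXTT -[LHS]/((P \x pi)%E (setT `*` setT)) product_measure1E//.
  by apply: etrans (congr2 mule (probability_setT P) (probability_setT pi)) _; rewrite mule1.
pose Q : probability (Omega * 'rV[R]_p)%type R :=
  HB.pack (mu : set _ -> \bar R) (Measure.class mu)
    (@Measure_isProbability.Build _ _ R mu mu1).
have Q_fst A : measurable A -> Q (A `*` setT) = P A.
  move=> mA; rewrite -[LHS]/((P \x pi)%E (A `*` setT)) product_measure1E//.
  by apply: etrans (congr1 (mule (P A)) (probability_setT pi)) _; rewrite mule1.
have Q_snd B : measurable B -> Q (setT `*` B) = pi B.
  move=> mB; rewrite -[LHS]/((P \x pi)%E (setT `*` B)) product_measure1E//.
  by apply: etrans (congr1 (mule^~ (pi B)) (probability_setT P)) _; rewrite mul1e.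
have mX1 : measurable_fun setT (fun z : Omega * 'rV[R]_p => norm2 (X 0%N z.1) ^+ 2)%R.
  exact: (measurableT_comp (measurableT_comp mn2 mX) measurable_fst).
have my1 : measurable_fun setT (fun z : Omega * 'rV[R]_p => norm2 z.2 ^+ 2)%R.
  exact: (measurableT_comp mn2 measurable_snd).
have mXy2 : measurable_fun setT (fun z : Omega * 'rV[R]_p => norm2 (X 0%N z.1 - z.2) ^+ 2)%R.
  exact: (measurableT_comp mdist2 (mXy 0%N)).
have fin : \int[Q]_z (norm2 (X 0%N z.1 - z.2) ^+ 2)%:E < +oo.
  apply: (@le_lt_trans _ _ (\int[Q]_z (2 * norm2 (X 0%N z.1) ^+ 2 + 2 * norm2 z.2 ^+ 2)%:E)).
    apply: ge0_le_integral_EFin => //.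
    - by apply: measurable_funD; exact: measurable_funM.
    - by move=> z; exact: norm2_sqB_le.
  rewrite ge0_integralD_EFin//; last 4 first.
  - exact: measurable_funM.
  - exact: measurable_funM.
  - by move=> u; rewrite mulr_ge0.
  - by move=> u; rewrite mulr_ge0.
  rewrite !ge0_integralZ_EFin//.
  rewrite (first_marginal_integral Q_fst (phi := fun w => (norm2 (X 0%N w) ^+ 2)%:E)); last 2 first.
  - by apply/measurable_EFinP; exact: (measurableT_comp mn2 mX).
  - by move=> w; rewrite lee_fin.
  rewrite (second_marginal_integral Q_snd (phi := fun y => (norm2 y ^+ 2)%:E)); last 2 first.
  - exact/measurable_EFinP.
  - by move=> w; rewrite lee_fin.
  by apply: lte_add_pinfty; apply: lte_mul_pinfty => //; rewrite lee_fin.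
exists (fine (\int[Q]_z (norm2 (X 0%N z.1 - z.2) ^+ 2)%:E)); exists Q; split=> //; last first.
  rewrite fineK// ge0_fin_numE//; apply: integral_ge0 => z _.
  by rewrite lee_fin.
move=> psi1 psi2 m1 m2 p10 p20 i1 i2 E12 B mB.
have mB1 : measurable_fun setT (\1_B : 'rV[R]_p -> R) by exact: measurable_indic.
have E (psi : Omega -> R) : measurable_fun setT psi -> (forall w, 0 <= psi w)%R ->
    \int[Q]_z (psi z.1 * \1_B z.2)%:E = pi B * \int[P]_w (psi w)%:E.
  move=> mpsi psi0; have mp : measurable_fun setT (fun z : Omega * 'rV[R]_p => (psi z.1 * \1_B z.2)%:E).
    apply/measurable_EFinP; apply: measurable_funM; first exact: (measurableT_comp mpsi measurable_fst).
    exact: (measurableT_comp mB1 measurable_snd).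
  rewrite -[LHS]/(\int[(P \x pi)%E]_z (psi z.1 * \1_B z.2)%:E).
  rewrite (fubini_tonelli1 (fun z : Omega * 'rV[R]_p => (psi z.1 * \1_B z.2)%:E))//; last first.
    by move=> z; rewrite lee_fin mulr_ge0.
  pose b : R := fine (pi B).
  have bE : b%:E = pi B by rewrite fineK// fin_num_measure.
  have b0 : (0 <= b)%R by rewrite -lee_fin bE.
  rewrite -bE -ge0_integralZ_EFin//; apply: eq_integral => w _.
  rewrite /fubini_F/= ge0_integralZ_EFin// integral_indic// setIT.
  rewrite [X in _ * X](_ : _ = b%:E); last exact: esym bE.
  by rewrite -EFinM mulrC.
rewrite !E//; congr (_ * _).
have := E12 setT; apply.
exact: (@measurableT _ (g_sigma_algebraType _)).
Qed.

(** The drift bound controls the gap for accepted proposals; the mixture estimate then pays for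
    rejections with a second factor 1 + eta h and a term of order h^2. Integrals under the new
    coupling are first rewritten under the old one. *)
Lemma coupled_withinS (k : nat) (e eta g6 n6 : R) :
  coupled_within k e -> (0 < eta)%R -> (0 < h k)%R -> (h k <= a)%R -> (0 < c k)%R ->
  \int[pi]_y (norm2 (grad f y) ^+ 6)%:E <= g6%:E ->
  \int[P]_w (norm2 (xi k w) ^+ 6)%:E <= n6%:E ->
  (0 <= drift_rate (p := p) m M eta (h k))%R ->
  coupled_within k.+1
    ((1 + eta * h k) *
     (drift_rate (p := p) m M eta (h k) * e +
      h k ^+ 2 * (8 * p%:R ^+ 2 + 4) * (1 + g6) +
      drift_bias (p := p) M K eta (h k) (c k) +
      h k ^+ 2 * (p%:R * delta ^+ 2 / (2 * c k ^+ 2))) +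
     h k ^+ 2 * mala_error_const M a eta * (1 + g6 + n6))%R.
Proof.
move=> [Q [Q_fst Q_snd Q_ad Qe]] eta0 h0 ha c0 G6 N6 rate0.
have mX : measurable_fun setT (X k) by exact: measurable_funPT.
have mX1 : measurable_fun setT (X k.+1) by exact: measurable_funPT.
have mD : measurable_fun setT (Delta k) by exact: measurable_funPT.
have mxi : measurable_fun setT (xi k) by exact: measurable_funPT.
have g60 y : (0 <= norm2 (grad f y) ^+ 6)%R by rewrite exprn_ge0// norm2_ge0.
have n60 (y : 'rV[R]_p) : (0 <= norm2 y ^+ 6)%R by rewrite exprn_ge0// norm2_ge0.
have mg6 : measurable_fun setT (fun y => norm2 (grad f y) ^+ 6)%R.
  exact: measurable_norm2_6.
have mn6 : measurable_fun setT (fun w => norm2 (xi k w) ^+ 6)%R.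
  exact: measurable_norm2_6.
(* t <= 1 + t^3 at t = |grad f y|^2 extracts the second moment from the sixth. *)
have G2 : \int[pi]_y (norm2 (grad f y) ^+ 2)%:E <= (1 + g6)%:E.
  apply: (@le_trans _ _ (\int[pi]_y (1 + norm2 (grad f y) ^+ 6)%:E)).
    apply: ge0_le_integral_EFin => //.
    - exact: measurable_norm2_sq.
    - exact: measurable_funD.
    - by move=> y; exact: sqr_ge0.
    - by move=> y; rewrite (_ : 6 = 2 * 3)%N// exprM le_1DX3 ?sqr_ge0.
  rewrite ge0_integralD_EFin// integral_cst//= probability_setT mule1 EFinD.
  exact: leeD.
have bias0 : (0 <= drift_bias (p := p) M K eta (h k) (c k))%R.
  have h0' := ltW h0; have eta0' := ltW eta0; have c0' := ltW c0.
  have p3 : (0 <= p%:R ^+ 3 :> R)%R by exact: exprn_ge0.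
  have c4 : (0 <= c k ^+ 4)%R by exact: exprn_ge0.
  have b1 : (0 <= K ^+ 2 * c k ^+ 4 * p%:R ^+ 3)%R.
    by apply: mulr_ge0 => //; apply: mulr_ge0 => //; exact: sqr_ge0.
  have b2 : (0 <= 4 * M ^+ 2 * c k ^+ 2 * p%:R ^+ 3)%R.
    apply: mulr_ge0 => //; apply: mulr_ge0; last exact: sqr_ge0.
    by apply: mulr_ge0 => //; exact: sqr_ge0.
  by apply: addr_ge0; apply: mulr_ge0; rewrite ?divr_ge0 ?sqr_ge0.
have err0 : (0 <= mala_error_const M a eta)%R.
  exact: (mala_error_const_ge0 M0 eta0 h0 ha).
have mH C : H k C -> measurable C by exact: history_measurable.
have IH : setI_closed (H k) by exact: g_sigma_setI_closed.
have IH1 : setI_closed (H k.+1) by exact: g_sigma_setI_closed.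
have XH (E : set 'rV[R]_p) : measurable E -> H k (X k @^-1` E).
  exact: (state_history chain mf).
have DH C s := @direction_prob _ _ _ _ _ _ _ _ _ _ _ _ _ chain k C s.
have eH C s := @noise_balance _ _ _ _ _ _ _ _ _ _ _ noise k C s.
have meps := measurable_noise epsp epsm k.
have drift := noisy_drift_le m0 M0 f_convex f_lip df f_third mf mgrad mX mD
  meps mH IH XH (direction_sign chain k) DH eH
  (noise_second_moment noise k) Q_fst Q_snd Q_ad Qe G2 eta0 (ltW h0) c0 rate0 bias0.
set A := noisy_drift _ _ _ _ _ _ in drift.
have xiH C E := @gauss_indep _ _ _ _ _ _ _ _ _ _ _ _ _ chain k C E.
have xiH1 (E : set 'rV[R]_p) : measurable E -> H k.+1 (xi k @^-1` E).
  by move=> mE; apply: history_gen => // C HC; left; left; right.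
have [Q' [Q'_fst Q'_snd Q'_ad Q'E]] := mala_coupling h0 mf mgrad mxi
  (spsa_gauss chain k) mH xiH (@history_subS _ _ _ _ _ X Delta xi epsp epsm k)
  IH1 xiH1 pi_gibbs Q_fst Q_snd Q_ad.
exists Q'; split => //.
have mXy1 : measurable_fun setT (fun z : Omega * 'rV[R]_p => norm2 (X k.+1 z.1 - z.2) ^+ 2)%R.
  exact: (measurableT_comp mdist2 (mXy k.+1)).
have mA : measurable_fun setT A.
  have mX' := measurableT_comp mX (@measurable_fst _ _ Omega 'rV[R]_p).
  have mD' := measurableT_comp mD (@measurable_fst _ _ Omega 'rV[R]_p).
  have meps' := measurableT_comp meps (@measurable_fst _ _ Omega 'rV[R]_p).
  have mg' := measurableT_comp mgrad (@measurable_snd _ _ Omega 'rV[R]_p).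
  apply: measurable_funB_rV; first exact: (measurable_funB_rV mX' measurable_snd).
  apply: measurable_funZ_rV => //; apply: measurable_funB_rV => //.
  apply: measurable_funD_rV; apply: measurable_funZ_rV => //.
    exact: measurable_spsa_quotient.
  exact: measurable_funM.
have mA2 : measurable_fun setT (fun z => norm2 (A z) ^+ 2)%R by exact: measurable_norm2_sq.
have k1 : (0 <= 1 + eta * h k)%R by rewrite addr_ge0// mulr_ge0// ltW.
have k2 : (0 <= h k ^+ 2 * mala_error_const M a eta)%R by rewrite mulr_ge0// sqr_ge0.
have mg6' : measurable_fun setT (fun z : Omega * 'rV[R]_p => norm2 (grad f z.2) ^+ 6)%R.
  exact: (measurableT_comp mg6 measurable_snd).
have mn6' : measurable_fun setT (fun z : Omega * 'rV[R]_p => norm2 (xi k z.1) ^+ 6)%R.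
  exact: (measurableT_comp mn6 measurable_fst).
rewrite Q'E//; last by move=> z; exact: sqr_ge0.
set bnd := (X in _ <= X).
apply: (@le_trans _ _ (\int[Q]_z ((1 + eta * h k) * norm2 (A z) ^+ 2 +
  h k ^+ 2 * mala_error_const M a eta *
    (1 + norm2 (grad f z.2) ^+ 6 + norm2 (xi k z.1) ^+ 6))%:E)).
  have mpair : measurable_fun setT (fun z : Omega * 'rV[R]_p => (z.2, xi k z.1)).
    apply/measurable_fun_pairP; split; first exact: measurable_snd.
    exact: (measurableT_comp mxi measurable_fst).
  have mprop : measurable_fun setT (fun z : Omega * 'rV[R]_p => mala_proposal f (h k) z.2 (xi k z.1)).
    exact: (measurableT_comp (measurable_mala_proposal (h k) mgrad) mpair).
  have macc : measurable_fun setT (fun z : Omega * 'rV[R]_p =>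
      mala_accept f (h k) z.2 (mala_proposal f (h k) z.2 (xi k z.1))).
    have mpair' : measurable_fun setT (fun z : Omega * 'rV[R]_p =>
        (z.2, mala_proposal f (h k) z.2 (xi k z.1))).
      by apply/measurable_fun_pairP; split => //; exact: measurable_snd.
    exact: (measurableT_comp (measurable_mala_accept (h k) mf mgrad) mpair').
  have mX1' : measurable_fun setT (fun z : Omega * 'rV[R]_p =>
      norm2 (X k.+1 z.1 - mala_proposal f (h k) z.2 (xi k z.1)) ^+ 2)%R.
    apply: measurable_norm2_sq; apply: measurable_funB_rV => //.
    exact: (measurableT_comp mX1 measurable_fst).
  apply: ge0_le_integral_EFin.
  - apply: measurable_funD; apply: measurable_funM => //.
    exact: measurable_funB.
  - apply: measurable_funD; first exact: measurable_funM.
    apply: measurable_funM => //; apply: measurable_funD => //; exact: measurable_funD.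
  - move=> z; apply: addr_ge0; apply: mulr_ge0; rewrite ?sqr_ge0//.
      exact: mala_accept_ge0.
    by rewrite subr_ge0; exact: mala_accept_le1.
  move=> z.
  have step1 : (X k.+1 z.1 - mala_proposal f (h k) z.2 (xi k z.1) = A z)%R.
    rewrite (chain_step chain k z.1) mala_proposalE; exact: coupled_step.
  have step2 : (X k.+1 z.1 - z.2 =
      A z + (mala_proposal f (h k) z.2 (xi k z.1) - z.2))%R.
    by rewrite -step1 subrKA.
  rewrite [X in (_ * X + _ <= _)%R](congr1 (fun v => norm2 v ^+ 2)%R step1).
  rewrite [X in (_ + _ * X <= _)%R](congr1 (fun v => norm2 v ^+ 2)%R step2).
  exact: (mala_mixture_le m0 M0 f_convex f_lip eta0 h0 ha z.2 (xi k z.1) (A z)).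
rewrite ge0_integralD_EFin//; last 4 first.
- exact: measurable_funM.
- by apply: measurable_funM => //; apply: measurable_funD => //; exact: measurable_funD.
- by move=> z; rewrite mulr_ge0// sqr_ge0.
- by move=> z; rewrite mulr_ge0// addr_ge0// addr_ge0.
rewrite !ge0_integralZ_EFin//; last 3 first.
- by apply: measurable_funD => //; exact: measurable_funD.
- by move=> z; rewrite addr_ge0// addr_ge0.
- by move=> z; exact: sqr_ge0.
rewrite ge0_integralD_EFin//; last 2 first.
- exact: measurable_funD.
- by move=> z; rewrite addr_ge0.
rewrite ge0_integralD_EFin// integral_cst//= [Q _]probability_setT mule1.
rewrite (first_marginal_integral Q_fst (phi := fun w => (norm2 (xi k w) ^+ 6)%:E)); last 2 first.
- exact/measurable_EFinP.
- by move=> w; rewrite lee_fin.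
rewrite (second_marginal_integral Q_snd (phi := fun y => (norm2 (grad f y) ^+ 6)%:E)); last 2 first.
- exact/measurable_EFinP.
- by move=> w; rewrite lee_fin.
have G7 : 1 + \int[pi]_y (norm2 (grad f y) ^+ 6)%:E + \int[P]_w (norm2 (xi k w) ^+ 6)%:E <=
    (1 + g6 + n6)%:E.
  by rewrite EFinD; apply: leeD => //; rewrite EFinD; apply: leeD.
by have := lee_affine2 0 k1 k2 drift G7; rewrite adde0 addr0.
Qed.

End chain_coupling.

(** * Rates *)

Section rates.
Context {R : realType}.

Lemma powR_expn (x s : R) (n : nat) : (x `^ s) ^+ n = x `^ (s * n%:R).
Proof. by rewrite powRrM powR_mulrn// powR_ge0. Qed.

Section drift_rate_bound.
Variables (p : nat) (m M a h : R).
Hypotheses (m0 : 0 < m) (M0 : 0 < M) (h0 : 0 <= h) (ha : h <= a).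

Definition drift_rate_const : R :=
  M ^+ 2 + m / 2 * M ^+ 2 * a + (m / 4) ^+ 2 * (1 + M ^+ 2 * a ^+ 2) +
  (1 + m / 4 * a) * (2 * M ^+ 2 * (4 * p%:R ^+ 2 + 2)).

Lemma drift_rate_const_ge0 : 0 <= drift_rate_const.
Proof.
have a0 : 0 <= a := le_trans h0 ha.
have m0' := ltW m0; have M2 := sqr_ge0 M; have a2 := sqr_ge0 a.
have B0 : 0 <= 4 * p%:R ^+ 2 + 2 :> R by rewrite addr_ge0// mulr_ge0// sqr_ge0.
have m4 : 0 <= m / 4 by rewrite divr_ge0.
have k1 : 0 <= (1 + m / 4 * a) by rewrite addr_ge0// mulr_ge0.
have k2 : 0 <= 2 * M ^+ 2 * (4 * p%:R ^+ 2 + 2) by rewrite mulr_ge0// mulr_ge0.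
have k3 : 0 <= 1 + M ^+ 2 * a ^+ 2 by rewrite addr_ge0// mulr_ge0.
have k4 : 0 <= m / 2 * M ^+ 2 by rewrite mulr_ge0// divr_ge0.
have := mulr_ge0 k1 k2; have := mulr_ge0 (sqr_ge0 (m / 4)) k3; have := mulr_ge0 k4 a0.
by rewrite /drift_rate_const => ? ? ?; rewrite !addr_ge0.
Qed.

(** Two factors 1 + (m/4) h, one for the gradient bias inside [drift_rate] and one for rejections,
    take m h / 2 from the contraction 2 m h; what remains carries h^2 and is bounded through h <=
    a. *)
Lemma drift_rate_le :
  (1 + m / 4 * h) * drift_rate (p := p) m M (m / 4) h <=
  1 - 3 / 2 * m * h + drift_rate_const * h ^+ 2.
Proof.
have a0 : 0 <= a := le_trans h0 ha.
have M2 := sqr_ge0 M; have h2 := sqr_ge0 h.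
have ha2 : h ^+ 2 <= a ^+ 2 by rewrite lerXn2r.
have p2 : 0 <= 4 * p%:R ^+ 2 + 2 :> R by rewrite addr_ge0// mulr_ge0// sqr_ge0.
pose q := 1 - 2 * m * h + M ^+ 2 * h ^+ 2.
have qle : q <= 1 + M ^+ 2 * a ^+ 2.
  have : M ^+ 2 * h ^+ 2 <= M ^+ 2 * a ^+ 2 by exact: ler_wpM2l.
  have : 0 <= m * h by rewrite mulr_ge0// ltW.
  by rewrite /q; lra.
have h1 : (m / 4) ^+ 2 * h ^+ 2 * q <= (m / 4) ^+ 2 * h ^+ 2 * (1 + M ^+ 2 * a ^+ 2).
  exact: (ler_wpM2l (mulr_ge0 (sqr_ge0 _) h2) qle).
have h3 : m / 2 * M ^+ 2 * h ^+ 2 * h <= m / 2 * M ^+ 2 * h ^+ 2 * a.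
  by apply: ler_wpM2l => //; apply: mulr_ge0 => //; apply: mulr_ge0 => //; rewrite divr_ge0// ltW.
have h4 : (m / 4 * h) * (h ^+ 2 * (2 * M ^+ 2 * (4 * p%:R ^+ 2 + 2))) <=
    (m / 4 * a) * (h ^+ 2 * (2 * M ^+ 2 * (4 * p%:R ^+ 2 + 2))).
  apply: ler_wpM2r; first by rewrite mulr_ge0// mulr_ge0// mulr_ge0.
  by apply: ler_wpM2l => //; rewrite divr_ge0// ltW.
have h5 : 0 <= m ^+ 2 * h ^+ 2 by rewrite mulr_ge0// sqr_ge0.
rewrite /drift_rate /drift_rate_const.
move: h1 h3 h4; rewrite /q.
move: (4 * p%:R ^+ 2 + 2) => B h1 h3 h4.
lra.
Qed.

End drift_rate_bound.

(** [T] stands for c^2 and [v] for delta^2. The cubic identity expresses v h through T^3, which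
    makes the noise term (1/9) (h K^2 / m) p^4 T^2, while the bias is 4 (h K^2 / m) p^3 T^2; then p
    >= 1 and 4 + 1/9 <= 5. *)
Lemma bias_noise_le (m K p h T v : R) : 0 < m -> 0 < K -> 1 <= p -> 0 <= h ->
  0 < T -> T ^+ 3 = 9 * m * v * h / (2 * K ^+ 2 * p ^+ 3) ->
  h / (m / 4) * (K ^+ 2 * T ^+ 2 * p ^+ 3) + h ^+ 2 * (p * v / (2 * T)) <=
  h * (5 * K ^+ 2 / m) * (p ^+ 4 * T ^+ 2).
Proof.
move=> m0 K0 p1 h0 T0 T3; have p0 : 0 < p by apply: lt_le_trans p1.
have vh : v * h = 2 * K ^+ 2 * p ^+ 3 * T ^+ 3 / (9 * m).
  by rewrite T3; field; rewrite !gt_eqF.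
have -> : h ^+ 2 * (p * v / (2 * T)) = h * (p * (v * h) / (2 * T)) by field; rewrite gt_eqF.
have -> : h * (p * (v * h) / (2 * T)) = h * (K ^+ 2 / m) * (p ^+ 4 * T ^+ 2) / 9.
  by rewrite vh; field; rewrite !gt_eqF.
have -> : h / (m / 4) * (K ^+ 2 * T ^+ 2 * p ^+ 3) =
    4 * (h * (K ^+ 2 / m)) * (p ^+ 3 * T ^+ 2) by field; rewrite gt_eqF.
have c0 : 0 <= h * (K ^+ 2 / m) by rewrite mulr_ge0// divr_ge0 ?sqr_ge0// ltW.
have pT : p ^+ 3 * T ^+ 2 <= p ^+ 4 * T ^+ 2.
  by apply: ler_wpM2r; rewrite ?sqr_ge0// ler_weXn2l.
have := ler_wpM2l c0 pT.
have : 0 <= h * (K ^+ 2 / m) * (p ^+ 4 * T ^+ 2).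
  apply: mulr_ge0 => //; apply: mulr_ge0; last exact: sqr_ge0.
  by rewrite exprn_ge0// ltW.
lra.
Qed.

Section perturbation.
Variables (m K a k0 delta : R) (p : nat).
Hypotheses (m0 : 0 < m) (K0 : 0 < K) (a0 : 0 < a) (k01 : 1 <= k0).
Hypotheses (delta0 : 0 < delta) (p1 : (1 <= p)%N).
Local Notation n k := (k%:R + k0).
Local Notation h := (stepsize a k0).
Local Notation c := (perturbation m K delta p h).

Let n0 k : 0 < n k.
Proof. by rewrite ltr_wpDl// (lt_le_trans _ k01). Qed.

Let p0 : 0 < p%:R :> R. Proof. by rewrite ltr0n. Qed.

Let arg_gt0 k : 0 < 9 * m * delta ^+ 2 * h k / (2 * K ^+ 2 * p%:R ^+ 3).
Proof.
have h0 : 0 < h k by exact: divr_gt0.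
have d2 : 0 < delta ^+ 2 by exact: exprn_gt0.
have K2 : 0 < K ^+ 2 by exact: exprn_gt0.
have p3 : 0 < p%:R ^+ 3 :> R by exact: exprn_gt0.
by rewrite divr_gt0 ?(mulr_gt0 _ p3) ?(mulr_gt0 _ h0) ?(mulr_gt0 _ d2) ?(mulr_gt0 _ m0) ?(mulr_gt0 _ K2).
Qed.

Definition perturbation_const : R := (9 * m * a / (2 * K ^+ 2)) `^ 3^-1.

Lemma perturbation_const_gt0 : 0 < perturbation_const.
Proof. by rewrite powR_gt0// divr_gt0// ?mulr_gt0// exprn_gt0. Qed.

Lemma perturbation_cube k :
  (c k ^+ 2) ^+ 3 = 9 * m * delta ^+ 2 * h k / (2 * K ^+ 2 * p%:R ^+ 3).
Proof.
rewrite /perturbation sqr_sqrtr ?powR_ge0// powR_expn mulVf// powRr1//.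
exact/ltW/arg_gt0.
Qed.

Lemma perturbation_gt0 k : 0 < c k.
Proof. by rewrite sqrtr_gt0 powR_gt0// arg_gt0. Qed.

(** Both sides are nonnegative, so their cubes are compared. The factor 1/p makes p^4 c^4 of order
    p^2, whence a distance bound linear in p. *)
Lemma perturbation_sqr k : c k ^+ 2 =
  perturbation_const * delta `^ (2 / 3) / p%:R * n k `^ (- (1 / 3)).
Proof.
apply/eqP; rewrite -(@eqrXn2 _ 3)//.
- rewrite perturbation_cube !exprMn exprVn !powR_expn.
  have -> : 3^-1 * 3%:R = 1 :> R by rewrite mulVf.
  have -> : 2 / 3 * 3%:R = 2%:R :> R by rewrite divfK.
  have -> : - (1 / 3) * 3%:R = -1 :> R by rewrite div1r mulNr mulVf.
  rewrite powR_mulrn ?(ltW delta0)// powRr1; last first.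
    by rewrite divr_ge0 ?(mulr_ge0 _ (sqr_ge0 K)) ?(mulr_ge0 _ (ltW a0)) ?(mulr_ge0 _ (ltW m0)).
  rewrite powR_inv1 ?(ltW (n0 k))// /stepsize; apply/eqP.
  by field; rewrite !gt_eqF.
- exact: sqr_ge0.
- by rewrite !mulr_ge0 ?powR_ge0// invr_ge0 ltW.
Qed.

Lemma perturbation_sqr_le k : c k ^+ 2 <= perturbation_const * delta `^ (2 / 3) / p%:R.
Proof.
rewrite perturbation_sqr ler_piMr ?mulr_ge0 ?powR_ge0// ?invr_ge0 ?(ltW p0)//.
rewrite -[leRHS](powRr0 (n k)) ler_powR//.
by rewrite (le_trans k01)// lerDr.
Qed.

End perturbation.
End rates.

Lemma littleo_powR (R : realType) (k0 s q r : R) : 0 < k0 -> 0 <= s -> q < r ->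
  0 <= q ->
  (fun k : nat => s * (k%:R + k0) `^ (- r) : R) =o_\oo
  (fun k : nat => k%:R `^ (- q) : R).
Proof.
move=> k00 s0 qr q0; apply/eqoP => eps eps0.
have rq0 : 0 < r - q by rewrite subr_gt0.
have r0 : 0 <= r by exact: le_trans q0 (ltW qr).
near=> k.
have k1 : 1 <= k%:R :> R by near: k; exact: nbhs_infty_ger.
have kp : 0 < k%:R :> R by exact: lt_le_trans k1.
have nk : k%:R <= k%:R + k0 by rewrite lerDl ltW.
(* From this index on, k^(r - q), the quotient of the two powers, is at least s / eps. *)
have kT : (s / eps) `^ (r - q)^-1 <= k%:R by near: k; exact: nbhs_infty_ger.
have keps : s / eps <= k%:R `^ (r - q).
  have -> : s / eps = ((s / eps) `^ (r - q)^-1) `^ (r - q).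
    by rewrite -powRrM mulVf ?gt_eqF// powRr1// divr_ge0// ltW.
  by apply: ge0_ler_powR; rewrite ?nnegrE ?powR_ge0 ?(ltW rq0) ?(ltW kp).
rewrite !ger0_norm ?mulr_ge0 ?powR_ge0//.
apply: (@le_trans _ _ (s * k%:R `^ (- r))).
  apply: ler_wpM2l => //; rewrite !powRN lef_pV2 ?posrE ?powR_gt0//; last exact: lt_le_trans nk.
  by apply: ge0_ler_powR; rewrite ?nnegrE ?(ltW kp) ?(ltW (lt_le_trans kp nk)).
have -> : k%:R `^ (- q) = k%:R `^ (r - q) * k%:R `^ (- r) :> R.
  rewrite -powRD; last by rewrite (gt_eqF kp) implybT.
  by congr (_ `^ _); lra.
rewrite mulrA ler_wpM2r ?powR_ge0//.
by move: keps; rewrite ler_pdivrMr// mulrC.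
Unshelve. all: by end_near.
Qed.

Lemma bigO_powR (R : realType) (k0 s q : R) : 0 < k0 -> 0 <= s -> 0 <= q ->
  (fun k : nat => s / (k%:R + k0) `^ q : R) =O_\oo
  (fun k : nat => k%:R `^ (- q) : R).
Proof.
move=> k00 s0 q0; apply/eqO_exP; exists (s + 1); first by rewrite ltr_wpDl.
near=> k.
have k1 : 1 <= k%:R :> R by near: k; exact: nbhs_infty_ger.
have kp : 0 < k%:R :> R by exact: lt_le_trans k1.
have nk : k%:R <= k%:R + k0 by rewrite lerDl ltW.
rewrite !ger0_norm ?divr_ge0 ?powR_ge0// powRN.
apply: ler_pM; rewrite ?invr_ge0 ?powR_ge0 ?lerDl//.
rewrite lef_pV2 ?posrE ?powR_gt0//; last exact: lt_le_trans nk.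
by apply: ge0_ler_powR; rewrite ?nnegrE ?(ltW kp) ?(ltW (lt_le_trans kp nk)).
Unshelve. all: by end_near.
Qed.

Lemma expe2_le (R : realType) (W : \bar R) (x : R) : (0 <= W)%E ->
  (W <= x%:E)%E -> (W ^+ 2 <= (x ^+ 2)%:E)%E.
Proof.
move=> W0 Wx; rewrite expe2 expr2 EFinM.
by apply: lee_pmul.
Qed.

Lemma wasserstein2_ge0 (R : realType) (p : nat) (mu nu : probability 'rV[R]_p R) :
  (0 <= wasserstein2 mu nu)%E.
Proof. by apply: le_ereal_inf_tmp => _ [gamma _ <-]; exact: poweR_ge0. Qed.

(** Between the all-ones vector and 0, the contraction inequality has a square on its left and the
    factor times p > 0 on its right, which forces the sign of the factor. *)
Lemma contraction_factor_ge0 (R : realType) (p : nat) (f : 'rV[R]_p -> R)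
    (m M h : R) : (0 < p)%N -> 0 < M -> strong_convexity f m ->
  gradient_lipschitz f M -> 0 <= h -> 0 <= 1 - 2 * m * h + M ^+ 2 * h ^+ 2.
Proof.
case: p f => // p f _ M0 f_convex f_lip h0.
have := gradient_step_contraction M0 f_convex f_lip (const_mx 1) 0 h0.
move=> /(le_trans (sqr_ge0 _)); rewrite subr0 norm2_sqE.
under eq_bigr do rewrite mxE expr1n.
by rewrite sumr_const card_ord pmulr_lge0.
Qed.

(** * Recursion for the prescribed step sizes and perturbations *)

Section recursion.
Context {R : realType} {p : nat} (f : 'rV[R]_p -> R) (m M M3 a k0 delta : R).
Hypotheses (m0 : 0 < m) (M0 : 0 < M) (M30 : 0 < M3) (a0 : 0 < a) (k01 : 1 <= k0).
Hypotheses (delta0 : 0 < delta) (p1 : (1 <= p)%N).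
Hypothesis f_convex : strong_convexity f m.
Hypothesis f_lip : gradient_lipschitz f M.
Hypothesis df : times_differentiable 3 f.
Hypothesis f_third : third_derivative_bound f M3.
Context {d : measure_display} {Omega : measurableType d} (P : probability Omega R).
Variables (X Delta xi : nat -> {RV P >-> 'rV[R]_p}) (epsp epsm : nat -> {RV P >-> R}).
Local Notation h := (stepsize a k0).
Local Notation c := (perturbation m M3 delta p h).
Local Notation n k := (k%:R + k0).
Hypothesis chain : noisy_lmc_spsa f h c X Delta xi epsp epsm.
Hypothesis noise : noise_assumption X Delta xi epsp epsm delta.
Variable pi : probability 'rV[R]_p R.
Hypothesis pi_gibbs : gibbs_measure f pi.

(** The number B of the overview; it involves only [m], [a] and [M3], so the leading constant is
    uniform in p and delta. *)
Definition noise_rate_const : R :=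
  (1 + m / 4 * a) * (5 * a * M3 ^+ 2 / m) * perturbation_const m M3 a ^+ 2.

Let n1 k : 1 <= n k.
Proof. by rewrite (le_trans k01)// lerDr. Qed.

Let n0 k : 0 < n k.
Proof. exact: lt_le_trans (n1 k). Qed.

Let h0 k : 0 < h k. Proof. exact: divr_gt0. Qed.

Let ha k : h k <= a.
Proof. by rewrite ler_pdivrMr// ler_peMr// ltW. Qed.

Let p0 : 0 < p%:R :> R. Proof. by rewrite ltr0n. Qed.

Let m4 : 0 < m / 4. Proof. exact: divr_gt0. Qed.

Let rate0 k : 0 <= drift_rate (p := p) m M (m / 4) (h k).
Proof.
have := contraction_factor_ge0 p1 M0 f_convex f_lip (ltW (h0 k)).
have k1 : 0 <= 1 + m / 4 * h k by rewrite addr_ge0// mulr_ge0// ltW.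
move=> /(mulr_ge0 k1) q0; apply: addr_ge0 => //.
have M2 := sqr_ge0 M; have h2 := sqr_ge0 (h k).
apply: mulr_ge0 => //; apply: mulr_ge0; first exact: mulr_ge0.
by rewrite addr_ge0// mulr_ge0// sqr_ge0.
Qed.

Let bias_noise k :
  h k / (m / 4) * (M3 ^+ 2 * c k ^+ 4 * p%:R ^+ 3) +
  h k ^+ 2 * (p%:R * delta ^+ 2 / (2 * c k ^+ 2)) <=
  5 * a * M3 ^+ 2 / m * perturbation_const m M3 a ^+ 2 *
    (delta `^ (2 / 3) * p%:R) ^+ 2 * n k `^ (- (2 / 3)) / n k.
Proof.
have c2 : 0 < c k ^+ 2 by rewrite exprn_gt0// perturbation_gt0.
have pR1 : 1 <= p%:R :> R by rewrite ler1n.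
have := bias_noise_le m0 M30 pR1 (ltW (h0 k)) c2
  (perturbation_cube m0 M30 a0 k01 delta0 p1 k).
rewrite -exprM => /le_trans; apply.
rewrite (exprM (c k) 2 2) (perturbation_sqr m0 M30 a0 k01 delta0 p1).
have -> : n k `^ (- (2 / 3)) = (n k `^ (- (1 / 3))) ^+ 2.
  by rewrite powR_expn; congr (_ `^ _); lra.
rewrite le_eqVlt; apply/orP; left; apply/eqP; rewrite /stepsize.
by field; rewrite !gt_eqF.
Qed.

(** The weight eta is m/4. [K] collects the terms of order h^2 and may depend on p, delta and the
    moments; the noise term is kept apart because 1 / c_k^2 grows, and joins the bias at order
    n^(-5/3). *)
Lemma coupled_within_recursion : exists2 K : R, 0 <= K &
  forall k e, coupled_within X Delta xi epsp epsm pi k e ->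
  coupled_within X Delta xi epsp epsm pi k.+1
    ((1 - 3 / 2 * m * a / n k + K / n k ^+ 2) * e +
      noise_rate_const * (delta `^ (2 / 3) * p%:R) ^+ 2 * n k `^ (- (2 / 3)) / n k +
      K / n k ^+ 2).
Proof.
have mf : measurable_fun setT f.
  by apply: continuous_measurable_rV => x; apply: differentiable_continuous; case: df.
have mgrad : measurable_fun setT (grad f).
  apply: measurable_fun_rV => i; under eq_fun do rewrite mxE.
  apply: continuous_measurable_rV => x; apply: differentiable_continuous.
  by case: df => _ /(_ i)[].
have [_ g6oo] := gibbs_sixth_moment m0 M0 f_convex f_lip mf mgrad pi_gibbs.
have g6_ge0 : (0 <= \int[pi]_y (norm2 (grad f y) ^+ 6)%:E)%E.
  by apply: integral_ge0 => y _; rewrite lee_fin exprn_ge0// norm2_ge0.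
pose g6 := fine (\int[pi]_y (norm2 (grad f y) ^+ 6)%:E)%E.
have g6E : (\int[pi]_y (norm2 (grad f y) ^+ 6)%:E <= g6%:E)%E.
  by rewrite fineK// ge0_fin_numE.
have g60 : 0 <= g6 by rewrite fine_ge0.
have [n6 n6P] := @gaussian_sixth_moment R p.
have n6E k : (\int[P]_w (norm2 (xi k w) ^+ 6)%:E <= n6%:E)%E.
  have := n6P (distribution P (xi k)) (fun A mA => spsa_gauss chain k mA).
  rewrite (ge0_integral_distribution (xi k) (f := fun v => (norm2 v ^+ 6)%:E))//.
  - by apply/measurable_EFinP; exact: measurable_norm2_6.
  - by move=> v; rewrite lee_fin exprn_ge0// norm2_ge0.
have n60 : 0 <= n6.
  rewrite -lee_fin; apply: le_trans (n6E 0%N); apply: integral_ge0 => y _.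
  by rewrite lee_fin exprn_ge0// norm2_ge0.
have err0 := mala_error_const_ge0 M0 m4 (h0 0%N) (ha 0%N).
(* Bound for c_k^2 uniform in k, as n k >= 1. *)
pose U := perturbation_const m M3 a * delta `^ (2 / 3) / p%:R.
pose KB := (8 * p%:R ^+ 2 + 4) * (1 + g6) + 4 * M ^+ 2 * U * p%:R ^+ 3.
pose KC := (1 + m / 4 * a) * KB + mala_error_const M a (m / 4) * (1 + g6 + n6).
pose KR := drift_rate_const p m M a.
have U0 : 0 <= U by rewrite !mulr_ge0 ?powR_ge0// invr_ge0 ltW.
have p3 : 0 <= p%:R ^+ 3 :> R by exact: exprn_ge0.
have M2 : 0 <= 4 * M ^+ 2 by rewrite mulr_ge0// sqr_ge0.
have p2 : 0 <= 8 * p%:R ^+ 2 + 4 :> R by rewrite addr_ge0// mulr_ge0// sqr_ge0.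
have KB0 : 0 <= KB.
  by apply: addr_ge0; apply: mulr_ge0 => //; [rewrite addr_ge0|exact: mulr_ge0].
have k1 : 0 <= 1 + m / 4 * a by rewrite addr_ge0// mulr_ge0// ltW.
have KC0 : 0 <= KC.
  apply: addr_ge0; first exact: mulr_ge0.
  by rewrite mulr_ge0// addr_ge0// addr_ge0.
have KR0 : 0 <= KR by exact: drift_rate_const_ge0 m0 (ltW (h0 0%N)) (ha 0%N).
(* Since h k = a / n k, the factor a^2 converts coefficients of h^2 into coefficients of 1 / n^2. *)
exists (a ^+ 2 * (KR + KC)); first by rewrite mulr_ge0 ?sqr_ge0// addr_ge0.
move=> k e ke; have e0 := coupled_within_ge0 ke.
have := coupled_withinS m0 M0 f_convex f_lip df f_third chain noise pi_gibbs ke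
  m4 (h0 k) (ha k) (perturbation_gt0 m0 M30 a0 k01 delta0 p1 k) g6E (n6E k) (rate0 k).
set e' := (X in coupled_within _ _ _ _ _ _ _ X) => ke'.
apply: coupled_within_le ke'.
have -> : a ^+ 2 * (KR + KC) / n k ^+ 2 = (KR + KC) * h k ^+ 2.
  by rewrite /stepsize; field; rewrite gt_eqF.
have -> : 3 / 2 * m * a / n k = 3 / 2 * m * h k.
  by rewrite /stepsize; field; rewrite gt_eqF.
have x2 : 0 <= h k ^+ 2 by exact: sqr_ge0.
have kx0 : 0 <= 1 + m / 4 * h k by rewrite addr_ge0// mulr_ge0// ltW.
have kx : 1 + m / 4 * h k <= 1 + m / 4 * a.
  by rewrite lerD2l; apply: ler_wpM2l; [exact: ltW|exact: ha].
have s1 := ler_wpM2r e0 (@drift_rate_le R p m M a (h k) m0 (ltW (h0 k)) (ha k)).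
have bn := bias_noise k.
have Uk : 4 * M ^+ 2 * c k ^+ 2 * p%:R ^+ 3 <= 4 * M ^+ 2 * U * p%:R ^+ 3.
  apply: ler_wpM2r => //; apply: ler_wpM2l => //.
  exact: (perturbation_sqr_le m0 M30 a0 k01 delta0 p1).
have s2 : (1 + m / 4 * h k) * (h k ^+ 2 * ((8 * p%:R ^+ 2 + 4) * (1 + g6) +
    4 * M ^+ 2 * c k ^+ 2 * p%:R ^+ 3)) <= (1 + m / 4 * a) * (h k ^+ 2 * KB).
  apply: ler_pM => //; last by apply: ler_wpM2l => //; rewrite lerD2l.
  apply: mulr_ge0 => //; apply: addr_ge0; first by rewrite mulr_ge0// addr_ge0.
  by apply: mulr_ge0 => //; apply: mulr_ge0 => //; exact: sqr_ge0.
have s3 : (1 + m / 4 * h k) * (h k / (m / 4) * (M3 ^+ 2 * c k ^+ 4 * p%:R ^+ 3) +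
    h k ^+ 2 * (p%:R * delta ^+ 2 / (2 * c k ^+ 2))) <=
    noise_rate_const * (delta `^ (2 / 3) * p%:R) ^+ 2 * n k `^ (- (2 / 3)) / n k.
  have -> : noise_rate_const * (delta `^ (2 / 3) * p%:R) ^+ 2 * n k `^ (- (2 / 3)) / n k =
    (1 + m / 4 * a) * (5 * a * M3 ^+ 2 / m * perturbation_const m M3 a ^+ 2 *
    (delta `^ (2 / 3) * p%:R) ^+ 2 * n k `^ (- (2 / 3)) / n k).
    by rewrite /noise_rate_const !mulrA.
  apply: ler_pM => //; apply: addr_ge0; apply: mulr_ge0.
  - by rewrite divr_ge0 ?(ltW m4) ?(ltW (h0 k)).
  - apply: mulr_ge0 => //; apply: mulr_ge0; first exact: sqr_ge0.
    by rewrite exprn_ge0// sqrtr_ge0.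
  - exact: sqr_ge0.
  - by rewrite divr_ge0// mulr_ge0// sqr_ge0.
have xe : 0 <= h k ^+ 2 * (KC * e) by rewrite mulr_ge0// mulr_ge0.
have xr : 0 <= h k ^+ 2 * KR by rewrite mulr_ge0.
rewrite /e' /drift_bias.
move: s1 s2 s3 xe; rewrite -/KR /KC.
move: (drift_rate _ _ _ _) (noise_rate_const * _ * _ / _) (h k / _ * _)
  (h k ^+ 2 * (p%:R * _ / _)) (4 * M ^+ 2 * c k ^+ 2 * p%:R ^+ 3)
  (8 * p%:R ^+ 2 + 4) (mala_error_const _ _ _) => rho N b1 b2 b3 p8 E.
lra.
Qed.
End recursion.

(** [C] is fixed before p and delta, so the leading term displays the whole dependence on both; [D]
    also absorbs the remainder, whose constant may depend on the full problem. *)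
Theorem theorem6 (R : realType) (m M M3 a k0 : R) (M1 : nat -> R)
    (m_gt0 : 0 < m) (M_gt0 : 0 < M) (M3_gt0 : 0 < M3)
    (M1_gt0 : forall p : nat, (1 <= p)%N -> 0 < M1 p)
    (M1_linear : M1 =O_\oo (fun p : nat => p%:R : R))
    (a_gt : 2 / (3 * m) < a)
    (k0_ge : Num.max 1 (a * (m + M) / 2) <= k0) :
  exists2 C : R, 0 < C &
  forall (p : nat) (delta : R) (f : 'rV[R]_p -> R) (pi : probability 'rV[R]_p R)
    (d : measure_display) (Omega : measurableType d) (P : probability Omega R)
    (X Delta xi : nat -> {RV P >-> 'rV[R]_p})
    (epsp epsm : nat -> {RV P >-> R}),
  let h := stepsize a k0 in
  let c := perturbation m M3 delta p h in
  let W k := wasserstein2 (distribution P (X k)) pi in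
  (1 <= p)%N -> 0 < delta ->
  times_differentiable 3 f ->
  gibbs_measure f pi ->
  noisy_lmc_spsa f h c X Delta xi epsp epsm ->
  (W 0%N < +oo)%E ->
  strong_convexity f m ->
  gradient_lipschitz f M ->
  third_derivative_bound f M3 ->
  gradient_moment_bound f X (M1 p) ->
  noise_assumption X Delta xi epsp epsm delta ->
  exists2 D : R, 0 < D &
    [/\ (forall k : nat,
           (W k ^+ 2 <= (D / (k%:R + k0) `^ (2 / 3))%:E)%E /\
           (W k <= (Num.sqrt D / (k%:R + k0) `^ (1 / 3))%:E)%E),
        (fun k : nat => Num.sqrt D / (k%:R + k0) `^ (1 / 3) : R) =O_\oo
          (fun k : nat => k%:R `^ (- (1 / 3)) : R) &
        exists2 r : nat -> R,
          r =o_\oo (fun k : nat => k%:R `^ (- (1 / 3)) : R) &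
          forall k : nat,
            (W k <= (C * delta `^ (2 / 3) * p%:R / (k%:R + k0) `^ (1 / 3)
                     + r k)%:E)%E /\
            C * delta `^ (2 / 3) * p%:R / (k%:R + k0) `^ (1 / 3) + r k
              <= Num.sqrt D / (k%:R + k0) `^ (1 / 3)].
Proof.
have a0 : 0 < a by apply: lt_trans a_gt; rewrite divr_gt0// mulr_gt0.
have k01 : 1 <= k0 by apply: le_trans k0_ge; rewrite le_max lexx.
pose B := @noise_rate_const R m M3 a.
have B0 : 0 < B.
  have u0 := perturbation_const_gt0 m_gt0 M3_gt0 a0.
  rewrite mulr_gt0 ?exprn_gt0// mulr_gt0//; first by rewrite addr_gt0// mulr_gt0// divr_gt0.
  by rewrite divr_gt0// mulr_gt0 ?exprn_gt0// mulr_gt0.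
(* The square root of 4 b, stripped of its factor delta^(2/3) p. *)
pose C := 2 * Num.sqrt B.
have C0 : 0 < C by rewrite mulr_gt0// sqrtr_gt0.
exists C => // p delta f pi d Omega P X Delta xi epsp epsm h c W p1 delta0 df
  pi_gibbs chain W0 f_convex f_lip f_third _ noise.
have [K K0 rec] := coupled_within_recursion m_gt0 M_gt0 M3_gt0 a0 k01 delta0 p1
  f_convex f_lip df f_third chain noise pi_gibbs.
have [e0 e0P] := coupled_within0 m_gt0 M_gt0 f_convex f_lip df Delta xi epsp epsm pi_gibbs W0.
pose n k : R := k%:R + k0.
have n1 k : 1 <= n k by rewrite (le_trans k01)// lerDr.
have n0 k : 0 < n k by exact: lt_le_trans (n1 k).
pose b := B * (delta `^ (2 / 3) * p%:R) ^+ 2.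
(* The recursion taken with equality: a sequence of admissible bounds started from any bound at time
   0. *)
pose e := fix e (k : nat) : R := if k is j.+1 then
  (1 - 3 / 2 * m * a / n j + K / n j ^+ 2) * e j +
  b * n j `^ (- (2 / 3)) / n j + K / n j ^+ 2 else e0.
have eP k : coupled_within X Delta xi epsp epsm pi k (e k).
  by elim: k => [//|k IH]; exact: rec.
(* This is where a > 2 / (3 m) enters. *)
have lam1 : 1 <= 3 / 2 * m * a.
  by move: a_gt; rewrite ltr_pdivrMr ?mulr_gt0// => H; lra.
have b0 : 0 <= b by rewrite mulr_ge0 ?sqr_ge0// ltW.
have [K' K'0 eK'] := recursion_bound k01 lam1 b0 K0
  (fun k => coupled_within_ge0 (eP k)) (fun k => lexx _).
pose A := C * delta `^ (2 / 3) * p%:R.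
have A0 : 0 <= A by rewrite !mulr_ge0 ?powR_ge0// ltW.
have A2 : A ^+ 2 = 4 * b.
  rewrite /A /C /b !exprMn sqr_sqrtr ?(ltW B0)//; ring.
pose S := Num.sqrt K'.
have S0 : 0 < S by rewrite sqrtr_gt0.
(* Square root of the remainder K' n^(-5/6), negligible since 5/12 > 1/3. *)
pose r k := S * n k `^ (- (5 / 12)).
have r0 k : 0 <= r k by rewrite mulr_ge0 ?powR_ge0// ltW.
have An0 k : 0 <= A / n k `^ (1 / 3) by rewrite divr_ge0 ?powR_ge0.
have WA k : (W k <= (A / n k `^ (1 / 3) + r k)%:E)%E.
  apply: (le_trans (wasserstein2_le (eP k))); rewrite lee_fin.
  rewrite -[leRHS]ger0_norm ?addr_ge0// -sqrtr_sqr ler_wsqrtr//.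
  apply: (le_trans (eK' k)); rewrite -A2 sqrrD.
  have -> : (A / n k `^ (1 / 3)) ^+ 2 = A ^+ 2 * n k `^ (- (2 / 3)).
    rewrite exprMn -powRN powR_expn; congr (_ * _ `^ _); lra.
  have -> : r k ^+ 2 = K' * n k `^ (- (5 / 6)).
    rewrite exprMn sqr_sqrtr ?(ltW K'0)// powR_expn; congr (_ * _ `^ _); lra.
  (* The cross term of the square is nonnegative and is dropped: sqrt(x^2 + y^2) <= x + y. *)
  by rewrite -addrA lerD2l lerDr mulrn_wge0// mulr_ge0.
have AS k : A / n k `^ (1 / 3) + r k <= (A + S) / n k `^ (1 / 3).
  rewrite mulrDl lerD2l ler_wpM2l ?(ltW S0)// -powRN ler_powR//; lra.
have AS0 : 0 < A + S by rewrite ltr_wpDl.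
have sqrtD : Num.sqrt ((A + S) ^+ 2) = A + S by rewrite sqrtr_sqr gtr0_norm.
have WAS k : (W k <= ((A + S) / n k `^ (1 / 3))%:E)%E.
  by apply: (le_trans (WA k)); rewrite lee_fin.
(* As n k >= 1, the remainder is at most S n^(-1/3), so A + S bounds everything by a single
   power. *)
exists ((A + S) ^+ 2); first by rewrite exprn_gt0.
rewrite sqrtD; split.
- move=> k; split; last exact: WAS.
  have -> : (A + S) ^+ 2 / n k `^ (2 / 3) = ((A + S) / n k `^ (1 / 3)) ^+ 2.
    rewrite exprMn exprVn powR_expn; congr (_ / _ `^ _); lra.
  exact: expe2_le (wasserstein2_ge0 _ _) (WAS k).
- by apply: bigO_powR; rewrite ?(lt_le_trans _ k01) ?(ltW AS0).
- exists r => [|k]; last by split; [exact: WA|exact: AS].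
  apply: littleo_powR; rewrite ?(lt_le_trans _ k01) ?(ltW S0)//; lra.
Qed.
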